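(* Let $\{X_k\}_{k\in\mathbb{Z}}$ be a $q$-variate stationary process which has a spectral density $w$ with $\log\det w\in L_1(\mathbb{T})$, and suppose that $M_{(-\infty,-1]}^X\cap M_{[-n,\infty)}^X=M_{[-n,-1]}^X$ for all $n=1,2,\dots$. Then, for every $n\in\mathbb{N}$, $$\phi_{n,n}=c_0\sum_{k=0}^\infty\Bigl(\sum_{j=0}^\infty b_{n,j}^{2k}\beta_{n+j}\Bigr)\tilde{c}_0^{-1},\qquad \tilde{\phi}_{n,n}=\tilde{c}_0\sum_{k=0}^\infty\Bigl(\sum_{j=0}^\infty\tilde{b}_{n,j}^{2k}\beta_{n+j}^*\Bigr)c_0^{-1}.$$
   Context: Stationary processes. Let $q\in\mathbb{N}$. A $q$-variate stationary process $\{X_k\}_{k\in\mathbb{Z}}$ is a $\mathbb{C}^q$-valued, centered, weakly stationary process on a probability space, $X_k=(X_k^1,\dots,X_k^q)^{\mathrm T}$. $M$ is the closed complex linear span in $L^2(\Omega,\mathcal F,P)$ of all entries $X_k^j$, with inner product $(x,y)_M=E[x\overline{y}]$. For $K\subset\mathbb{Z}$ (e.g. $(-\infty,n]$, $[n,\infty)$, $[m,n]$, all understood as sets of integers), $M_K^X$ is the closed linear span of $\{X_k^j:1\le j\le q,\ k\in K\}$, and $P_K$, $P_K^\perp$ are the orthogonal projections of $M$ onto $M_K^X$ and $(M_K^X)^\perp$; they act entrywise on $M^q$, the space of $\mathbb{C}^q$-valued random vectors with entries in $M$. For $x,y\in M^q$, $\langle x,y\rangle:=E[xy^*]\in\mathbb{C}^{q\times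 q}$. $\mathbb{T}$ is the unit circle, $\mathbb{D}$ the open unit disk. A spectral density of $\{X_k\}$ is a positive-semidefinite-Hermitian-matrix-valued $w\in L_1^{q\times q}(\mathbb{T})$ with $\langle X_m,X_n\rangle=\int_{-\pi}^{\pi}e^{-i(m-n)\theta}w(e^{i\theta})\frac{d\theta}{2\pi}$. Outer factors. Assume $\log\det w\in L_1(\mathbb{T})$. Put $\tilde w(e^{i\theta})=w(e^{-i\theta})$, the spectral density of the time-reversed process $\tilde X_k:=X_{-k}$. Fix outer functions $h,\tilde h\in H_2^{q\times q}(\mathbb{T})$ with $w=hh^*$, $\tilde w=\tilde h\tilde h^*$ a.e. (they exist and are unique up to right constant unitary factors); here $H_2^{q\times q}$ is the matrix-valued Hardy class (functions identified with their holomorphic extensions to $\mathbb{D}$) and $f\in H_2^{q\times q}$ is outer if $\log|\det f(0)|=\int_{-\pi}^{\pi}\log|\det f(e^{i\theta})|\frac{d\theta}{2\pi}$. Put $h_\sharp(z):=\{\tilde h(\overline z)\}^*$, so that $w=h_\sharp^*h_\sharp$ a.e. Set $c_0:=h(0)$, $\tilde c_0:=\tilde h(0)$, and $$\beta_k:=-\int_{-\pi}^{\pi}e^{-ik\theta}h(e^{i\theta})^*h_\sharp(e^{i\theta})^{-1}\frac{d\theta}{2\pi},\qquad k\in\mathbb{Z}.$$ Sequences $b,\tilde b$. For $n\in\mathbb{N}$, the square-summable $\mathbb{C}^{q\times q}$-valued sequences $\{b_{n,j}^k\}_{j\ge0}$ and $\{\tilde b_{n,j}^k\}_{j\ge0}$,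 $k=0,1,2,\dots$, are defined recursively by $$b_{n,j}^0=\delta_{0j}I_q,\quad b_{n,j}^{2k+1}=\sum_{l=0}^\infty b_{n,l}^{2k}\beta_{n+j+l+1},\quad b_{n,j}^{2k+2}=\sum_{l=0}^\infty b_{n,l}^{2k+1}\beta_{n+j+l+1}^*,$$ $$\tilde b_{n,j}^0=\delta_{0j}I_q,\quad \tilde b_{n,j}^{2k+1}=\sum_{l=0}^\infty\tilde b_{n,l}^{2k}\beta_{n+j+l+1}^*,\quad \tilde b_{n,j}^{2k+2}=\sum_{l=0}^\infty\tilde b_{n,l}^{2k+1}\beta_{n+j+l+1}.$$ Finite predictor coefficients. $\phi_{n,k},\tilde\phi_{n,k}\in\mathbb{C}^{q\times q}$ ($1\le k\le n$) are the (unique) matrices with $$P_{[-n,-1]}X_0=\phi_{n,1}X_{-1}+\cdots+\phi_{n,n}X_{-n},\qquad P_{[-n,-1]}X_{-(n+1)}=\tilde\phi_{n,1}X_{-n}+\cdots+\tilde\phi_{n,n}X_{-1}.$$ *)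

(* Defs.v *)
From HB Require Import structures.
From mathcomp Require Import all_boot all_order all_algebra.
From mathcomp Require Import spectral sesquilinear complex.
From mathcomp Require Import all_classical all_reals all_analysis.

Set Implicit Arguments.
Unset Strict Implicit.
Unset Printing Implicit Defensive.

Import Order.TTheory GRing.Theory Num.Theory.
Import numFieldNormedType.Exports.

Local Open Scope classical_set_scope.
Local Open Scope complex_scope.
Local Open Scope sesquilinear_scope.
Local Open Scope ring_scope.

(* Adjoint of a matrix, with the conjugation of the [numClosedFieldType]
   structure of [R[i]]. *)
Definition adjmx (R : realType) (m n : nat) (A : 'M[R[i]]_(m, n)) :
  'M[R[i]]_(n, m) := A ^t*.

Definition psdmx (R : realType) (q : nat) (A : 'M[R[i]]_q) : Prop :=
  adjmx A = A /\ forall v : 'cV[R[i]]_q, 0 <= (adjmx v *m A *m v) 0 0.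

Definition expi (R : realType) (x : R) : R[i] := cos x +i* sin x.

(** Integration of complex-valued functions: [R[i]] carries no measurable
    structure in the library, so measurability and integrals are taken on
    real and imaginary parts; [normc] is the [R]-valued modulus. *)

Definition cintegral d (T : measurableType d) (R : realType)
    (mu : {measure set T -> \bar R}) (D : set T) (f : T -> R[i]) : R[i] :=
  (\int[mu]_(x in D) complex.Re (f x)) +i* (\int[mu]_(x in D) complex.Im (f x)).

Definition cmeasurable d (T : measurableType d) (R : realType)
    (D : set T) (f : T -> R[i]) : Prop :=
  measurable_fun D (fun x => complex.Re (f x)) /\
  measurable_fun D (fun x => complex.Im (f x)).

Definition inL1 d (T : measurableType d) (R : realType)
    (mu : {measure set T -> \bar R}) (D : set T) (f : T -> R[i]) : Prop :=
  cmeasurable D f /\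
  mu.-integrable D (fun x => (ComplexField.Normc.normc (f x))%:E).

Definition inL2 d (T : measurableType d) (R : realType)
    (mu : {measure set T -> \bar R}) (D : set T) (f : T -> R[i]) : Prop :=
  cmeasurable D f /\
  mu.-integrable D (fun x => (ComplexField.Normc.normc (f x) ^+ 2)%:E).

(** The unit circle, parametrized by [-pi, pi] through [expi]. *)

Definition circle_arc (R : realType) : set R := `[- pi, pi]%classic.

Definition ae_circle (R : realType) (Q : R[i] -> Prop) : Prop :=
  {ae @lebesgue_measure R, forall x, circle_arc x -> Q (expi x)}.

(* Entrywise integral against dtheta / (2 pi). *)
Definition circle_int (R : realType) (q : nat) (F : R -> 'M[R[i]]_q) :
    'M[R[i]]_q :=
  \matrix_(i, j)
    (((2 * pi)^-1)%:C * cintegral (@lebesgue_measure R) (@circle_arc R) (fun x => F x i j)).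

Definition inL1_circle (R : realType) (q : nat) (w : R[i] -> 'M[R[i]]_q) : Prop :=
  forall i j, inL1 (@lebesgue_measure R) (@circle_arc R) (fun x => w (expi x) i j).

(** Stationary processes. *)

(* <x, y> = E[x y^*] *)
Definition gram d (T : measurableType d) (R : realType) (P : probability T R)
    (q : nat) (x y : T -> 'cV[R[i]]_q) : 'M[R[i]]_q :=
  \matrix_(i, j) cintegral P setT (fun t => (x t *m adjmx (y t)) i j).

Record stationary d (T : measurableType d) (R : realType) (P : probability T R)
    (q : nat) (X : int -> T -> 'cV[R[i]]_q) : Prop := Stationary {
  stationary_L2 : forall k j, inL2 P setT (fun t => X k t j 0) ;
  stationary_centered :
    forall k j, cintegral P setT (fun t => X k t j 0) = 0 ;
  stationary_gram :
    forall m n l, gram P (X (m + l)) (X (n + l)) = gram P (X m) (X n) }.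

Definition spectral_density d (T : measurableType d) (R : realType)
    (P : probability T R) (q : nat) (X : int -> T -> 'cV[R[i]]_q)
    (w : R[i] -> 'M[R[i]]_q) : Prop :=
  [/\ inL1_circle w, ae_circle (fun z => psdmx (w z)) &
    forall m n : int, gram P (X m) (X n) =
      circle_int (fun x => expi (- ((m - n)%:~R * x)) *: w (expi x))].

(* [lne] is the logarithm with log 0 = -oo, so integrability forces
   det w > 0 almost everywhere. *)
Definition logdet_L1 (R : realType) (q : nat) (w : R[i] -> 'M[R[i]]_q) : Prop :=
  (@lebesgue_measure R).-integrable (@circle_arc R)
    (fun x => lne (complex.Re (\det (w (expi x))))%:E).

(* M_K^X, as the set of all representatives of its elements: it is saturated
   under almost sure equality, and closure is for the L2 distance. *)
Definition Mspan d (T : measurableType d) (R : realType) (P : probability T R)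
    (q : nat) (X : int -> T -> 'cV[R[i]]_q) (K : set int) : set (T -> R[i]) :=
  [set f | inL2 P setT f /\ forall e : R, 0 < e ->
    exists s : seq (R[i] * int * 'I_q),
      (forall a, a \in s -> K a.1.2) /\
      (\int[P]_t ((ComplexField.Normc.normc
          (f t - \sum_(a <- s) a.1.1 * X a.1.2 t a.2 0)) ^+ 2)%:E < e%:E)%E].

(* y is (a version of) P_K x, entrywise. *)
Definition is_proj d (T : measurableType d) (R : realType) (P : probability T R)
    (q : nat) (X : int -> T -> 'cV[R[i]]_q) (K : set int)
    (x y : T -> 'cV[R[i]]_q) : Prop :=
  forall i, Mspan P X K (fun t => y t i 0) /\
    forall z, Mspan P X K z ->
      cintegral P setT (fun t => (x t i 0 - y t i 0) * (z t)^*) = 0.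

Definition forward_coeffs d (T : measurableType d) (R : realType)
    (P : probability T R) (q : nat) (X : int -> T -> 'cV[R[i]]_q)
    (n : nat) (phi : nat -> 'M[R[i]]_q) : Prop :=
  is_proj P X [set k | - n%:Z <= k <= -1] (X 0)
    (fun t => \sum_(1 <= k < n.+1) phi k *m X (- k%:Z) t).

(* The k-th coefficient multiplies X_{-(n + 1 - k)}. *)
Definition backward_coeffs d (T : measurableType d) (R : realType)
    (P : probability T R) (q : nat) (X : int -> T -> 'cV[R[i]]_q)
    (n : nat) (phit : nat -> 'M[R[i]]_q) : Prop :=
  is_proj P X [set k | - n%:Z <= k <= -1] (X (- n.+1%:Z))
    (fun t => \sum_(1 <= k < n.+1) phit k *m X (- (n.+1%:Z - k%:Z)) t).

(** Hardy class and outer functions: one function on the closed disk stands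
    for the holomorphic function on the open disk together with its boundary
    function (a measurable version of the radial limits). [derivable f z 1]
    over the field [R[i]] is complex differentiability. *)

Definition hardy2 (R : realType) (f : R[i] -> R[i]) : Prop :=
  [/\ forall z : R[i]^o, `|z| < 1 -> derivable (f : R[i]^o -> R[i]^o) z 1,
    exists C : R, forall r : R, 0 <= r < 1 ->
      (\int[@lebesgue_measure R]_(x in @circle_arc R)
        ((ComplexField.Normc.normc (f (r%:C * expi x))) ^+ 2)%:E <= C%:E)%E,
    inL2 (@lebesgue_measure R) (@circle_arc R) (fun x => f (expi x)) &
    {ae @lebesgue_measure R, forall x, circle_arc x ->
      (f (r%:C * expi x) : R[i]^o) @[r --> (1 : R)^'-] --> (f (expi x) : R[i]^o)}].

Definition hardy2mx (R : realType) (q : nat) (f : R[i] -> 'M[R[i]]_q) : Prop :=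
  forall i j, hardy2 (fun z => f z i j).

Definition outer (R : realType) (q : nat) (f : R[i] -> 'M[R[i]]_q) : Prop :=
  hardy2mx f /\
  lne (ComplexField.Normc.normc (\det (f 0)))%:E =
    (((2 * pi)^-1)%:E * \int[@lebesgue_measure R]_(x in @circle_arc R)
       lne (ComplexField.Normc.normc (\det (f (expi x))))%:E)%E.

(* f is an outer function with w = f f^* a.e. *)
Definition outer_factor (R : realType) (q : nat) (w f : R[i] -> 'M[R[i]]_q) :
    Prop :=
  outer f /\ ae_circle (fun z => w z = f z *m adjmx (f z)).

Definition time_reversal (R : realType) (q : nat) (w : R[i] -> 'M[R[i]]_q) :
    R[i] -> 'M[R[i]]_q :=
  fun z => w z^*.

Definition hsharp (R : realType) (q : nat) (ht : R[i] -> 'M[R[i]]_q) :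
    R[i] -> 'M[R[i]]_q :=
  fun z => adjmx (ht z^*).

Definition beta_coef (R : realType) (q : nat) (h ht : R[i] -> 'M[R[i]]_q) (k : int) :
    'M[R[i]]_q :=
  - circle_int (fun x => expi (- (k%:~R * x)) *:
      (adjmx (h (expi x)) *m invmx (hsharp ht (expi x)))).

(** Series of matrices. The topology of the field [R[i]] sits on its alias
    [R[i]^o]. *)

Definition mxsummable (R : realType) (q : nat) (u : nat -> 'M[R[i]]_q) : Prop :=
  cvgn (series u : nat -> 'M[R[i]^o]_q).

Definition mxsum (R : realType) (q : nat) (u : nat -> 'M[R[i]]_q) : 'M[R[i]]_q :=
  limn (series u : nat -> 'M[R[i]^o]_q).

(** [bcoef B n k j] is b_{n,j}^k and [btcoef B n k j] is its tilde version, for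
    the sequence [B] in the role of beta. *)

Fixpoint bcoef (R : realType) (q : nat) (B : int -> 'M[R[i]]_q) (n k : nat) :
    nat -> 'M[R[i]]_q :=
  if k isn't k'.+1 then fun j => if j == 0%N then 1%:M else 0
  else fun j => mxsum (fun l =>
    bcoef B n k' l *m
      (if odd k' then adjmx (B (n + j + l + 1)%N) else B (n + j + l + 1)%N)).

Fixpoint btcoef (R : realType) (q : nat) (B : int -> 'M[R[i]]_q) (n k : nat) :
    nat -> 'M[R[i]]_q :=
  if k isn't k'.+1 then fun j => if j == 0%N then 1%:M else 0
  else fun j => mxsum (fun l =>
    btcoef B n k' l *m
      (if odd k' then B (n + j + l + 1)%N else adjmx (B (n + j + l + 1)%N))).

(* A = L (sum_k sum_j u k j) M, the iterated series being convergent. *)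
Definition eq_double_series (R : realType) (q : nat) (A L M : 'M[R[i]]_q)
    (u : nat -> nat -> 'M[R[i]]_q) : Prop :=
  [/\ forall k, mxsummable (u k), mxsummable (fun k => mxsum (u k)) &
    A = L *m mxsum (fun k => mxsum (u k)) *m M].

(* Main.v *)
(* Under the isomorphism X_k -> e^{-ikt} h(e^{it}) (rows of h) everything takes place
   in L2 of the circle. As h is outer, the orthonormal rows u_l = e^{-ilt} e_j, l >= 0,
   complement the closed span of the past X_k, k <= -1; the factor
   U = ht(e^{-it})^-1 h(e^{it}) is unitary, and the rows v_l = e^{i(n+1+l)t} U complement
   in the same way the closed span of the future X_k, k >= -n. The inner products
   <u_l, v_j> are -beta_{n+1+l+j}. By the intersection property the predictor is the
   limit of alternating projections onto the past and the future (von Neumann);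
   expanding each projection in (u_l) or (v_l) produces the recursion for b, and
   pairing with e^{int} U isolates phi_{n,n} ht(0).

   That outer factors yield the innovations is proved as follows: the normalized
   innovation has, by uniqueness of Fourier coefficients, a constant Gram matrix on the
   circle, and Jensen's inequality for log |det| forces it to be a constant matrix. *)
Require Import Defs.
From HB Require Import structures.
From mathcomp Require Import all_boot all_order all_algebra.
From mathcomp Require Import spectral sesquilinear complex.
From mathcomp Require Import all_classical all_reals all_analysis.
From mathcomp Require Import measurable_realfun.
From mathcomp Require Import ring lra zify.

Set Implicit Arguments.
Unset Strict Implicit.
Unset Printing Implicit Defensive.

Import Order.TTheory GRing.Theory Num.Theory.
Import numFieldNormedType.Exports.

Local Open Scope classical_set_scope.
Local Open Scope ring_scope.

Import ComplexField.Normc.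

(** [outer] is an equality of means of log |det| and says nothing about closed spans, so the
    innovation has to be identified by inequalities. Jensen's inequality bounds the determinant of
    the innovation's Gram matrix by |det h(0)|^2, the arithmetic-geometric mean turns this into a
    bound on a trace, and the trace leaves no room for the innovation to differ from its mean h(0).
    The determinants may vanish on the circle; every logarithm is therefore taken after adding a
    positive constant, removed only at the end by dominated convergence.

    Vectors are functions and not classes: projections and limits are unique up to null vectors, and
    the passage between the process and the circle is a relation built on equal Gram matrices.

    The series has no alternating signs because two signs cancel: the k-th residual carries (-1)^k
    from the inner products -beta, and it enters the k-th iterate of the alternating projections
    with the factor (-1)^k. The second formula is the first one with past and future, u and v, beta
    and its adjoint exchanged. *)

Notation Re := complex.Re.
Notation Im := complex.Im.

(** * Complex-valued integrals *)

Section complex_facts.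
Context {R : realType}.
Implicit Types z u : R[i].

Lemma ReD z u : Re (z + u) = Re z + Re u. Proof. by case: z u => ? ? []. Qed.
Lemma ImD z u : Im (z + u) = Im z + Im u. Proof. by case: z u => ? ? []. Qed.
Lemma ReN z : Re (- z) = - Re z. Proof. by case: z. Qed.
Lemma ImN z : Im (- z) = - Im z. Proof. by case: z. Qed.
Lemma ReB z u : Re (z - u) = Re z - Re u. Proof. by rewrite ReD ReN. Qed.
Lemma ImB z u : Im (z - u) = Im z - Im u. Proof. by rewrite ImD ImN. Qed.
Lemma ReM z u : Re (z * u) = Re z * Re u - Im z * Im u.
Proof. by case: z u => ? ? []. Qed.
Lemma ImM z u : Im (z * u) = Re z * Im u + Im z * Re u.
Proof. by case: z u => ? ? []. Qed.
Lemma ReJ z : Re z^* = Re z. Proof. by case: z. Qed.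
Lemma ImJ z : Im z^* = - Im z. Proof. by case: z. Qed.
Lemma complex_ext z u : Re z = Re u -> Im z = Im u -> z = u.
Proof. by case: z u => ? ? [? ?] /= -> ->. Qed.

Lemma Re_sum I (r : seq I) (P : pred I) (F : I -> R[i]) :
  Re (\sum_(i <- r | P i) F i) = \sum_(i <- r | P i) Re (F i).
Proof. by elim/big_rec2 : _ => // i y1 y2 _ <-; rewrite ReD. Qed.

Lemma normc_ge0 z : 0 <= normc z.
Proof. by case: z => a b; exact: sqrtr_ge0. Qed.

Lemma normc2 z : normc z ^+ 2 = Re z ^+ 2 + Im z ^+ 2.
Proof. by case: z => a b /=; rewrite sqr_sqrtr// addr_ge0// sqr_ge0. Qed.

Lemma mulcJ z : z * z^* = ((normc z ^+ 2)%:C)%C.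
Proof.
by rewrite normc2; case: z => a b; apply: complex_ext; rewrite /= ?expr2; ring.
Qed.

Lemma normcJ z : normc z^* = normc z.
Proof. by case: z => a b /=; rewrite sqrrN. Qed.

Lemma normc_real (x : R) : normc (x%:C)%C = `|x|.
Proof. by rewrite /= expr0n addr0 sqrtr_sqr. Qed.

Lemma Re_le_normc z : `|Re z| <= normc z.
Proof.
by rewrite -(@ler_pXn2r _ 2)// ?nnegrE ?normc_ge0// real_normK ?num_real// normc2 lerDl sqr_ge0.
Qed.
Lemma Im_le_normc z : `|Im z| <= normc z.
Proof.
by rewrite -(@ler_pXn2r _ 2)// ?nnegrE ?normc_ge0// real_normK ?num_real// normc2 lerDr sqr_ge0.
Qed.
Lemma normc_le z : normc z <= `|Re z| + `|Im z|.
Proof.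
rewrite -(@ler_pXn2r _ 2)// ?nnegrE ?normc_ge0// ?addr_ge0// normc2 sqrrD.
rewrite !real_normK ?num_real// lerD2r lerDl.
by rewrite mulrn_wge0// mulr_ge0.
Qed.

Lemma normcE z : (`|z| = (normc z)%:C)%C.
Proof. by []. Qed.

Lemma conjCR (x : R) : ((x%:C)%C)^* = (x%:C)%C.
Proof. by apply: complex_ext; rewrite ?ReJ ?ImJ//= oppr0. Qed.

Lemma normc_eq0 z : normc z = 0 -> z = 0.
Proof. exact: eq0_normc. Qed.

Lemma normcX z n : normc (z ^+ n) = normc z ^+ n.
Proof.
by elim: n => [|n ih]; rewrite ?expr0 ?normc1// !exprS normcM ih.
Qed.

Lemma normcD_sqr z u : normc (z + u) ^+ 2 <= 2 * (normc z ^+ 2 + normc u ^+ 2).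
Proof.
rewrite !normc2 ReD ImD.
have := sqr_ge0 (Re z - Re u); have := sqr_ge0 (Im z - Im u).
by rewrite !expr2 => *; nra.
Qed.

Lemma normcM_sqr z u : normc (z * u) <= normc z ^+ 2 + normc u ^+ 2.
Proof.
rewrite normcM; have := sqr_ge0 (normc z - normc u); have := sqr_ge0 (normc z + normc u).
have := normc_ge0 z; have := normc_ge0 u.
by rewrite !expr2 => *; nra.
Qed.

End complex_facts.

Section complex_measurability.
Context d (T : measurableType d) (R : realType) (D : set T).
Hypothesis mD : measurable D.
Implicit Types f g : T -> R[i].

Lemma cmeas_cst (c : R[i]) : cmeasurable D (fun=> c).
Proof. by split; exact: measurable_cst. Qed.

Lemma cmeasD f g : cmeasurable D f -> cmeasurable D g ->
  cmeasurable D (fun x => f x + g x).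
Proof.
move=> [f1 f2] [g1 g2]; split.
  by under eq_fun do rewrite ReD; exact: measurable_funD.
by under eq_fun do rewrite ImD; exact: measurable_funD.
Qed.

Lemma cmeasN f : cmeasurable D f -> cmeasurable D (fun x => - f x).
Proof.
move=> [f1 f2]; split.
  by under eq_fun do rewrite ReN; exact: measurable_funN.
by under eq_fun do rewrite ImN; exact: measurable_funN.
Qed.

Lemma cmeasB f g : cmeasurable D f -> cmeasurable D g ->
  cmeasurable D (fun x => f x - g x).
Proof. by move=> mf mg; apply: cmeasD => //; exact: cmeasN. Qed.

Lemma cmeasM f g : cmeasurable D f -> cmeasurable D g ->
  cmeasurable D (fun x => f x * g x).
Proof.
move=> [f1 f2] [g1 g2]; split.
  under eq_fun do rewrite ReM.
  by apply: measurable_funB; exact: measurable_funM.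
under eq_fun do rewrite ImM.
by apply: measurable_funD; exact: measurable_funM.
Qed.

Lemma cmeasJ f : cmeasurable D f -> cmeasurable D (fun x => (f x)^*).
Proof.
move=> [f1 f2]; split.
  by under eq_fun do rewrite ReJ.
by under eq_fun do rewrite ImJ; exact: measurable_funN.
Qed.

Lemma cmeas_sum I (r : seq I) (P : pred I) (F : I -> T -> R[i]) :
  (forall i, P i -> cmeasurable D (F i)) ->
  cmeasurable D (fun x => \sum_(i <- r | P i) F i x).
Proof.
move=> mF; elim: r => [|i r ih].
  by under eq_fun do rewrite big_nil; exact: cmeas_cst.
under eq_fun do rewrite big_cons.
by case: (boolP (P i)) => // Pi; apply: cmeasD => //; exact: mF.
Qed.

Lemma cmeas_prod I (r : seq I) (P : pred I) (F : I -> T -> R[i]) :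
  (forall i, P i -> cmeasurable D (F i)) ->
  cmeasurable D (fun x => \prod_(i <- r | P i) F i x).
Proof.
move=> mF; elim: r => [|i r ih].
  by under eq_fun do rewrite big_nil; exact: cmeas_cst.
under eq_fun do rewrite big_cons.
by case: (boolP (P i)) => // Pi; apply: cmeasM => //; exact: mF.
Qed.

Lemma cmeas_real (f : T -> R) : measurable_fun D f ->
  cmeasurable D (fun x => (f x)%:C%C).
Proof. by move=> mf; split => //=; exact: measurable_cst. Qed.

Lemma measurable_normc f : cmeasurable D f -> measurable_fun D (fun x => normc (f x)).
Proof.
move=> [f1 f2].
rewrite (_ : (fun x => normc _) = Num.sqrt \o (fun x => Re (f x) ^+ 2 + Im (f x) ^+ 2)); last first.
  by apply/funext => x /=; case: (f x).
apply: measurableT_comp.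
  exact: continuous_measurable_fun (@sqrt_continuous R).
by apply: measurable_funD; exact: measurable_funX.
Qed.

Lemma measurable_inv (f : T -> R) : measurable_fun D f ->
  measurable_fun D (fun x => (f x)^-1).
Proof.
move=> mf.
(* The inverse is f times a real power of the nonnegative f^2; at f = 0 this gives 0, in accordance
   with 0^-1 = 0. *)
rewrite (_ : (fun x => _) = (fun x => f x * (((f x) ^+ 2) `^ (-1)))); last first.
  apply/funext => x; rewrite powR_inv1 ?sqr_ge0// expr2 invfM mulrA.
  have [->|fx0] := eqVneq (f x) 0; first by rewrite invr0 mul0r mulr0.
  by rewrite mulfV// mul1r.
apply: measurable_funM => //.
apply: (measurableT_comp (measurable_powR (-1))).
exact: measurable_funX.
Qed.

Lemma complex_invE (z : R[i]) :
  z^-1 = z^* * ((normc z ^+ 2)^-1)%:C%C.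
Proof.
have [->|z0] := eqVneq z 0; first by rewrite conjC0 mul0r invr0.
have nz : (normc z ^+ 2)%:C%C != 0.
  by rewrite -mulcJ mulf_neq0// conjC_eq0.
apply: (mulfI z0); rewrite mulfV// mulrA mulcJ.
by rewrite -rmorphM/= mulfV// ; move: nz; apply: contra => /eqP ->.
Qed.

Lemma cmeasV f : cmeasurable D f -> cmeasurable D (fun x => (f x)^-1).
Proof.
move=> mf; under eq_fun do rewrite complex_invE.
apply: cmeasM; first exact: cmeasJ.
apply: cmeas_real; apply: measurable_inv; apply: measurable_funX.
exact: measurable_normc.
Qed.

Lemma cmeas_det q (A : T -> 'M[R[i]]_q) :
  (forall i j, cmeasurable D (fun x => A x i j)) ->
  cmeasurable D (fun x => \det (A x)).
Proof.
move=> mA; rewrite /determinant; apply: cmeas_sum => s _.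
by apply: cmeasM; [exact: cmeas_cst|apply: cmeas_prod => i _].
Qed.

Lemma cmeas_mulmx m n p (A : T -> 'M[R[i]]_(m, n)) (B : T -> 'M[R[i]]_(n, p)) :
  (forall i j, cmeasurable D (fun x => A x i j)) ->
  (forall i j, cmeasurable D (fun x => B x i j)) ->
  forall i j, cmeasurable D (fun x => (A x *m B x) i j).
Proof.
move=> mA mB i j; under eq_fun do rewrite mxE.
by apply: cmeas_sum => k _; exact: cmeasM.
Qed.

Lemma adjmxE m n (A : 'M[R[i]]_(m, n)) i j : adjmx A i j = (A j i)^*.
Proof. by rewrite /adjmx !mxE. Qed.

Lemma cmeas_adjmx m n (A : T -> 'M[R[i]]_(m, n)) :
  (forall i j, cmeasurable D (fun x => A x i j)) ->
  forall i j, cmeasurable D (fun x => adjmx (A x) i j).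
Proof.
by move=> mA i j; under eq_fun do rewrite adjmxE; exact: cmeasJ.
Qed.

Lemma cmeas_if (b : T -> bool) f g : measurable_fun D b ->
  cmeasurable D f -> cmeasurable D g ->
  cmeasurable D (fun x => if b x then f x else g x).
Proof.
move=> mb [f1 f2] [g1 g2]; split.
  under eq_fun do rewrite (fun_if (@Re R)).
  by apply: measurable_fun_if => //; apply: (measurable_funS mD).
under eq_fun do rewrite (fun_if (@Im R)).
by apply: measurable_fun_if => //; apply: (measurable_funS mD).
Qed.

Lemma measurable_ceq0 f : cmeasurable D f -> measurable_fun D (fun x => f x == 0).
Proof.
move=> [f1 f2]; under eq_fun do rewrite eq_complex.
by apply: measurable_and; apply: measurable_fun_eqr.
Qed.

Lemma cmeas_invmx q (A : T -> 'M[R[i]]_q) :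
  (forall i j, cmeasurable D (fun x => A x i j)) ->
  forall i j, cmeasurable D (fun x => invmx (A x) i j).
Proof.
move=> mA i j; have mdet := cmeas_det mA.
(* [invmx] returns its argument on singular matrices, hence the case distinction. *)
rewrite (_ : (fun x => _) = (fun x => if \det (A x) == 0 then A x i j else
  (\det (A x))^-1 * (\adj (A x)) i j)); last first.
  apply/funext => x; rewrite /invmx unitmxE unitfE.
  by case: eqVneq => //=; rewrite mxE.
apply: cmeas_if => //; first exact: measurable_ceq0.
apply: cmeasM; first exact: cmeasV.
under eq_fun do rewrite mxE /cofactor.
apply: cmeasM; first exact: cmeas_cst.
apply: cmeas_det => k l.
by under eq_fun do rewrite !mxE; exact: mA.
Qed.

End complex_measurability.

Section almost_everywhere_facts.
Context d (T : measurableType d) (R : realType) (mu : {measure set T -> \bar R}).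
Implicit Types P Q S : T -> Prop.

Lemma ae_sub P Q : (forall x, P x -> Q x) -> {ae mu, forall x, P x} -> {ae mu, forall x, Q x}.
Proof. by move=> PQ; exact: filterS. Qed.

Lemma ae_and P Q : {ae mu, forall x, P x} -> {ae mu, forall x, Q x} ->
  {ae mu, forall x, P x /\ Q x}.
Proof. by move=> hP hQ; exact: filterI. Qed.

Lemma ae_all (I : finType) (P : I -> T -> Prop) :
  (forall i, {ae mu, forall x, P i x}) -> {ae mu, forall x, forall i, P i x}.
Proof. by move=> h; exact: filter_forall. Qed.

End almost_everywhere_facts.

Section real_integrals.
Context d (T : measurableType d) (R : realType).
Variables (mu : {measure set T -> \bar R}) (D : set T).
Hypothesis mD : measurable D.

Definition rint (f : T -> R) := mu.-integrable D (fun x => (f x)%:E).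
Definition RI (f : T -> R) : R := \int[mu]_(x in D) f x.

Implicit Types f g h : T -> R.

Lemma rint_meas f : rint f -> measurable_fun D f.
Proof. by move=> /measurable_int /measurable_EFinP. Qed.

Lemma rintD f g : rint f -> rint g -> rint (fun x => f x + g x).
Proof. by move=> If Ig; have := integrableD mD If Ig. Qed.

Lemma rintN f : rint f -> rint (fun x => - f x).
Proof. by move=> If; have := integrableN If. Qed.

Lemma rintB f g : rint f -> rint g -> rint (fun x => f x - g x).
Proof. by move=> If Ig; apply: rintD => //; exact: rintN. Qed.

Lemma rintZ c f : rint f -> rint (fun x => c * f x).
Proof. by move=> If; have := integrableZl mD c If. Qed.

Lemma rint0 : rint (fun=> 0).
Proof. exact: integrable0. Qed.

Lemma rint_sum I (r : seq I) (P : pred I) (F : I -> T -> R) :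
  (forall i, P i -> rint (F i)) -> rint (fun x => \sum_(i <- r | P i) F i x).
Proof.
move=> IF; elim: r => [|i r ih].
  by under [X in rint X]eq_fun do rewrite big_nil; exact: rint0.
under [X in rint X]eq_fun do rewrite big_cons.
by case: (boolP (P i)) => // Pi; apply: rintD => //; exact: IF.
Qed.

Lemma rint_le f g : measurable_fun D f -> (forall x, D x -> `|f x| <= g x) ->
  rint g -> rint f.
Proof.
move=> mf fg Ig; apply: (le_integrable mD _ _ Ig).
  exact/measurable_EFinP.
by move=> x Dx /=; rewrite lee_fin (le_trans (fg _ Dx))// ler_norm.
Qed.

Lemma rint_norm f : rint f -> rint (fun x => `|f x|).
Proof. exact: integrable_norm. Qed.

Lemma RI_D f g : rint f -> rint g -> RI (fun x => f x + g x) = RI f + RI g.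
Proof. by move=> If Ig; exact: RintegralD. Qed.

Lemma RI_Z c f : rint f -> RI (fun x => c * f x) = c * RI f.
Proof. by move=> If; exact: RintegralZl. Qed.

Lemma RI_N f : rint f -> RI (fun x => - f x) = - RI f.
Proof.
move=> If; under [X in RI X]eq_fun do rewrite -mulN1r.
by rewrite RI_Z// mulN1r.
Qed.

Lemma RI_B f g : rint f -> rint g -> RI (fun x => f x - g x) = RI f - RI g.
Proof. by move=> If Ig; rewrite RI_D//; [rewrite RI_N|exact: rintN]. Qed.

Lemma RI_ge0 f : (forall x, D x -> 0 <= f x) -> 0 <= RI f.
Proof. exact: Rintegral_ge0. Qed.

Lemma RI_le f g : rint f -> rint g -> (forall x, D x -> f x <= g x) ->
  RI f <= RI g.
Proof. exact: le_Rintegral. Qed.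

Lemma RI_sum I (r : seq I) (P : pred I) (F : I -> T -> R) :
  (forall i, P i -> rint (F i)) ->
  RI (fun x => \sum_(i <- r | P i) F i x) = \sum_(i <- r | P i) RI (F i).
Proof.
move=> IF; elim: r => [|i r ih].
  under [X in RI X]eq_fun do rewrite big_nil.
  by rewrite big_nil /RI /Rintegral integral0.
under [X in RI X]eq_fun do rewrite big_cons.
rewrite big_cons; case: (boolP (P i)) => // Pi.
by rewrite RI_D ?ih//; [exact: IF|exact: rint_sum].
Qed.

Lemma RI_norm f : rint f -> `|RI f| <= RI (fun x => `|f x|).
Proof. exact: le_normr_Rintegral. Qed.

Lemma eq_RI f g : (forall x, D x -> f x = g x) -> RI f = RI g.
Proof. by move=> fg; apply: eq_Rintegral => x; rewrite inE => /fg. Qed.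

Lemma eq_rint f g : (forall x, D x -> f x = g x) -> rint f -> rint g.
Proof. by move=> fg; apply: eq_integrable => // x; rewrite inE => /fg ->. Qed.

Lemma RI_EFin f : rint f -> (\int[mu]_(x in D) (f x)%:E = (RI f)%:E)%E.
Proof. by move=> If; rewrite /RI /Rintegral fineK//; exact: integrable_fin_num. Qed.

Lemma RI_ae f g : measurable_fun D f -> measurable_fun D g ->
  {ae mu, forall x, D x -> f x = g x} -> RI f = RI g.
Proof.
move=> mf mg fg; rewrite /RI /Rintegral; congr fine.
apply: ae_eq_integral => //; [exact/measurable_EFinP|exact/measurable_EFinP|].
by apply: filterS fg => x fg Dx; rewrite fg.
Qed.

Lemma rint_ae f g : measurable_fun D g ->
  {ae mu, forall x, D x -> f x = g x} -> rint f -> rint g.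
Proof.
move=> mg fg If; apply/integrableP; split; first exact/measurable_EFinP.
have /integrableP[mf] := If; apply: le_lt_trans.
rewrite le_eqVlt; apply/orP; left; apply/eqP; apply: ae_eq_integral => //.
- by apply: measurableT_comp => //; exact/measurable_EFinP.
- exact: measurableT_comp.
- by apply: filterS fg => x fg Dx; rewrite fg.
Qed.

Lemma RI_dct (f_ : nat -> T -> R) f g :
  (forall n, measurable_fun D (f_ n)) -> measurable_fun D f ->
  {ae mu, forall x, D x -> f_ n x @[n --> \oo] --> f x} ->
  rint g -> (forall n x, D x -> `|f_ n x| <= g x) ->
  rint f /\ RI (f_ n) @[n --> \oo] --> RI f.
Proof.
move=> mf_ mf cf Ig fg.
have [||||I1 _ I2] := @dominated_convergence _ _ _ mu D mD
   (fun n x => (f_ n x)%:E) (fun x => (f x)%:E) (fun x => (g x)%:E) _ _ _ Ig.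
- by move=> n; exact/measurable_EFinP.
- exact/measurable_EFinP.
- by apply: filterS cf => x cf Dx; apply: cvg_EFin; [exact: nearW|exact: cf].
- by apply: aeW => x n Dx; rewrite lee_fin; exact: fg.
split => //; apply: (fine_cvg (a := RI f)).
by rewrite -(RI_EFin I1).
Qed.

Lemma RI_eq0_ae f : rint f -> (forall x, D x -> 0 <= f x) -> RI f = 0 ->
  {ae mu, forall x, D x -> f x = 0}.
Proof.
move=> If f0 If0.
have : (\int[mu]_(x in D) `|(f x)%:E| = 0)%E.
  rewrite -[RHS]/(0%:E) -If0 -RI_EFin//; apply: eq_integral => x.
  by rewrite inE => Dx; rewrite gee0_abs// lee_fin f0.
move/ae_eq_integral_abs => -/(_ mD (measurable_int _ If)).
by apply: filterS => x h Dx; have := h Dx => -[].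
Qed.

Lemma rint_bounded f (M : R) : (mu D < +oo)%E -> measurable_fun D f ->
  (forall x, D x -> `|f x| <= M) -> rint f.
Proof.
move=> fD mf fM; apply: measurable_bounded_integrable => //.
exists M; split; first exact: num_real.
by move=> N MN x Dx /=; apply: (le_trans (fM _ Dx)); exact: ltW.
Qed.

Lemma RI_cst c : (mu D < +oo)%E -> RI (fun=> c) = c * fine (mu D).
Proof. by move=> fD; rewrite /RI Rintegral_cst. Qed.

End real_integrals.

Section complex_integrals.
Context d (T : measurableType d) (R : realType).
Variables (mu : {measure set T -> \bar R}) (D : set T).
Hypothesis mD : measurable D.

Notation L1 := (inL1 mu D).
Notation L2 := (inL2 mu D).
Notation CI := (cintegral mu D).
Notation RI := (RI mu D).
Notation rint := (rint mu D).
Implicit Types f g : T -> R[i].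

Lemma inL1P f : L1 f <-> rint (fun x => Re (f x)) /\ rint (fun x => Im (f x)).
Proof.
split=> [[[f1 f2] If]|[If1 If2]].
  by split; apply: (rint_le mD _ _ If) => // x _; rewrite ?Re_le_normc ?Im_le_normc.
have mf : cmeasurable D f by split; [exact: rint_meas If1|exact: rint_meas If2].
split => //; apply: (rint_le mD) (rintD mD (rint_norm If1) (rint_norm If2)).
  exact: measurable_normc.
by move=> x _; rewrite ger0_norm ?normc_ge0// normc_le.
Qed.

Lemma inL1_rint f : L1 f -> rint (fun x => normc (f x)).
Proof. by case. Qed.

Lemma inL1_le f (g : T -> R) : cmeasurable D f ->
  (forall x, D x -> normc (f x) <= g x) -> rint g -> L1 f.
Proof.
move=> mf fg Ig; split => //; apply: (rint_le mD _ _ Ig).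
  exact: measurable_normc.
by move=> x Dx; rewrite ger0_norm ?normc_ge0// fg.
Qed.

Lemma inL1D f g : L1 f -> L1 g -> L1 (fun x => f x + g x).
Proof.
move=> [mf If] [mg Ig]; apply: (inL1_le _ _ (rintD mD If Ig)).
  exact: cmeasD.
by move=> x _; exact: le_normcD.
Qed.

Lemma inL1Z c f : L1 f -> L1 (fun x => c * f x).
Proof.
move=> [mf If]; apply: (inL1_le _ _ (rintZ mD (normc c) If)).
  by apply: cmeasM => //; exact: cmeas_cst.
by move=> x _; rewrite normcM.
Qed.

Lemma inL1N f : L1 f -> L1 (fun x => - f x).
Proof. by move=> If; under eq_fun do rewrite -mulN1r; exact: inL1Z. Qed.

Lemma inL1B f g : L1 f -> L1 g -> L1 (fun x => f x - g x).
Proof. by move=> If Ig; apply: inL1D => //; exact: inL1N. Qed.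

Lemma inL10 : L1 (fun=> 0).
Proof.
split; first exact: cmeas_cst.
by rewrite normc0; exact: integrable0.
Qed.

Lemma inL1_sum I (r : seq I) (P : pred I) (F : I -> T -> R[i]) :
  (forall i, P i -> L1 (F i)) -> L1 (fun x => \sum_(i <- r | P i) F i x).
Proof.
move=> IF; elim: r => [|i r ih].
  by under eq_fun do rewrite big_nil; exact: inL10.
under eq_fun do rewrite big_cons.
by case: (boolP (P i)) => // Pi; apply: inL1D => //; exact: IF.
Qed.

Lemma inL1_bmul f g (M : R) : cmeasurable D g ->
  (forall x, D x -> normc (g x) <= M) -> L1 f -> L1 (fun x => g x * f x).
Proof.
move=> mg gM [mf If]; apply: (inL1_le _ _ (rintZ mD M If)).
  exact: cmeasM.
by move=> x Dx; rewrite normcM ler_wpM2r ?normc_ge0 ?gM.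
Qed.

Lemma eq_CI f g : (forall x, D x -> f x = g x) -> CI f = CI g.
Proof. by move=> fg; rewrite /cintegral; congr Complex; apply: eq_RI => x /fg ->. Qed.

Lemma CI_D f g : L1 f -> L1 g -> CI (fun x => f x + g x) = CI f + CI g.
Proof.
move=> /inL1P[f1 f2] /inL1P[g1 g2]; apply: complex_ext; rewrite /= ?ReD ?ImD /=.
  under eq_Rintegral do rewrite ReD; exact: RI_D.
under eq_Rintegral do rewrite ImD; exact: RI_D.
Qed.

Lemma CI_Z c f : L1 f -> CI (fun x => c * f x) = c * CI f.
Proof.
move=> /inL1P[f1 f2]; apply: complex_ext; rewrite /= ?ReM ?ImM /=.
  under eq_Rintegral do rewrite ReM.
  by rewrite [LHS](RI_B mD (rintZ mD _ f1) (rintZ mD _ f2)) !RI_Z.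
under eq_Rintegral do rewrite ImM.
by rewrite [LHS](RI_D mD (rintZ mD _ f2) (rintZ mD _ f1)) !RI_Z.
Qed.

Lemma CI_N f : L1 f -> CI (fun x => - f x) = - CI f.
Proof.
move=> If; under [X in CI X]eq_fun do rewrite -mulN1r.
by rewrite CI_Z// mulN1r.
Qed.

Lemma CI_B f g : L1 f -> L1 g -> CI (fun x => f x - g x) = CI f - CI g.
Proof. by move=> If Ig; rewrite CI_D//; [rewrite CI_N|exact: inL1N]. Qed.

Lemma CI_0 : CI (fun=> 0) = 0.
Proof.
by apply: complex_ext; rewrite /= /Rintegral integral0.
Qed.

Lemma CI_sum I (r : seq I) (P : pred I) (F : I -> T -> R[i]) :
  (forall i, P i -> L1 (F i)) ->
  CI (fun x => \sum_(i <- r | P i) F i x) = \sum_(i <- r | P i) CI (F i).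
Proof.
move=> IF; elim: r => [|i r ih].
  under [X in CI X]eq_fun do rewrite big_nil.
  by rewrite big_nil CI_0.
under [X in CI X]eq_fun do rewrite big_cons.
rewrite big_cons; case: (boolP (P i)) => // Pi.
by rewrite CI_D ?ih//; [exact: IF|exact: inL1_sum].
Qed.

Lemma CI_J f : L1 f -> CI (fun x => (f x)^*) = (CI f)^*.
Proof.
move=> /inL1P[f1 f2]; apply: complex_ext; rewrite ?ReJ ?ImJ /=.
  by under eq_Rintegral do rewrite ReJ.
under eq_Rintegral do rewrite ImJ; exact: RI_N.
Qed.

Lemma CI_ae f g : cmeasurable D f -> cmeasurable D g ->
  {ae mu, forall x, D x -> f x = g x} -> CI f = CI g.
Proof.
move=> [f1 f2] [g1 g2] fg; apply: complex_ext; rewrite /=; apply: RI_ae => //;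
  by apply: filterS fg => x fg Dx; rewrite fg.
Qed.

Lemma CI_real (f : T -> R) : CI (fun x => (f x)%:C%C) = (RI f)%:C%C.
Proof. by apply: complex_ext => //=; rewrite /Rintegral integral0. Qed.

Lemma normc_CI f : L1 f -> normc (CI f) <= RI (fun x => normc (f x)).
Proof.
move=> If; have [->|z0] := eqVneq (CI f) 0.
  by rewrite normc0; apply: RI_ge0 => // x _; exact: normc_ge0.
set z := CI f in z0 *.
have nz : normc z != 0 by apply: contra_neq z0 => /normc_eq0.
(* A unimodular factor with c z = |z|: it moves the modulus into the integral as a real part. *)
pose c := z^* * ((normc z)^-1)%:C%C.
have cz : c * z = (normc z)%:C%C.
  rewrite /c mulrAC (mulrC _ z) mulcJ -rmorphM/= expr2 mulfK//.
have nc : normc c = 1.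
  by rewrite /c normcM normcJ normc_real ger0_norm ?invr_ge0 ?normc_ge0// mulfV.
have -> : normc z = RI (fun x => Re (c * f x)).
  by transitivity (Re (c * z)); [rewrite cz|rewrite -CI_Z].
have /inL1P[I1 _] := inL1Z c If.
apply: RI_le => //; first by case: If.
move=> x _; apply: (le_trans (ler_norm _)); apply: (le_trans (Re_le_normc _)).
by rewrite normcM nc mul1r.
Qed.

Lemma inL2_rint f : L2 f -> rint (fun x => normc (f x) ^+ 2).
Proof. by case. Qed.

Lemma inL2_le f (g : T -> R) : cmeasurable D f ->
  (forall x, D x -> normc (f x) ^+ 2 <= g x) -> rint g -> L2 f.
Proof.
move=> mf fg Ig; split => //; apply: (rint_le mD _ _ Ig).
  by apply: measurable_funX; exact: measurable_normc.
by move=> x Dx; rewrite ger0_norm ?sqr_ge0// fg.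
Qed.

Lemma inL2D f g : L2 f -> L2 g -> L2 (fun x => f x + g x).
Proof.
move=> [mf If] [mg Ig]; apply: (inL2_le _ _ (rintZ mD 2 (rintD mD If Ig))).
  exact: cmeasD.
by move=> x _; exact: normcD_sqr.
Qed.

Lemma inL2_bmul f g (M : R) : cmeasurable D g ->
  (forall x, D x -> normc (g x) <= M) -> L2 f -> L2 (fun x => g x * f x).
Proof.
move=> mg gM [mf If]; apply: (inL2_le _ _ (rintZ mD (M ^+ 2) If)).
  exact: cmeasM.
move=> x Dx; rewrite normcM exprMn ler_wpM2r ?sqr_ge0//.
by rewrite ler_pXn2r ?nnegrE ?normc_ge0 ?gM ?(le_trans _ (gM _ Dx)) ?normc_ge0.
Qed.

Lemma inL2Z c f : L2 f -> L2 (fun x => c * f x).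
Proof. by apply: inL2_bmul (cmeas_cst _ _) _ => //. Qed.

Lemma inL20 : L2 (fun=> 0).
Proof.
split; first exact: cmeas_cst.
by rewrite normc0 expr0n/=; exact: integrable0.
Qed.

Lemma inL2_sum I (r : seq I) (P : pred I) (F : I -> T -> R[i]) :
  (forall i, P i -> L2 (F i)) -> L2 (fun x => \sum_(i <- r | P i) F i x).
Proof.
move=> IF; elim: r => [|i r ih].
  by under eq_fun do rewrite big_nil; exact: inL20.
under eq_fun do rewrite big_cons.
by case: (boolP (P i)) => // Pi; apply: inL2D => //; exact: IF.
Qed.

Lemma inL2N f : L2 f -> L2 (fun x => - f x).
Proof. by move=> If; under eq_fun do rewrite -mulN1r; exact: inL2Z. Qed.

Lemma inL2B f g : L2 f -> L2 g -> L2 (fun x => f x - g x).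
Proof. by move=> If Ig; apply: inL2D => //; exact: inL2N. Qed.

Lemma inL2J f : L2 f -> L2 (fun x => (f x)^*).
Proof.
move=> [mf If]; apply: (inL2_le _ _ If); first exact: cmeasJ.
by move=> x _; rewrite normcJ.
Qed.

Lemma inL2_mul f g : L2 f -> L2 g -> L1 (fun x => f x * g x).
Proof.
move=> [mf If] [mg Ig]; apply: (inL1_le _ _ (rintD mD If Ig)).
  exact: cmeasM.
by move=> x _; exact: normcM_sqr.
Qed.

Lemma inL2_mulJ f g : L2 f -> L2 g -> L1 (fun x => f x * (g x)^*).
Proof. by move=> If Ig; apply: inL2_mul => //; exact: inL2J. Qed.

Lemma inL2_ae f g : cmeasurable D g ->
  {ae mu, forall x, D x -> f x = g x} -> L2 f -> L2 g.
Proof.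
move=> mg fg [mf If]; split => //.
apply: (rint_ae mD _ _ If).
  by apply: measurable_funX; exact: measurable_normc.
by apply: filterS fg => x fg Dx; rewrite fg.
Qed.

Lemma inL2_cst (c : R[i]) : (mu D < +oo)%E -> L2 (fun=> c).
Proof.
move=> fD; split; first exact: cmeas_cst.
by apply: (rint_bounded mD fD (M := normc c ^+ 2)) => // x _; rewrite ger0_norm ?sqr_ge0.
Qed.

Lemma inL2_L1 f : (mu D < +oo)%E -> L2 f -> L1 f.
Proof.
by move=> fD If; have := inL2_mul (inL2_cst 1 fD) If; under eq_fun do rewrite mul1r.
Qed.

End complex_integrals.

(** * Closed subspaces and alternating projections *)

(* Only a seminorm is available on square-integrable functions, which are not
   identified up to almost everywhere equality. *)
Record semiHilbert (R : realType) := SemiHilbert {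
  sh_car :> lmodType R[i];
  ip : sh_car -> sh_car -> R[i];
  ip_lin : forall a x y z, ip (a *: x + y) z = a * ip x z + ip y z;
  ipC : forall x y, ip y x = (ip x y)^*;
  ip_ge0 : forall x, 0 <= Re (ip x x);
  sh_complete : forall u : nat -> sh_car,
    (forall e : R, 0 < e -> exists N, forall m n, (N <= m)%N -> (N <= n)%N ->
       Re (ip (u m - u n) (u m - u n)) < e) ->
    exists v, forall e : R, 0 < e -> exists N, forall n, (N <= n)%N ->
       Re (ip (u n - v) (u n - v)) < e }.

Section inner_product.
Context {R : realType} {H : semiHilbert R}.
Implicit Types (x y z : H) (a : R[i]).

Definition nrm2 x : R := Re (ip x x).
Definition nrm x : R := Num.sqrt (nrm2 x).

Lemma ipDl x y z : ip (x + y) z = ip x z + ip y z.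
Proof. by rewrite -[x]scale1r ip_lin mul1r scale1r. Qed.

Lemma ip0l z : ip 0 z = 0.
Proof. by apply: (addrI (ip 0 z)); rewrite -ipDl !addr0. Qed.

Lemma ipZl a x z : ip (a *: x) z = a * ip x z.
Proof. by rewrite -[a *: x]addr0 ip_lin ip0l addr0. Qed.

Lemma ipNl x z : ip (- x) z = - ip x z.
Proof. by rewrite -scaleN1r ipZl mulN1r. Qed.

Lemma ipBl x y z : ip (x - y) z = ip x z - ip y z.
Proof. by rewrite ipDl ipNl. Qed.

Lemma ip_suml I (r : seq I) (P : pred I) (F : I -> H) z :
  ip (\sum_(i <- r | P i) F i) z = \sum_(i <- r | P i) ip (F i) z.
Proof. by apply: (big_morph (fun x => ip x z)) => [x y|]; [exact: ipDl|exact: ip0l]. Qed.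

Lemma ipDr x y z : ip z (x + y) = ip z x + ip z y.
Proof. by rewrite ipC ipDl rmorphD/= -!ipC. Qed.

Lemma ip0r z : ip z 0 = 0.
Proof. by rewrite ipC ip0l conjC0. Qed.

Lemma ipZr a x z : ip z (a *: x) = a^* * ip z x.
Proof. by rewrite ipC ipZl rmorphM/= -ipC. Qed.

Lemma ipNr x z : ip z (- x) = - ip z x.
Proof. by rewrite ipC ipNl rmorphN/= -ipC. Qed.

Lemma ipBr x y z : ip z (x - y) = ip z x - ip z y.
Proof. by rewrite ipDr ipNr. Qed.

Lemma ip_sumr I (r : seq I) (P : pred I) (F : I -> H) z :
  ip z (\sum_(i <- r | P i) F i) = \sum_(i <- r | P i) ip z (F i).
Proof. by apply: (big_morph (fun x => ip z x)) => [x y|]; [exact: ipDr|exact: ip0r]. Qed.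

Lemma ip_nrm2 x : ip x x = (nrm2 x)%:C%C.
Proof.
apply: complex_ext => //=.
by have /(congr1 (@Im R)) := ipC x x; rewrite ImJ => h; lra.
Qed.

Lemma nrm2_ge0 x : 0 <= nrm2 x. Proof. exact: ip_ge0. Qed.

Lemma nrm20 : nrm2 0 = 0. Proof. by rewrite /nrm2 ip0l. Qed.

Lemma nrm2D x y : nrm2 (x + y) = nrm2 x + nrm2 y + 2 * Re (ip x y).
Proof.
rewrite /nrm2 ipDl !ipDr !ReD [ip y x]ipC ReJ; ring.
Qed.

Lemma nrm2Z a x : nrm2 (a *: x) = normc a ^+ 2 * nrm2 x.
Proof.
by rewrite /nrm2 ipZl ipZr mulrA mulcJ ip_nrm2 -rmorphM/=.
Qed.

Lemma nrm2N x : nrm2 (- x) = nrm2 x.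
Proof. by rewrite -scaleN1r nrm2Z normcN normc1 expr1n mul1r. Qed.

Lemma nrm2B x y : nrm2 (x - y) = nrm2 x + nrm2 y - 2 * Re (ip x y).
Proof. by rewrite nrm2D nrm2N ipNr ReN mulrN. Qed.

Lemma pythagoras x y : ip x y = 0 -> nrm2 (x + y) = nrm2 x + nrm2 y.
Proof. by move=> h; rewrite nrm2D h mulr0 addr0. Qed.

(* The polynomial in s has value |p|^2 (s^2 |y|^2 - 2 s) + |x|^2, with p = <x,y>. *)
Lemma nrm2B_line x y (s : R) :
  nrm2 (x - (s%:C%C * ip x y) *: y) =
  nrm2 x - 2 * s * normc (ip x y) ^+ 2 + s ^+ 2 * normc (ip x y) ^+ 2 * nrm2 y.
Proof.
rewrite nrm2B nrm2Z ipZr normcM normc_real exprMn -normrX ger0_norm ?sqr_ge0//.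
rewrite rmorphM/= conjCR -mulrA [_^* * _]mulrC mulcJ -rmorphM/=; ring.
Qed.

Lemma cauchy_schwarz2 x y : normc (ip x y) ^+ 2 <= nrm2 x * nrm2 y.
Proof.
have := nrm2_ge0 y; rewrite le_eqVlt => /orP[/eqP y0|y0].
  rewrite -y0 mulr0 leNgt; apply/negP => p0.
  have pn : normc (ip x y) != 0 by apply: contraTneq p0 => ->; rewrite expr0n/= ltxx.
  (* For a null y the value is affine in s; this s brings it down to -1. *)
  have := nrm2_ge0 (x - (((nrm2 x + 1) / (2 * normc (ip x y) ^+ 2))%:C%C * ip x y) *: y).
  rewrite nrm2B_line -y0 mulr0 addr0.
  rewrite (_ : 2 * _ * _ = nrm2 x + 1); last by field.
  by rewrite opprD addrA subrr add0r oppr_ge0 ler10.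
(* Here s = 1 / |y|^2 is the minimiser of the quadratic polynomial. *)
have := nrm2_ge0 (x - (((nrm2 y)^-1)%:C%C * ip x y) *: y).
rewrite nrm2B_line (_ : _ + _ * _ = nrm2 x - normc (ip x y) ^+ 2 / nrm2 y).
  by rewrite subr_ge0 ler_pdivrMr.
by field; rewrite gt_eqF.
Qed.

Lemma nrm_ge0 x : 0 <= nrm x. Proof. exact: sqrtr_ge0. Qed.

Lemma nrm_sqr x : nrm x ^+ 2 = nrm2 x.
Proof. by rewrite sqr_sqrtr// nrm2_ge0. Qed.

Lemma nrm0 : nrm 0 = 0. Proof. by rewrite /nrm nrm20 sqrtr0. Qed.

Lemma cauchy_schwarz x y : normc (ip x y) <= nrm x * nrm y.
Proof.
rewrite -(@ler_pXn2r _ 2)// ?nnegrE ?normc_ge0 ?mulr_ge0 ?nrm_ge0//.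
by rewrite exprMn !nrm_sqr cauchy_schwarz2.
Qed.

Lemma nrmD x y : nrm (x + y) <= nrm x + nrm y.
Proof.
rewrite -(@ler_pXn2r _ 2)// ?nnegrE ?addr_ge0 ?nrm_ge0//.
rewrite sqrrD !nrm_sqr nrm2D -mulr_natl.
have := le_trans (Re_le_normc _) (cauchy_schwarz x y).
by have := ler_norm (Re (ip x y)); lra.
Qed.

Lemma nrmZ a x : nrm (a *: x) = normc a * nrm x.
Proof. by rewrite /nrm nrm2Z sqrtrM ?sqr_ge0// sqrtr_sqr ger0_norm ?normc_ge0. Qed.

Lemma nrmN x : nrm (- x) = nrm x.
Proof. by rewrite /nrm nrm2N. Qed.

Lemma nrmC x y : nrm (x - y) = nrm (y - x).
Proof. by rewrite -nrmN opprB. Qed.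

Lemma nrm_tri z x y : nrm (x - y) <= nrm (x - z) + nrm (z - y).
Proof. by rewrite (le_trans _ (nrmD _ _))// addrA subrK. Qed.

Lemma nrm_lt2 x (e : R) : 0 <= e -> (nrm x < e) = (nrm2 x < e ^+ 2).
Proof. by move=> e0; rewrite -nrm_sqr ltr_pXn2r// nnegrE ?nrm_ge0. Qed.

Lemma nrm_eq0 x : (nrm x = 0) <-> (nrm2 x = 0).
Proof.
split=> h; first by rewrite -nrm_sqr h expr0n.
by rewrite /nrm h sqrtr0.
Qed.

Lemma ip_null x y : nrm x = 0 -> ip x y = 0.
Proof.
move=> h; apply: normc_eq0; apply/eqP; rewrite eq_le normc_ge0 andbT.
by rewrite (le_trans (cauchy_schwarz _ _))// h mul0r.
Qed.

Definition hcvg (u : nat -> H) (v : H) := forall e : R, 0 < e ->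
  exists N, forall n, (N <= n)%N -> nrm (u n - v) < e.

Lemma complete (u : nat -> H) :
  (forall e : R, 0 < e -> exists N, forall m n, (N <= m)%N -> (N <= n)%N ->
     nrm (u m - u n) < e) -> exists v, hcvg u v.
Proof.
move=> cu; have [|v hv] := @sh_complete R H u.
  move=> e e0; have [|N hN] := cu (Num.sqrt e); first by rewrite sqrtr_gt0.
  exists N => m n Nm Nn; have := hN m n Nm Nn.
  by rewrite nrm_lt2 ?sqrtr_ge0// sqr_sqrtr// ltW.
exists v => e e0; have [|N hN] := hv (e ^+ 2); first by rewrite exprn_gt0.
by exists N => n Nn; rewrite nrm_lt2 ?ltW//; exact: hN.
Qed.

Lemma hcvg_null u v v' : hcvg u v -> nrm (v - v') = 0 -> hcvg u v'.
Proof.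
move=> h h0 e e0; have [N hN] := h e e0; exists N => n /hN; apply: le_lt_trans.
by rewrite (le_trans (nrm_tri v _ _))// h0 addr0.
Qed.

Definition ccvg (a : nat -> R[i]) (l : R[i]) := forall e : R, 0 < e ->
  exists N, forall n, (N <= n)%N -> normc (a n - l) < e.

Lemma hcvg_ip u v y : hcvg u v -> ccvg (fun n => ip (u n) y) (ip v y).
Proof.
move=> h e e0; have [|N hN] := h (e / (nrm y + 1)).
  by rewrite divr_gt0// ltr_wpDl// nrm_ge0.
exists N => n /hN; rewrite ltr_pdivlMr ?ltr_wpDl ?nrm_ge0//.
apply: le_lt_trans; rewrite -ipBl (le_trans (cauchy_schwarz _ _))//.
by rewrite ler_wpM2l ?nrm_ge0// lerDl.
Qed.

(** Closedness refers to the seminorm, so a closed subspace contains everything at distance 0 from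
    its elements ([csub_null]); this replaces equality in the quotient by null vectors. *)
Record csub (S : H -> Prop) : Prop := CSub {
  csub0 : S 0;
  csub_lin : forall a x y, S x -> S y -> S (a *: x + y);
  csub_closed : forall x,
    (forall e : R, 0 < e -> exists2 s, S s & nrm (x - s) < e) -> S x }.

Section csub_theory.
Variables (S : H -> Prop) (cS : csub S).

Lemma csubD x y : S x -> S y -> S (x + y).
Proof. by move=> Sx Sy; rewrite -[x]scale1r; exact: csub_lin. Qed.
Lemma csubZ a x : S x -> S (a *: x).
Proof. by move=> Sx; rewrite -[_ *: _]addr0; apply: csub_lin => //; exact: csub0. Qed.
Lemma csubN x : S x -> S (- x).
Proof. by move=> Sx; rewrite -scaleN1r; exact: csubZ. Qed.
Lemma csubB x y : S x -> S y -> S (x - y).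
Proof. by move=> Sx Sy; apply: csubD => //; exact: csubN. Qed.
Lemma csub_sum I (r : seq I) (P : pred I) (F : I -> H) :
  (forall i, P i -> S (F i)) -> S (\sum_(i <- r | P i) F i).
Proof.
by move=> SF; elim/big_ind : _ => //; [exact: csub0|exact: csubD].
Qed.
Lemma csub_null x y : S x -> nrm (y - x) = 0 -> S y.
Proof. by move=> Sx xy; apply: (csub_closed cS) => e e0; exists x => //; rewrite xy. Qed.
Lemma csub_hcvg u v : (exists N, forall n, (N <= n)%N -> S (u n)) -> hcvg u v -> S v.
Proof.
move=> [N Su] uv; apply: (csub_closed cS) => e /uv[M hM].
exists (u (maxn N M)); first by apply: Su; exact: leq_maxl.
by rewrite nrmC hM// leq_maxr.
Qed.

(** A sequence in S minimising the distance to x is Cauchy by the parallelogram law; its limit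
    attains the infimum, and moving it along z cannot lower the distance. *)
Lemma proj_exists x : exists p, S p /\ forall z, S z -> ip (x - p) z = 0.
Proof.
pose E := [set nrm2 (x - s) | s in S].
have E0 : E !=set0 by exists (nrm2 (x - 0)); exists 0 => //; exact: csub0 cS.
have lE : has_lbound E by exists 0 => _ [s _ <-]; exact: nrm2_ge0.
pose dd := inf E.
have dle s : S s -> dd <= nrm2 (x - s) by move=> Ss; apply: ge_inf => //; exists s.
have [|s hs] := @choice _ _ (fun n s => S s /\ nrm2 (x - s) < dd + n.+1%:R^-1).
  move=> n.
  have n0 : 0 < n.+1%:R^-1 :> R by rewrite invr_gt0.
  have [_ [s Ss <-] h] := inf_adherent n0 (conj E0 lE).
  by exists s.
(* The midpoint of s_m and s_n lies in S, hence at squared distance at least [dd] from x; the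
   parallelogram law does the rest. *)
have para m n : nrm2 (s m - s n) <= 2 * m.+1%:R^-1 + 2 * n.+1%:R^-1.
  have Sh : S (2^-1 *: (s m + s n)).
    by apply: csubZ; apply: csubD; [exact: (hs m).1|exact: (hs n).1].
  have := dle _ Sh.
  rewrite (_ : x - _ = 2^-1 *: ((x - s m) + (x - s n))); last first.
    rewrite addrACA -opprD scalerBr; congr (_ - _).
    by rewrite scalerDr -scalerDl -{1}[x]scale1r; congr (_ *: _); field.
  rewrite nrm2Z (_ : normc _ = 2^-1) //; last first.
    by rewrite normcV -(rmorph_nat (real_complex R)) normc_real normr_nat.
  rewrite (_ : s m - s n = (x - s n) - (x - s m)); last by rewrite opprB [RHS]addrC addrA subrK.
  rewrite nrm2B nrm2D [ip (x - s n) _]ipC ReJ.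
  rewrite (_ : 2^-1 ^+ 2 = 4^-1); last by rewrite exprVn -natrX.
  move: (hs m).2 (hs n).2; set a := nrm2 _; set b := nrm2 _; set c := Re _.
  by move: (m.+1%:R^-1) (n.+1%:R^-1) => im jn *; lra.
have [e e0|p hp] := @complete s.
  have e4 : 0 < e ^+ 2 / 4 by rewrite divr_gt0// exprn_gt0.
  pose N := Num.trunc ((e ^+ 2 / 4)^-1).
  have hN k : (N <= k)%N -> (k.+1%:R^-1 : R) < e ^+ 2 / 4.
    move=> Nk; rewrite invf_plt ?posrE//.
    by rewrite (lt_le_trans (truncnS_gt _))// ler_nat.
  exists N => m n Nm Nn; rewrite nrm_lt2 ?(ltW e0)// (le_lt_trans (para m n))//.
  by move: (hN _ Nm) (hN _ Nn); move: (m.+1%:R^-1) (n.+1%:R^-1) => im jn *; lra.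
have Sp : S p by apply: (csub_hcvg _ hp); exists 0%N => n _; exact: (hs n).1.
have pd : nrm2 (x - p) <= dd.
  rewrite leNgt; apply/negP => dp.
  pose e := nrm2 (x - p) - dd.
  have e0 : 0 < e by rewrite subr_gt0.
  have M0 : 0 < 2 * nrm (x - p) + 1 by rewrite ltr_wpDl// mulr_ge0// nrm_ge0.
  have [|N hN] := hp (e / 2 / (2 * nrm (x - p) + 1)); first by rewrite !divr_gt0.
  pose n := maxn N (Num.trunc ((e / 2)^-1)).
  have h1 := hN n (leq_maxl _ _).
  have h2 : (n.+1%:R^-1 : R) < e / 2.
    rewrite invf_plt ?posrE ?divr_gt0//.
    by rewrite (lt_le_trans (truncnS_gt _))// ler_nat ltnS leq_maxr.
  have h3 := (hs n).2.
  have h4 : nrm2 (x - p) <= nrm2 (x - s n) + 2 * nrm (x - p) * nrm (s n - p).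
    have h5 := nrm_tri (s n) x p; have h6 := nrm_ge0 (s n - p).
    rewrite -!nrm_sqr; have := nrm_ge0 (x - p); have := nrm_ge0 (x - s n).
    move: h5 h6; set a := nrm _; set b := nrm _; set c := nrm _ => h5 h6 b0 a0.
    rewrite !expr2; case: (leP c a) => ca; last by nra.
    have : 0 <= (b - (a - c)) * (b + (a - c)) by rewrite mulr_ge0//; lra.
    by nra.
  have : 2 * nrm (x - p) * nrm (s n - p) <= e / 2.
    move: h1; rewrite ltr_pdivlMr// => h1; have := nrm_ge0 (s n - p); have := nrm_ge0 (x - p).
    by move: h1; set a := nrm (s n - p); set b := nrm _ => *; nra.
  have ed : nrm2 (x - p) = e + dd by rewrite /e subrK.
  move: h2 h3 h4 ed; clearbody e.
  by move: (n.+1%:R^-1) (2 * nrm (x - p) * nrm (s n - p)) (nrm2 _) (nrm2 _) => i pr *; lra.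
exists p; split => // z Sz; apply: normc_eq0; apply/eqP; rewrite -sqrf_eq0.
rewrite eq_le sqr_ge0 andbT leNgt; apply/negP => c0.
(* The step 1 / (|z|^2 + 1) along <x - p, z> z lowers the distance strictly when <x - p, z> is
   nonzero; the + 1 covers null z. *)
have N0 : 0 < nrm2 z + 1 by rewrite ltr_wpDl// nrm2_ge0.
have Ss : S (p + (((nrm2 z + 1)^-1)%:C%C * ip (x - p) z) *: z).
  by apply: csubD => //; exact: csubZ.
have := dle _ Ss; rewrite opprD addrA nrm2B_line.
set c := normc _ ^+ 2 in c0 *; set i := (nrm2 z + 1)^-1.
have i0 : 0 < i by rewrite invr_gt0.
have iN : i * nrm2 z < 1.
  by rewrite mulrC ltr_pdivrMr// mul1r ltrDl.
have ic : 0 < i * c by rewrite mulr_gt0.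
rewrite (_ : i ^+ 2 * c * nrm2 z = i * c * (i * nrm2 z)); last by ring.
have : i * c * (i * nrm2 z) < i * c by rewrite -[ltRHS]mulr1 ltr_pM2l.
by move: pd; rewrite -!mulrA; lra.
Qed.

End csub_theory.


(** A relation, since the seminorm determines a projection only up to null vectors; [pj] chooses
    one. *)
Definition isproj (S : H -> Prop) x p := S p /\ forall z, S z -> ip (x - p) z = 0.

Section projection.
Variables (S : H -> Prop) (cS : csub S).

Definition pj x : H := sval (cid (proj_exists cS x)).

Lemma pj_isproj x : isproj S x (pj x).
Proof. exact: (svalP (cid (proj_exists cS x))). Qed.

Lemma pj_in x : S (pj x). Proof. exact: (pj_isproj x).1. Qed.

Lemma pj_orth x z : S z -> ip (x - pj x) z = 0.
Proof. exact: (pj_isproj x).2. Qed.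

End projection.

Lemma isproj_ip (S : H -> Prop) x p z : isproj S x p -> S z -> ip p z = ip x z.
Proof. by move=> [_ h] /h; rewrite ipBl => /eqP; rewrite subr_eq0 => /eqP. Qed.

Lemma isproj_ipr (S : H -> Prop) x p z : isproj S x p -> S z -> ip z p = ip z x.
Proof. by move=> h Sz; rewrite ipC (isproj_ip h Sz) -ipC. Qed.

(** Together with [clspan_sub] this extends orthogonality from generators to their closed span. *)
Lemma csub_orth y : csub (fun v => ip v y = 0).
Proof.
split => [|a u v hu hv|x hx]; first by rewrite ip0l.
  by rewrite ip_lin hu hv mulr0 addr0.
apply: normc_eq0; apply/eqP; rewrite eq_le normc_ge0 andbT leNgt; apply/negP => e0.
have M0 : 0 < nrm y + 1 by rewrite ltr_wpDl// nrm_ge0.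
have [|s hs h] := hx (normc (ip x y) / (nrm y + 1)); first by rewrite divr_gt0.
have : normc (ip (x - s) y) <= nrm (x - s) * nrm y by exact: cauchy_schwarz.
rewrite ipBl hs subr0 leNgt => /negP; apply.
move: h; rewrite ltr_pdivlMr//; apply: le_lt_trans.
by rewrite ler_wpM2l ?nrm_ge0// lerDl.
Qed.

Section span.
Variables (I : Type) (g : I -> H).
Implicit Types K : I -> Prop.

Inductive lspan K : H -> Prop :=
| lspan0 : lspan K 0
| lspanS a i v : K i -> lspan K v -> lspan K (a *: g i + v).

Definition clspan K v := forall e : R, 0 < e -> exists2 s, lspan K s & nrm (v - s) < e.

Lemma lspan_lin K a x y : lspan K x -> lspan K y -> lspan K (a *: x + y).
Proof.
elim=> [|b i v Ki hv ih] hy; first by rewrite scaler0 add0r.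
rewrite scalerDr scalerA -addrA; apply: lspanS => //; exact: ih.
Qed.

Lemma lspan_gen K i : K i -> lspan K (g i).
Proof.
move=> Ki; rewrite -[g i]scale1r -[_ *: _]addr0; apply: lspanS => //; exact: lspan0.
Qed.

Lemma lspan_sub K (S : H -> Prop) : csub S -> (forall i, K i -> S (g i)) ->
  forall v, lspan K v -> S v.
Proof.
move=> cS h v; elim=> [|a i u Ki _ Su]; first exact: csub0.
by apply: csub_lin => //; exact: h.
Qed.

Lemma lspan_mono K K' v : (forall i, K i -> K' i) -> lspan K v -> lspan K' v.
Proof.
move=> h; elim=> [|a i u Ki _ Su]; first exact: lspan0.
by apply: lspanS => //; exact: h.
Qed.

Lemma lspan_clspan K v : lspan K v -> clspan K v.
Proof. by move=> h e e0; exists v => //; rewrite subrr nrm0. Qed.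

Lemma clspan_gen K i : K i -> clspan K (g i).
Proof. by move=> Ki; apply: lspan_clspan; exact: lspan_gen. Qed.

Lemma csub_clspan K : csub (clspan K).
Proof.
split; first by apply: lspan_clspan; exact: lspan0.
  move=> a x y hx hy e e0.
  have e1 : 0 < e / 2 / (normc a + 1).
    by rewrite !divr_gt0// ltr_wpDl// normc_ge0.
  have e2 : 0 < e / 2 by rewrite divr_gt0.
  have [s hs h1] := hx _ e1; have [t ht h2] := hy _ e2.
  exists (a *: s + t); first exact: lspan_lin.
  rewrite opprD addrACA -scalerBr (le_lt_trans (nrmD _ _))//.
  rewrite [ltRHS]splitr ltr_leD// ?ltW// nrmZ.
  move: h1; rewrite ltr_pdivlMr ?ltr_wpDl ?normc_ge0//.
  by apply: le_lt_trans; rewrite mulrC ler_wpM2l ?nrm_ge0// lerDl.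
move=> x hx e e0; have e2 : 0 < e / 2 by rewrite divr_gt0.
have [s hs h1] := hx _ e2; have [t ht h2] := hs _ e2.
exists t => //; have := nrm_tri s x t; lra.
Qed.

Lemma clspan_sub K (S : H -> Prop) : csub S -> (forall i, K i -> S (g i)) ->
  forall v, clspan K v -> S v.
Proof.
move=> cS h v hv; apply: (csub_closed cS) => e /hv[s hs h1]; exists s => //.
exact: lspan_sub hs.
Qed.

Lemma clspan_mono K K' v : (forall i, K i -> K' i) -> clspan K v -> clspan K' v.
Proof.
by move=> h hv e /hv[s hs h1]; exists s => //; exact: lspan_mono hs.
Qed.

End span.

Section alternating_projections.
Variables (SA SB : H -> Prop).
Hypotheses (cA : csub SA) (cB : csub SB).
Definition alt (k : nat) : H -> Prop := if odd k then SA else SB.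
Variable z : nat -> H.
Hypothesis hz : forall k, isproj (alt k.+1) (z k) (z k.+1).

Lemma alt_in k : (0 < k)%N -> alt k (z k).
Proof. by case: k => // k _; exact: (hz k).1. Qed.

(** Self-adjointness: the last projection drops off the right argument because z_m lies in its
    range, then one projection is added on the left because the right argument lies in its range.
    The two indices approach each other and meet in the middle. *)
Lemma alt_ip k : forall m, (0 < m)%N -> ip (z m) (z (m + k.*2)%N) = ip (z (m + k)%N) (z (m + k)%N).
Proof.
elim: k => [|k ih] m m0; first by rewrite !addn0.
have e1 : alt (m + k.*2).+2 = alt m.
  by rewrite /alt /= negbK oddD odd_double addbF.
have e2 : alt (m + k.*2).+1 = alt m.+1 by rewrite /alt /= oddD odd_double addbF.
rewrite doubleS !addnS (isproj_ipr (hz _)); last by rewrite e1; exact: alt_in.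
have -> : ip (z m) (z (m + k.*2).+1) = ip (z m.+1) (z (m.+1 + k.*2)%N).
  by rewrite (isproj_ip (hz m)) ?addSn// -e2; exact: alt_in.
by rewrite ih// addSn.
Qed.

Lemma alt_nrm2 k : nrm2 (z k - z k.+1) = nrm2 (z k) - nrm2 (z k.+1).
Proof.
rewrite nrm2B (_ : ip (z k) (z k.+1) = ip (z k.+1) (z k.+1)); last first.
  by rewrite (isproj_ip (hz k))//; exact: alt_in.
by rewrite -/(nrm2 _); lra.
Qed.

Lemma alt_noninc k : nrm2 (z k.+1) <= nrm2 (z k).
Proof. by rewrite -subr_ge0 -alt_nrm2 nrm2_ge0. Qed.

(* [alt_ip]: <z_m, z_(m+2k)> = |z_(m+k)|^2, so the iterates are Cauchy as soon as
   their decreasing norms converge. *)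
Lemma alternating_projections : exists v,
  [/\ SA v, SB v, forall y, SA y -> SB y -> ip (z 0%N - v) y = 0 & hcvg z v].
Proof.
pose N k := nrm2 (z k).
have cN : cvgn N.
  apply: nonincreasing_is_cvgn.
    by apply/nonincreasing_seqP => k; exact: alt_noninc.
  by exists 0 => _ [k _ <-]; exact: nrm2_ge0.
have hN (e : R) : 0 < e -> exists M, (0 < M)%N /\ forall m, (M <= m)%N -> `|N m - limn N| < e.
  move=> e0; have /cvgrPdist_lt/(_ e e0)[M _ hM] := cN.
  by exists M.+1; split => // m Mm; rewrite distrC; apply: hM => /=; exact: ltnW.
have e1 (e : R) : 0 < e -> exists M, (0 < M)%N /\ forall m n, (M <= m <= n)%N -> nrm (z m - z n) < e.
  move=> e0; have [|M [M0 hM]] := hN ((e / 2) ^+ 2 / 4).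
    by rewrite divr_gt0// exprn_gt0// divr_gt0.
  exists M; split => // m n /andP[Mm mn].
  have e2 : 0 < e / 2 by rewrite divr_gt0.
  (* By [alt_ip] the square is N m + N (m + 2k) - 2 N (m + k), at most four times the tolerance
     chosen for N. Gaps of odd length cost one more step, bounded in [od]. *)
  have ev k : nrm (z m - z (m + k.*2)%N) < e / 2.
    rewrite nrm_lt2 ?(ltW e2)// nrm2B alt_ip ?(leq_trans M0)// -/(nrm2 _).
    have := hM m Mm; have := hM (m + k)%N (leq_trans Mm (leq_addr _ _)).
    have := hM (m + k.*2)%N (leq_trans Mm (leq_addr _ _)); rewrite /N.
    move: (nrm2 _) (nrm2 _) (nrm2 _) (limn _) => a b c l.
    by rewrite !ltr_norml => /andP[? ?] /andP[? ?] /andP[? ?]; lra.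
  have od k : (M <= k)%N -> nrm (z k - z k.+1) < e / 2.
    move=> Mk; rewrite nrm_lt2 ?(ltW e2)// alt_nrm2.
    have := hM k Mk; have := hM k.+1 (leqW Mk); rewrite /N.
    move: (nrm2 _) (nrm2 _) (limn _) => a b l.
    by rewrite !ltr_norml => /andP[? ?] /andP[? ?]; lra.
  have := odd_double_half (n - m); case: (odd _) => /= h.
    have -> : n = (m + (n - m)./2.*2).+1 by rewrite -(subnKC mn) -h; lia.
    have := nrm_tri (z (m + (n - m)./2.*2)%N) (z m) (z (m + (n - m)./2.*2).+1).
    have := ev (n - m)./2; have := od (m + (n - m)./2.*2)%N (leq_trans Mm (leq_addr _ _)).
    lra.
  have -> : n = (m + (n - m)./2.*2)%N by rewrite -[LHS](subnKC mn) -[in LHS]h; lia.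
  have := ev (n - m)./2; lra.
have [|v hv] := complete (u := z).
  move=> e /e1[M [_ hM]]; exists M => m n Mm Mn.
  case: (leqP m n) => mn; first by apply: hM; rewrite Mm.
  by rewrite nrmC; apply: hM; rewrite Mn ltnW.
(* The odd and the even iterates have the same limit, which therefore lies in both closed
   subspaces. *)
have sub (b : bool) : hcvg (fun k => z (b + k.*2.+2)%N) v.
  move=> e /hv[M hM]; exists M => n Mn; apply: hM; apply: leq_trans Mn _; lia.
exists v; split => //.
- apply: (csub_hcvg cA _ (sub true)); exists 0%N => k _.
  by have := @alt_in (true + k.*2.+2)%N isT; rewrite /alt oddD /= odd_double.
- apply: (csub_hcvg cB _ (sub false)); exists 0%N => k _.
  by have := @alt_in (false + k.*2.+2)%N isT; rewrite /alt oddD /= odd_double.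
- move=> y Ay By.
  have h k : ip (z k) y = ip (z 0%N) y.
    elim: k => // k <-; apply: (isproj_ip (hz k)); rewrite /alt; by case: odd.
  rewrite ipBl; apply: normc_eq0; apply/eqP; rewrite eq_le normc_ge0 andbT leNgt.
  apply/negP => e0; have [M /(_ M (leqnn _))] := hcvg_ip y hv e0.
  by rewrite h ltxx.
Qed.

End alternating_projections.

Section orthonormal_expansion.
Variables (q : nat) (u : nat -> 'I_q -> H).
Hypothesis ou : forall l m i j, ip (u l i) (u m j) = ((l == m) && (i == j))%:R.
Variables (S : H -> Prop) (cS : csub S).
Hypothesis uS : forall l i s, S s -> ip (u l i) s = 0.

Definition psum (z : H) N : H := \sum_(l < N) \sum_j ip z (u l j) *: u l j.

Lemma ip_psum z N l j : (l < N)%N -> ip (psum z N) (u l j) = ip z (u l j).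
Proof.
move=> lN; rewrite /psum ip_suml (bigD1 (Ordinal lN))//= ip_suml (bigD1 j)//=.
rewrite ipZl ou !eqxx mulr1 !big1 ?addr0// => [k kl|k kj].
  by rewrite ip_suml big1// => i _; rewrite ipZl ou -val_eqE/= in kl *; rewrite (negPf kl) mulr0.
by rewrite ipZl ou (negPf kj) andbF mulr0.
Qed.

Lemma psum_lspan z N : lspan (fun li : nat * 'I_q => u li.1 li.2) (fun li => (li.1 < N)%N) (psum z N).
Proof.
have h (a b : H) : lspan (fun li : nat * 'I_q => u li.1 li.2) (fun li => (li.1 < N)%N) a ->
    lspan (fun li : nat * 'I_q => u li.1 li.2) (fun li => (li.1 < N)%N) b ->
    lspan (fun li : nat * 'I_q => u li.1 li.2) (fun li => (li.1 < N)%N) (a + b).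
  by move=> *; rewrite -[a]scale1r; exact: lspan_lin.
rewrite /psum; elim/big_ind : _ => //; first exact: lspan0.
move=> l _; elim/big_ind : _ => //; first exact: lspan0.
move=> j _; rewrite -[_ *: _]addr0.
by apply: (@lspanS _ _ _ _ (nat_of_ord l, j)) => //=; exact: lspan0.
Qed.

Lemma lspan_bounded w : lspan (fun li : nat * 'I_q => u li.1 li.2) (fun=> True) w ->
  exists N, forall M, (N <= M)%N ->
    lspan (fun li : nat * 'I_q => u li.1 li.2) (fun li => (li.1 < M)%N) w.
Proof.
elim=> [|a [l j] v _ _ [N hN]]; first by exists 0%N => M _; exact: lspan0.
exists (maxn N l.+1) => M; rewrite geq_max => /andP[NM lM].
by apply: lspanS => //; exact: hN.
Qed.

(** z lies in the closure of S plus the span of all u_l: no third component is missing from its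
    expansion. *)
Definition approx z := forall e : R, 0 < e -> exists s w, [/\ S s,
  lspan (fun li : nat * 'I_q => u li.1 li.2) (fun=> True) w & nrm (z - (s + w)) < e].

(** The error E is orthogonal to S and to u_l for l < n, while z - (s + w) differs from E by an
    element of their sum. By Pythagoras E is no longer than z - (s + w), for every admissible s and
    w. *)
Lemma expansion z : approx z -> hcvg (psum z) (z - pj cS z).
Proof.
move=> az e /az[s [w [Ss sw h]]]; have [N hN] := lspan_bounded sw.
exists N => n Nn; rewrite nrmC; apply: le_lt_trans h.
have zp : isproj S z (pj cS z) by exact: pj_isproj.
set E := _ - psum z n.
have ES t : S t -> ip E t = 0.
  move=> St; rewrite ipBl zp.2// sub0r ip_suml big1 ?oppr0// => l _.
  by rewrite ip_suml big1// => j _; rewrite ipZl uS// mulr0.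
have Eu t : lspan (fun li : nat * 'I_q => u li.1 li.2) (fun li => (li.1 < n)%N) t -> ip E t = 0.
  elim=> [|a [l j] v /= ln _ ih]; first by rewrite ip0r.
  rewrite ipDr ipZr ih addr0 !ipBl ip_psum// addrAC subrr sub0r.
  by rewrite [ip (pj _ _) _]ipC uS ?conjC0 ?oppr0 ?mulr0//; exact: pj_in.
rewrite /nrm ler_sqrt ?nrm2_ge0//.
have -> : z - (s + w) = E + ((pj cS z - s) + (psum z n - w)).
  by rewrite /E [RHS]addrACA addKr (addrA (z - _)) subrK opprD addrA.
rewrite [nrm2 (E + _)]pythagoras; first by rewrite lerDl nrm2_ge0.
rewrite ipDr ES ?add0r; last by apply: csubB => //; exact: pj_in.
by rewrite ipBr !Eu ?subr0//; [exact: hN|exact: psum_lspan].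
Qed.

End orthonormal_expansion.

Section gram_matrices.
Variable q : nat.
Definition gramm (x y : 'I_q -> H) : 'M[R[i]]_q := \matrix_(i, j) ip (x i) (y j).
Definition mact (M : 'M[R[i]]_q) (x : 'I_q -> H) : 'I_q -> H := fun i => \sum_j M i j *: x j.

Lemma gramm_mactl M (x y : 'I_q -> H) : gramm (mact M x) y = M *m gramm x y.
Proof.
apply/matrixP => i j; rewrite !mxE ip_suml; apply: eq_bigr => k _.
by rewrite ipZl mxE.
Qed.

Lemma grammC (x y : 'I_q -> H) : gramm y x = adjmx (gramm x y).
Proof. by apply/matrixP => i j; rewrite adjmxE !mxE ipC. Qed.

Lemma grammDl (x y z : 'I_q -> H) : gramm (fun i => x i + y i) z = gramm x z + gramm y z.
Proof. by apply/matrixP => i j; rewrite !mxE ipDl. Qed.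

Lemma grammNl (x z : 'I_q -> H) : gramm (fun i => - x i) z = - gramm x z.
Proof. by apply/matrixP => i j; rewrite !mxE ipNl. Qed.

Lemma gramm_suml I (r : seq I) (P : pred I) (F : I -> 'I_q -> H) (z : 'I_q -> H) :
  gramm (fun i => \sum_(k <- r | P k) F k i) z = \sum_(k <- r | P k) gramm (F k) z.
Proof.
by apply/matrixP => i j; rewrite summxE !mxE ip_suml; apply: eq_bigr => k _; rewrite mxE.
Qed.

Definition mcvg (A : nat -> 'M[R[i]]_q) L := forall i j, ccvg (fun n => A n i j) (L i j).

Lemma hcvg_gramm (x : nat -> 'I_q -> H) (y z : 'I_q -> H) : (forall i, hcvg (x^~ i) (y i)) ->
  mcvg (fun n => gramm (x n) z) (gramm y z).
Proof.
move=> h i j; rewrite mxE; have := hcvg_ip (z j) (h i).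
by move=> h1 e /h1[N hN]; exists N => n /hN; rewrite mxE.
Qed.

End gram_matrices.

End inner_product.

(** * Transport of closed spans between families with equal Gram matrices *)

Section transport.
Context {R : realType} {H1 H2 : semiHilbert R} {I : Type}.
Variables (x1 : I -> H1) (x2 : I -> H2).
Hypothesis x12 : forall i j, ip (x1 i) (x1 j) = ip (x2 i) (x2 j).
Implicit Types K : I -> Prop.

(** Equal Gram matrices determine the images of vectors only up to null vectors, so the isometry is
    a relation: the same linear combination is formed on both sides. *)
Inductive lrel K : H1 -> H2 -> Prop :=
| lrel0 : lrel K 0 0
| lrelS a i v w : K i -> lrel K v w -> lrel K (a *: x1 i + v) (a *: x2 i + w).

Lemma lrel_r K v w : lrel K v w -> lspan x2 K w.
Proof. by elim=> *; [exact: lspan0|exact: lspanS]. Qed.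
Lemma lrel_ex K v : lspan x1 K v -> exists w, lrel K v w.
Proof.
elim=> [|a i u Ki _ [w hw]]; first by exists 0; exact: lrel0.
by exists (a *: x2 i + w); exact: lrelS.
Qed.
Lemma lrelT K v w : lrel K v w -> lrel (fun=> True) v w.
Proof. by elim=> *; [exact: lrel0|exact: lrelS]. Qed.

Lemma lrel_ip K K' v w v' w' : lrel K v w -> lrel K' v' w' -> ip v v' = ip w w'.
Proof.
move=> h h'; elim: h => [|a i u u' _ _ ih]; first by rewrite !ip0l.
rewrite !ip_lin ih; congr (_ * _ + _).
elim: h' => [|b j s s' _ _ ih']; first by rewrite !ip0r.
by rewrite !ipDr !ipZr x12 ih'.
Qed.

Lemma lrel_nrm K K' v w v' w' : lrel K v w -> lrel K' v' w' -> nrm (v - v') = nrm (w - w').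
Proof.
move=> h h'; rewrite /nrm !nrm2B /nrm2 (lrel_ip h h) (lrel_ip h' h').
by rewrite (lrel_ip h h').
Qed.

Definition crel v w := forall e : R, 0 < e -> exists a b,
  [/\ lrel (fun=> True) a b, nrm (v - a) < e & nrm (w - b) < e].

(** Combinations approximating v have images at the same mutual distances, hence a Cauchy sequence;
    its limit is the partner of v. *)
Lemma crel_ex K v : clspan x1 K v -> exists2 w, clspan x2 K w & crel v w.
Proof.
move=> hv.
have [|ab hab] := @choice _ _ (fun n (ab : H1 * H2) => lrel K ab.1 ab.2 /\ nrm (v - ab.1) < n.+1%:R^-1).
  move=> n; have [|s hs h] := hv (n.+1%:R^-1); first by rewrite invr_gt0.
  by have [w hw] := lrel_ex hs; exists (s, w).
have hN (e : R) : 0 < e -> exists N, forall n, (N <= n)%N -> (n.+1%:R^-1 : R) < e.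
  move=> e0; exists (Num.trunc (e^-1)) => n Nn; rewrite invf_plt ?posrE//.
  by rewrite (lt_le_trans (truncnS_gt _))// ler_nat.
have [|w hw] := complete (u := fun n => (ab n).2).
  move=> e e0; have e2 : 0 < e / 2 by rewrite divr_gt0.
  have [N h] := hN _ e2; exists N => m n Nm Nn.
  rewrite -(lrel_nrm (hab m).1 (hab n).1).
  have := nrm_tri v (ab m).1 (ab n).1; rewrite (nrmC (ab m).1 v).
  move: (hab m).2 (hab n).2 (h _ Nm) (h _ Nn).
  by move: (m.+1%:R^-1) (n.+1%:R^-1) => im jn *; lra.
exists w.
  move=> e /hw[N h]; exists (ab N).2; first exact: lrel_r (hab N).1.
  by rewrite nrmC; exact: h.
move=> e e0; have [N h] := hw e e0; have [M h'] := hN e e0.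
exists (ab (maxn N M)).1, (ab (maxn N M)).2; split.
- exact: lrelT (hab _).1.
- by apply: lt_trans (hab _).2 _; apply: h'; exact: leq_maxr.
- by rewrite nrmC; apply: h; exact: leq_maxl.
Qed.

Lemma crel_nrm v w v' w' : crel v w -> crel v' w' -> nrm (v - v') = 0 -> nrm (w - w') = 0.
Proof.
move=> h h' v0; apply/eqP; rewrite eq_le nrm_ge0 andbT leNgt; apply/negP => e0.
have e4 : 0 < nrm (w - w') / 4 by rewrite divr_gt0.
have [a [b [h1 h2 h3]]] := h _ e4; have [a' [b' [h1' h2' h3']]] := h' _ e4.
have := lrel_nrm h1 h1'.
have := nrm_tri b w w'; have := nrm_tri b' b w'; have := nrm_tri v a a'.
have := nrm_tri v' v a'; rewrite (nrmC b' w') (nrmC a v); lra.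
Qed.

End transport.

Lemma crelC (R : realType) (H1 H2 : semiHilbert R) I (x1 : I -> H1) (x2 : I -> H2) v w :
  crel x1 x2 v w -> crel x2 x1 w v.
Proof.
move=> h e /h[a [b [h1 h2 h3]]]; exists b, a; split => //.
by elim: h1 => *; [exact: lrel0|exact: lrelS].
Qed.

(** v has a partner in the span of K and one in the span of K'; they are at distance 0, so the
    inclusion applies to one of them, and the result is carried back. *)
Lemma clspan_inter_transport (R : realType) (H1 H2 : semiHilbert R) (I : Type)
    (x1 : I -> H1) (x2 : I -> H2) (K K' K'' : I -> Prop) :
  (forall i j, ip (x1 i) (x1 j) = ip (x2 i) (x2 j)) ->
  (forall w, clspan x2 K w -> clspan x2 K' w -> clspan x2 K'' w) ->
  forall v, clspan x1 K v -> clspan x1 K' v -> clspan x1 K'' v.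
Proof.
move=> x12 h v hK hK'.
have x21 i j : ip (x2 i) (x2 j) = ip (x1 i) (x1 j) by rewrite x12.
have [w hw vw] := crel_ex x12 hK; have [w' hw' vw'] := crel_ex x12 hK'.
have ww : nrm (w - w') = 0 by apply: (crel_nrm x12 vw vw'); rewrite subrr nrm0.
have Kw' : clspan x2 K' w by apply: (csub_null (csub_clspan _ _) hw' ww).
have [v' hv' wv] := crel_ex x21 (h w hw Kw').
apply: (csub_null (csub_clspan _ _) hv').
by apply: (crel_nrm x21 (crelC vw) wv); rewrite subrr nrm0.
Qed.

(** * The series expansion in an abstract Hilbert space *)

Section matrix_limits.
Context {R : realType} (q : nat).
Implicit Types (A : nat -> 'M[R[i]]_q) (L M : 'M[R[i]]_q).

Lemma ccvg_cst (c : R[i]) : ccvg (fun=> c) c.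
Proof. by move=> e e0; exists 0%N => n _; rewrite subrr normc0. Qed.

Lemma ccvgD (a b : nat -> R[i]) l m : ccvg a l -> ccvg b m -> ccvg (fun n => a n + b n) (l + m).
Proof.
move=> ha hb e e0; have e2 : 0 < e / 2 by rewrite divr_gt0.
have [N hN] := ha _ e2; have [N' hN'] := hb _ e2; exists (maxn N N') => n.
rewrite geq_max => /andP[/hN h1 /hN' h2].
by rewrite opprD addrACA (le_lt_trans (le_normcD _ _))// [ltRHS]splitr ltrD.
Qed.

Lemma ccvgZ c (a : nat -> R[i]) l : ccvg a l -> ccvg (fun n => c * a n) (c * l).
Proof.
move=> ha e e0; have c1 : 0 < normc c + 1 by rewrite ltr_wpDl// normc_ge0.
have [|N hN] := ha (e / (normc c + 1)); first by rewrite divr_gt0.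
exists N => n /hN; rewrite -mulrBr normcM ltr_pdivlMr//; apply: le_lt_trans.
by rewrite mulrC ler_wpM2l ?normc_ge0// lerDl.
Qed.

Lemma ccvg_sum I (r : seq I) (a : I -> nat -> R[i]) l :
  (forall i, ccvg (a i) (l i)) -> ccvg (fun n => \sum_(i <- r) a i n) (\sum_(i <- r) l i).
Proof.
move=> h; elim: r => [|i r ih].
  by rewrite big_nil; under [X in ccvg X _]eq_fun do rewrite big_nil; exact: ccvg_cst.
rewrite big_cons; under [X in ccvg X _]eq_fun do rewrite big_cons.
exact: ccvgD.
Qed.

Lemma eq_ccvg (a b : nat -> R[i]) l : a =1 b -> ccvg a l -> ccvg b l.
Proof. by move=> ab h e /h[N hN]; exists N => n /hN; rewrite ab. Qed.

Lemma eq_mcvg A B L : A =1 B -> mcvg A L -> mcvg B L.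
Proof. by move=> AB h i j; apply: eq_ccvg (h i j) => n; rewrite AB. Qed.

Lemma mcvg_mull M A L : mcvg A L -> mcvg (fun n => M *m A n) (M *m L).
Proof.
move=> h i j; rewrite mxE; apply: (@eq_ccvg (fun n => \sum_k M i k * A n k j)).
  by move=> n; rewrite mxE.
by apply: ccvg_sum => k; exact: ccvgZ.
Qed.

Lemma mcvg_scale c A L : mcvg A L -> mcvg (fun n => c *: A n) (c *: L).
Proof.
move=> h i j; rewrite mxE; apply: (@eq_ccvg (fun n => c * A n i j)).
  by move=> n; rewrite mxE.
exact: ccvgZ.
Qed.

Lemma mcvg_lim A L : mcvg A L -> (A : nat -> 'M[R[i]^o]_q) @ \oo --> (L : 'M[R[i]^o]_q).
Proof.
move=> h B [P LP PB]; rewrite /nbhs /=.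
have : \forall n \near \oo, forall ij : 'I_q * 'I_q, P ij.1 ij.2 (A n ij.1 ij.2).
  apply: filter_forall => -[i j] /=.
  have /nbhs_ballP[e /= e0 eP] := LP i j.
  (* A positive element of R[i] is real, so e and [Re e] define the same ball. *)
  have [|N hN] := h i j (Re e); first by move: e0; rewrite ltcE => /andP[].
  exists N => // n /hN hn; apply: eP; rewrite -ball_normE /= distrC.
  rewrite ltcE /=; move: e0; rewrite ltcE => /andP[/eqP /= ie _].
  by rewrite ie eqxx.
by apply: filterS => n hn; apply: PB => i j; exact: (hn (i, j)).
Qed.

Lemma mcvg_mxsum A L : mcvg (fun N => \sum_(l < N) A l) L -> mxsummable A /\ mxsum A = L.
Proof.
move=> h.
have {}h : (series A : nat -> 'M[R[i]^o]_q) @ \oo --> (L : 'M[R[i]^o]_q).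
  apply: mcvg_lim; apply: eq_mcvg h => n.
  by rewrite /series /= big_mkord.
split; first by apply/cvg_ex; exists L.
by apply: cvg_lim h; exact: norm_hausdorff.
Qed.

End matrix_limits.

Section alternating_series.
Context {R : realType} {H : semiHilbert R} (q : nat).
Variables (SA SB K : H -> Prop).
Hypotheses (cA : csub SA) (cB : csub SB) (cK : csub K).
Hypotheses (AK : forall z, SA z -> K z) (BK : forall z, SB z -> K z).
Variables (u v : nat -> 'I_q -> H) (x y eta : 'I_q -> H).
Hypothesis ou : forall l m i j, ip (u l i) (u m j) = ((l == m) && (i == j))%:R.
Hypothesis ov : forall l m i j, ip (v l i) (v m j) = ((l == m) && (i == j))%:R.
Hypothesis uA : forall l i s, SA s -> ip (u l i) s = 0.
Hypothesis vB : forall l i s, SB s -> ip (v l i) s = 0.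
Hypothesis KA : forall z, K z -> approx u SA z.
Hypothesis KB : forall z, K z -> approx v SB z.
Variables (C : 'M[R[i]]_q) (beta : nat -> 'M[R[i]]_q) (b : nat -> nat -> 'M[R[i]]_q).
Hypothesis Cunit : C \in unitmx.
Hypothesis xB : forall i, SB (x i).
Hypothesis xu : forall l, gramm x (u l) = if l == 0%N then C else 0.
Hypothesis uv : forall l j, gramm (u l) (v j) = - beta (j + l).+1.
Hypothesis ueta : forall l, gramm (u l) eta = - beta l.
Hypothesis etaB : forall i, SB (eta i).
Hypothesis xeta : gramm x eta = 0.
Hypotheses (yA : forall i, SA (y i)) (yB : forall i, SB (y i)).
Hypothesis xy : forall i z, SA z -> SB z -> ip (x i - y i) z = 0.
Hypothesis b0 : forall j, b 0%N j = if j == 0%N then 1%:M else 0.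
Hypothesis bS : forall k j, b k.+1 j = mxsum (fun l => b k l *m
  (if odd k then adjmx (beta (j + l).+1) else beta (j + l).+1)).

Let S := alt SA SB.
Let cS k : csub (S k). Proof. by rewrite /S /alt; case: odd. Qed.
Let sys k := if odd k then v else u.

(** As x lies in SB, the first projection is onto SA. [resid k.+1] is the part of [resid k]
    orthogonal to [S k.+1], and this part is expanded in [sys k], the system complementing
    [S k.+1]. *)
Fixpoint resid k : 'I_q -> H :=
  if k is k'.+1 then fun i => resid k' i - pj (cS k'.+1) (resid k' i) else x.

Let SK k z : S k z -> K z.
Proof. by rewrite /S /alt; case: odd; [exact: AK|exact: BK]. Qed.

Let residK k i : K (resid k i).
Proof.
elim: k => [|k ih] /=; first exact: BK.
by apply: csubB => //; apply: (SK (k := k.+1)); exact: pj_in.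
Qed.

Let resid_orth k i z : S k.+1 z -> ip (resid k.+1 i) z = 0.
Proof. by move=> Sz /=; exact: pj_orth. Qed.

Let resid_lim k i : hcvg (fun N => \sum_(l < N) mact (gramm (resid k) (sys k l)) (sys k l) i)
  (resid k.+1 i).
Proof.
have osys l m i' j : ip (sys k l i') (sys k m j) = ((l == m) && (i' == j))%:R.
  by rewrite /sys; case: odd; [exact: ov|exact: ou].
have sysS l i' s : S k.+1 s -> ip (sys k l i') s = 0.
  by rewrite /S /alt /sys /=; case: odd => /=; [exact: vB|exact: uA].
have apx : approx (sys k) (S k.+1) (resid k i).
  by rewrite /sys /S /alt /=; case: odd => /=; [exact: KB|exact: KA].
have := expansion osys (cS k.+1) sysS apx.
have -> : (fun N => \sum_(l < N) mact (gramm (resid k) (sys k l)) (sys k l) i) =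
  psum (sys k) (resid k i).
  apply/funext => N; rewrite /psum /mact; apply: eq_bigr => l _.
  by apply: eq_bigr => j _; rewrite mxE.
by [].
Qed.

(** One computation serves twice: with t the next system it yields the recursion for b, with t = eta
    the terms of the series. The summability comes from the convergence of the expansion of
    [resid k.+1], as C is invertible. *)
Let resid_gramm k (t : 'I_q -> H) (B : nat -> 'M[R[i]]_q) :
  (forall l, gramm (resid k) (sys k l) = (-1) ^+ k *: (C *m b k l)) ->
  (forall l, gramm (sys k l) t = - B l) ->
  mxsummable (fun l => b k l *m B l) /\
  gramm (resid k.+1) t = (-1) ^+ k.+1 *: (C *m mxsum (fun l => b k l *m B l)).
Proof.
move=> hc ht.
have h := hcvg_gramm t (fun i => resid_lim k i).
have {}h : mcvg (fun N => (-1) ^+ k.+1 *: (C *m (\sum_(l < N) b k l *m B l))) (gramm (resid k.+1) t).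
  apply: eq_mcvg h => N; rewrite gramm_suml mulmx_sumr scaler_sumr.
  apply: eq_bigr => l _; rewrite gramm_mactl hc ht mulmxN -scalemxAl -scalerN exprS mulN1r scaleNr scalerN.
  by rewrite mulmxA.
have {}h := mcvg_mull (invmx C) (mcvg_scale ((-1) ^+ k.+1) h).
have {}h : mcvg (fun N => \sum_(l < N) b k l *m B l)
    (invmx C *m ((-1) ^+ k.+1 *: gramm (resid k.+1) t)).
  apply: eq_mcvg h => N.
  by rewrite scalerA -expr2 sqrr_sign scale1r mulmxA mulVmx// mul1mx.
have [s1 s2] := mcvg_mxsum (A := fun l => b k l *m B l) h; split => //; rewrite s2.
by rewrite mulmxA mulmxV// mul1mx scalerA -expr2 sqrr_sign scale1r.
Qed.

Let resid_coef k l : gramm (resid k) (sys k l) = (-1) ^+ k *: (C *m b k l).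
Proof.
elim: k l => [|k ih] l.
  rewrite expr0 scale1r b0 /= /sys /= xu.
  by case: ifP => _; rewrite ?mulmx1 ?mulmx0.
rewrite bS; apply: (resid_gramm ih _).2 => m.
rewrite /sys /=; case: odd => /=; last by rewrite uv.
(* Odd k: the pair is (v, u) instead of (u, v), whence the adjoint of beta; the index of beta is
   symmetric in the two positions. *)
rewrite grammC uv addnC; apply/matrixP => i j.
by rewrite adjmxE [in LHS]mxE [in RHS]mxE adjmxE rmorphN.
Qed.

Let resid_eta k : mxsummable (fun l => b k.*2 l *m beta l) /\
  gramm (resid k.*2.+1) eta = - (C *m mxsum (fun l => b k.*2 l *m beta l)).
Proof.
have [l|h1 h2] := resid_gramm (B := beta) (t := eta) (resid_coef k.*2).
  by rewrite /sys odd_double ueta.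
by split => //; rewrite h2 exprS -signr_odd odd_double mulr1 scaleN1r.
Qed.

Let z i k : H := \sum_(m < k.+1) (-1) ^+ m *: resid m i.

Let zS i k : z i k.+1 = z i k + (-1) ^+ k.+1 *: resid k.+1 i.
Proof. by rewrite /z big_ord_recr. Qed.

Let z_in i k : S k (z i k).
Proof.
(* Induction in steps of two: z_(k+2) - z_k is, up to sign, a projection onto S_(k+2) = S_k. *)
suff : S k (z i k) /\ S k.+1 (z i k.+1) by case.
elim: k => [|k [ih1 ih2]].
  split; first by rewrite /z big_ord1 expr0 scale1r; exact: xB.
  rewrite zS /z big_ord1 expr0 scale1r expr1 scaleN1r /= opprB addrC subrK.
  exact: pj_in.
split => //.
have e : S k.+2 = S k by rewrite /S /alt /= negbK.
rewrite zS zS -addrA; apply: csubD => //; first by rewrite e.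
have -> : (-1) ^+ k.+1 *: resid k.+1 i + (-1) ^+ k.+2 *: resid k.+2 i =
    (-1) ^+ k.+1 *: pj (cS k.+2) (resid k.+1 i).
  by rewrite [in X in _ + X]exprS mulN1r scaleNr [resid k.+2 i]/= scalerBr opprB addrC subrK.
by apply: csubZ => //; exact: pj_in.
Qed.

Let z_proj i k : isproj (S k.+1) (z i k) (z i k.+1).
Proof.
split; first exact: z_in.
move=> t St; rewrite zS opprD addrA subrr sub0r ipNl ipZl resid_orth//.
by rewrite mulr0 oppr0.
Qed.

(** Two steps add - r_(2k+1) + r_(2k+2). The even residual is orthogonal to SB, which contains eta,
    so only the odd residuals contribute. *)
Let z_eta k : gramm (fun i => z i k.*2) eta =
  C *m \sum_(m < k) mxsum (fun l => b m.*2 l *m beta l).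
Proof.
elim: k => [|k ih].
  rewrite big_ord0 mulmx0 -xeta; apply/matrixP => i j.
  by rewrite !mxE /z big_ord1 expr0 scale1r.
rewrite big_ord_recr /= mulmxDr -ih doubleS.
have -> : (fun i => z i k.*2.+2) = (fun i => z i k.*2 + (- resid k.*2.+1 i + resid k.*2.+2 i)).
  apply/funext => i; rewrite !zS -addrA !exprS -signr_odd odd_double.
  by rewrite !mulr1 mulrNN mulr1 scaleN1r scale1r.
rewrite grammDl; congr (_ + _); rewrite grammDl grammNl (resid_eta k).2 opprK.
rewrite -[RHS]addr0; congr (_ + _); apply/matrixP => i j; rewrite [LHS]mxE [RHS]mxE.
by apply: resid_orth; rewrite /S /alt /= odd_double.
Qed.

(* [z i k] is x_i plus the alternating sum of the residuals, each the expansion of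
   the previous one along u or v; [z_eta] reads off the partial sums of the series. *)
Theorem alternating_series :
  [/\ forall k, mxsummable (fun l => b k.*2 l *m beta l),
      mxsummable (fun k => mxsum (fun l => b k.*2 l *m beta l)) &
      gramm y eta = C *m mxsum (fun k => mxsum (fun l => b k.*2 l *m beta l))].
Proof.
have zl i : hcvg (fun k => z i k.*2) (y i).
  have [w [wA wB xw hw]] := alternating_projections cA cB (z_proj i).
  have z0 : z i 0%N = x i by rewrite /z big_ord1 expr0 scale1r.
  (* Both w and y are projections of x onto the intersection of SA and SB, hence differ by a null
     vector. *)
  have hy : nrm (w - y i) = 0.
    have wyA : SA (w - y i) by exact: csubB.
    have wyB : SB (w - y i) by exact: csubB.
    apply/nrm_eq0; rewrite /nrm2.
    have -> : ip (w - y i) (w - y i) = ip (x i - y i - (x i - w)) (w - y i).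
      by congr (ip _ _); rewrite opprB [RHS]addrC addrA subrK.
    by rewrite ipBl xy// -z0 xw// subrr.
  have := hcvg_null hw hy.
  by move=> h e /h[N hN]; exists N => n Nn; apply: hN; rewrite -addnn (leq_trans Nn)// leq_addr.
have h := hcvg_gramm eta zl.
have {}h : mcvg (fun k => \sum_(m < k) mxsum (fun l => b m.*2 l *m beta l)) (invmx C *m gramm y eta).
  have := mcvg_mull (invmx C) h; apply: eq_mcvg => k.
  by rewrite z_eta mulmxA mulVmx// mul1mx.
have [s1 s2] := mcvg_mxsum (A := fun m => mxsum (fun l => b m.*2 l *m beta l)) h.
split.
- by move=> k; have [hk _] := resid_eta k.
- exact: s1.
- by rewrite s2 mulmxA mulmxV// mul1mx.
Qed.

End alternating_series.

(** * Completeness of L2 *)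

Section fast_sequences.
Context {R : realType}.
Variables (s : nat -> R) (M : R).
Hypothesis hs : forall k, `|s k.+1 - s k| <= M * 2^-1 ^+ k.

(** The factor 1 - 2^-j, dropped in [fast_seq_bound2], is what makes the induction on j close. *)
Lemma fast_seq_bound k j : `|s (k + j)%N - s k| <= 2 * M * 2^-1 ^+ k * (1 - 2^-1 ^+ j).
Proof.
elim: j => [|j ih]; first by rewrite addn0 subrr normr0 expr0 subrr mulr0.
rewrite addnS (_ : s _ - s k = (s (k + j).+1 - s (k + j)%N) + (s (k + j)%N - s k)); last first.
  by rewrite addrA subrK.
rewrite (le_trans (ler_normD _ _))//; have := lerD (hs (k + j)%N) ih.
move/le_trans; apply; rewrite exprD [in leRHS]exprS le_eqVlt; apply/orP; left; apply/eqP.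
by field.
Qed.

Lemma fast_seq_bound2 k j : (k <= j)%N -> `|s j - s k| <= 2 * M * 2^-1 ^+ k.
Proof.
move=> kj; rewrite -(subnKC kj) (le_trans (fast_seq_bound _ _))//.
have M0 : 0 <= M by have := le_trans (normr_ge0 _) (hs 0%N); rewrite expr0 mulr1.
have k0 : 0 <= (2^-1 : R) ^+ k by rewrite exprn_ge0// invr_ge0.
by rewrite -[leRHS]mulr1 ler_wpM2l ?mulr_ge0// lerBlDr lerDl exprn_ge0// invr_ge0.
Qed.

Lemma fast_seq_cvg : cvgn s.
Proof.
apply/cauchy_cvgP/cauchy_ballP => e e0.
have M0 : 0 <= M by have := le_trans (normr_ge0 _) (hs 0%N); rewrite expr0 mulr1.
have h : (fun k => 2 * M * (2^-1 : R) ^+ k) @ \oo --> 2 * M * 0.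
  by apply: cvgMr; apply: cvg_expr; rewrite ger0_norm ?invr_ge0// invf_lt1// ltr1n.
rewrite mulr0 in h.
have /cvgrPdist_lt/(_ (e / 2)) := h; rewrite divr_gt0// => /(_ isT)[N _ hN].
have hN' j : (N <= j)%N -> `|s j - s N| < e / 2.
  move=> Nj; apply: le_lt_trans (fast_seq_bound2 Nj) _.
  by have := hN N (leqnn _); rewrite /= sub0r normrN ger0_norm// !mulr_ge0.
exists (s @` [set k | (N <= k)%N], s @` [set k | (N <= k)%N]) => /=.
  by split; exists N => // k /= Nk; exists k.
move=> [_ _] /= [[m Nm <-] [n Nn <-]]; rewrite /ball /=.
have := hN' _ Nm; have := hN' _ Nn; rewrite -[s n - _]opprB normrN => h1 h2.
rewrite (_ : s m - s n = (s m - s N) + (s N - s n)); last by rewrite addrA subrK.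
by rewrite (le_lt_trans (ler_normD _ _))// [ltRHS]splitr ltrD.
Qed.

Lemma fast_seq_lim k : `|s k - limn s| <= 2 * M * 2^-1 ^+ k.
Proof.
rewrite distrC; have h : `|s j - s k| @[j --> \oo] --> `|limn s - s k|.
  by apply: cvg_norm; apply: cvgB; [exact: fast_seq_cvg|exact: cvg_cst].
rewrite -(cvg_lim _ h)//; apply: limr_le; first by apply/cvg_ex; eexists; exact: h.
by exists k => // j /= kj; exact: fast_seq_bound2.
Qed.

End fast_sequences.

Section riesz_fischer.
Context d (T : measurableType d) (R : realType).
Variables (mu : {measure set T -> \bar R}) (D : set T).
Hypothesis mD : measurable D.
Notation L2 := (inL2 mu D).
Notation RI := (RI mu D).

Lemma RI_sqr_tri (f g h : T -> R[i]) : L2 (fun x => f x - g x) -> L2 (fun x => g x - h x) ->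
  RI (fun x => normc (f x - h x) ^+ 2) <=
  2 * (RI (fun x => normc (f x - g x) ^+ 2) + RI (fun x => normc (g x - h x) ^+ 2)).
Proof.
move=> fg gh.
have fh : L2 (fun x => f x - h x).
  have := inL2D mD fg gh.
  by under eq_fun do rewrite addrA subrK.
rewrite -RI_D ?(inL2_rint fg) ?(inL2_rint gh)// -RI_Z//; last first.
  by apply: rintD => //; exact: inL2_rint.
apply: RI_le => //; first exact: inL2_rint.
  by apply: rintZ => //; apply: rintD => //; exact: inL2_rint.
by move=> x _; have := normcD_sqr (f x - g x) (g x - h x); rewrite addrA subrK.
Qed.

Variable u : nat -> T -> R[i].
Hypothesis u2 : forall n, L2 (u n).
Hypothesis cu : forall e : R, 0 < e -> exists N, forall m n, (N <= m)%N -> (N <= n)%N ->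
  RI (fun x => normc (u m x - u n x) ^+ 2) < e.

(* Along a subsequence with |u_{k+1} - u_k|_2^2 < 16^-k, the integrable majorant
   sum_k 4^k |u_{k+1} - u_k|^2 controls the pointwise convergence. *)
Theorem riesz_fischer : exists2 f, L2 f & forall e : R, 0 < e -> exists N, forall n, (N <= n)%N ->
  RI (fun x => normc (u n x - f x) ^+ 2) < e.
Proof.
have p0 (a : R) k : 0 < a -> 0 < a ^+ k by move=> a0; rewrite exprn_gt0.
have [N hN] : {N : nat -> nat & forall k m n, (N k <= m)%N -> (N k <= n)%N ->
    RI (fun x => normc (u m x - u n x) ^+ 2) < 16^-1 ^+ k}.
  by apply: (@choice _ _ (fun k N => forall m n, (N <= m)%N -> (N <= n)%N ->
    RI (fun x => normc (u m x - u n x) ^+ 2) < 16^-1 ^+ k)) => k; apply: cu; rewrite p0// invr_gt0.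
(* The running maximum makes the indices nondecreasing and admissible for every tolerance up to k;
   the summand k makes them unbounded. *)
pose nk k := (k + \max_(j < k.+1) N j)%N.
have nkS k : (nk k <= nk k.+1)%N by rewrite {2}/nk big_ord_recr /= leq_add// leq_maxl.
have nkN k : (N k <= nk k)%N by rewrite /nk big_ord_recr /= (leq_trans _ (leq_addl _ _))// leq_maxr.
pose uk k := u (nk k).
pose a k x := normc (uk k.+1 x - uk k x).
have ma k : measurable_fun D (a k).
  by apply: measurable_normc => //; apply: cmeasB => //; case: (u2 (nk k.+1)); case: (u2 (nk k)).
(* The weight 4^k leaves a series with integral at most the sum of 4^-k, that is 4/3, and still
   forces a_k^2 <= 4^-k G pointwise. *)
pose G x := (\sum_(k <oo) (4 ^+ k * a k x ^+ 2)%:E)%E.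
have t0 k x : (0 <= (4 ^+ k * a k x ^+ 2)%:E)%E by rewrite lee_fin mulr_ge0// ?sqr_ge0// ltW// p0.
have mt k : measurable_fun D (fun x => (4 ^+ k * a k x ^+ 2)%:E).
  by apply/measurable_EFinP; apply: measurable_funM => //; apply: measurable_funX.
have iG : (\int[mu]_(x in D) G x <= 2%:E)%E.
  rewrite /G integral_nneseries//.
  apply: lime_le.
    by apply: is_cvg_nneseries => k _ _; exact: integral_ge0.
  apply: nearW => n.
  have h k : (\int[mu]_(x in D) (4 ^+ k * a k x ^+ 2)%:E <= (4^-1 ^+ k)%:E)%E.
    have La : L2 (fun x => uk k.+1 x - uk k x) by apply: inL2B => //; exact: u2.
    rewrite RI_EFin//; last by apply: rintZ => //; exact: inL2_rint La.
    rewrite lee_fin RI_Z//; last exact: inL2_rint La.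
    have := ltW (hN k (nk k.+1) (nk k) (leq_trans (nkN k) (nkS k)) (nkN k)).
    rewrite -(ler_pM2l (p0 4 k (ltr0n _ 4))) => /le_trans; apply.
    by rewrite -exprMn; apply: lerXn2r; rewrite ?nnegrE; lra.
  apply: (@le_trans _ _ (\sum_(0 <= k < n) (4^-1 ^+ k)%:E)%E); first by apply: lee_sum => k _.
  rewrite sumEFin lee_fin.
  suff : \sum_(0 <= k < n) 4^-1 ^+ k <= 4 / 3 * (1 - 4^-1 ^+ n) :> R.
    move/le_trans; apply; have := p0 4^-1 n; rewrite invr_gt0 ltr0n => /(_ isT).
    by move: (4^-1 ^+ n) => t *; lra.
  elim: n => [|n ih]; first by rewrite big_nil expr0; lra.
  rewrite big_nat_recr //= exprS; move: ih.
  by move: (\sum_(0 <= i < n) _) (4^-1 ^+ n) => S t *; lra.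
have G0 x : (0 <= G x)%E by apply: nneseries_ge0 => k _ _.
have mG : measurable_fun D G.
  by apply: (ge0_emeasurable_sum (P := xpredT)) => // k x _ _; exact: t0.
have IG : mu.-integrable D G.
  apply/integrableP; split => //; under eq_integral do rewrite gee0_abs//.
  by rewrite (le_lt_trans iG)// ltry.
pose g x := fine (G x).
have Ig : rint mu D g.
  have mg : measurable_fun D (fun x => (g x)%:E).
    by apply/measurable_EFinP; apply: (measurableT_comp (f := fine)) => //; exact: fine_measurable.
  apply: (le_integrable mD mg _ IG) => x _; rewrite /g.
  by have := G0 x; case: (G x) => [r|_|//] /=; rewrite ?lexx// normr0 leey.
have g0 x : 0 <= g x by rewrite fine_ge0.
have gI : RI g <= 2.
  rewrite -lee_fin -RI_EFin//; apply: le_trans iG.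
  have mg : measurable_fun D (fun x => (g x)%:E).
    by apply/measurable_EFinP; exact: rint_meas Ig.
  apply: ge0_le_integral => //; first by move=> x _; rewrite lee_fin.
  by move=> x _; rewrite /g; have := G0 x; case: (G x) => [r|_|//] /=; rewrite ?leey.
have ag k x : (G x < +oo)%E -> a k x ^+ 2 <= g x * 4^-1 ^+ k.
  move=> Gx; rewrite exprVn ler_pdivlMr ?p0// mulrC -lee_fin /g fineK ?ge0_fin_numE//.
  apply: (@le_trans _ _ (\sum_(0 <= j < k.+1) (4 ^+ j * a j x ^+ 2)%:E)%E).
    by rewrite big_nat_recr //= leeDr// sume_ge0.
  by apply: (@nneseries_lim_ge R (fun j => (4 ^+ j * a j x ^+ 2)%:E) xpredT 0 k.+1).
(* Replaced by 0 where G is infinite, the sequence converges at every point, so its limit is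
   measurable without an exceptional set. *)
pose v k x := if (G x < +oo)%E then uk k x else 0.
have mv k : cmeasurable D (v k).
  by apply: cmeas_if => //; [exact: measurable_fun_lte|case: (u2 (nk k))].
have va k x : normc (v k.+1 x - v k x) <= Num.sqrt (g x) * 2^-1 ^+ k.
  rewrite /v; case: ifPn => Gx; last first.
    by rewrite subrr normc0 mulr_ge0 ?sqrtr_ge0// ltW// p0// invr_gt0.
  rewrite -(@ler_pXn2r _ 2)// ?nnegrE ?normc_ge0 ?mulr_ge0 ?sqrtr_ge0//.
  rewrite exprMn sqr_sqrtr// -exprM mulnC exprM (_ : 2^-1 ^+ 2 = 4^-1 :> R).
    exact: ag.
  by rewrite exprVn -natrX.
have vR x k : `|Re (v k.+1 x) - Re (v k x)| <= Num.sqrt (g x) * 2^-1 ^+ k.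
  by rewrite -ReB (le_trans (Re_le_normc _)).
have vI x k : `|Im (v k.+1 x) - Im (v k x)| <= Num.sqrt (g x) * 2^-1 ^+ k.
  by rewrite -ImB (le_trans (Im_le_normc _)).
pose f x : R[i] := Complex (limn (fun k => Re (v k x))) (limn (fun k => Im (v k x))).
have mf : cmeasurable D f.
  split.
    apply: (@measurable_fun_cvg _ _ _ D (fun k x => Re (v k x))).
      by move=> k; case: (mv k).
    by move=> x _; exact: (fast_seq_cvg (vR x)).
  apply: (@measurable_fun_cvg _ _ _ D (fun k x => Im (v k x))).
    by move=> k; case: (mv k).
  by move=> x _; exact: (fast_seq_cvg (vI x)).
have vf k x : normc (v k x - f x) ^+ 2 <= 16 * g x * 4^-1 ^+ k.
  rewrite normc2 ReB ImB /=.
  have h (r : R) : `|r| <= 2 * Num.sqrt (g x) * 2^-1 ^+ k -> r ^+ 2 <= 4 * g x * 4^-1 ^+ k.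
    move=> hr; rewrite -real_normK ?num_real//.
    apply: (@le_trans _ _ ((2 * Num.sqrt (g x) * 2^-1 ^+ k) ^+ 2)).
      by rewrite lerXn2r ?nnegrE//; exact: le_trans hr.
    rewrite !exprMn sqr_sqrtr// -[(_ ^+ k) ^+ 2]exprM mulnC exprM.
    have -> : (2^-1 : R) ^+ 2 = 4^-1 by rewrite exprVn -natrX.
    by rewrite -natrX.
  have := h _ (fast_seq_lim (vR x) k); have := h _ (fast_seq_lim (vI x) k).
  have := mulr_ge0 (g0 x) (ltW (p0 4^-1 k _)); rewrite invr_gt0 ltr0n => /(_ isT).
  by move: (g x) (4^-1 ^+ k) (_ ^+ 2) (_ ^+ 2) => gx q4 A B *; nra.
have Gae : {ae mu, forall x, D x -> (G x < +oo)%E}.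
  apply: filterS (integrable_ae mD IG) => x h /h.
  by rewrite ge0_fin_numE.
have uv k : {ae mu, forall x, D x -> v k x = uk k x}.
  by apply: filterS Gae => x h /h hx; rewrite /v hx.
have v2 k : L2 (v k).
  apply: (inL2_ae mD (mv k) _ (u2 (nk k))).
  by apply: filterS (uv k) => x h /h ->.
have vf2 k : L2 (fun x => v k x - f x).
  apply: (inL2_le mD _ (g := fun x => 16 * 4^-1 ^+ k * g x)).
  - exact: cmeasB.
  - by move=> x _; rewrite mulrAC; exact: vf.
  - exact: rintZ.
have f2 : L2 f.
  have := inL2B mD (v2 0%N) (vf2 0%N).
  by under eq_fun do rewrite opprB addrC subrK.
exists f => // e e0.
have uf k : RI (fun x => normc (uk k x - f x) ^+ 2) <= 32 * 4^-1 ^+ k.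
  have -> : RI (fun x => normc (uk k x - f x) ^+ 2) = RI (fun x => normc (v k x - f x) ^+ 2).
    apply: RI_ae => //.
    - by apply: measurable_funX; apply: measurable_normc => //; apply: cmeasB => //; case: (u2 (nk k)).
    - by apply: measurable_funX; apply: measurable_normc => //; apply: cmeasB.
    - by apply: filterS (uv k) => x h /h ->.
  apply: (@le_trans _ _ (RI (fun x => 16 * 4^-1 ^+ k * g x))).
    apply: RI_le => //; [exact: inL2_rint (vf2 k)|exact: rintZ|].
    by move=> x _; rewrite mulrAC; exact: vf.
  rewrite RI_Z//; have := p0 4^-1 k; rewrite invr_gt0 ltr0n => /(_ isT).
  by move: gI; move: (RI g) (4^-1 ^+ k) => A B *; nra.
have [M hM] := cu (divr_gt0 e0 (ltr0n R 4 : 0 < 4)).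
have h : (fun k => 32 * (4^-1 : R) ^+ k) @ \oo --> 32 * (0 : R).
  by apply: cvgMr; apply: cvg_expr; rewrite ger0_norm ?invr_ge0// invf_lt1// ltr1n.
rewrite mulr0 in h.
have /cvgrPdist_lt/(_ (e / 4)) := h; rewrite divr_gt0// => /(_ isT)[M' _ hM'].
have [k [k1 k2]] : exists k, (M <= nk k)%N /\ 32 * 4^-1 ^+ k < e / 4.
  exists (maxn M M'); split; first by rewrite /nk (leq_trans _ (leq_addr _ _))// leq_maxl.
  by have := hM' (maxn M M') (leq_maxr _ _); rewrite /= sub0r normrN ger0_norm.
exists M => n Mn; apply: le_lt_trans (RI_sqr_tri (g := uk k) _ _) _.
- by apply: inL2B => //; exact: u2.
- by apply: inL2B => //; exact: u2.
have := hM n (nk k) Mn k1; have := uf k; lra.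
Qed.

End riesz_fischer.

Section L2_rows.
Context d (T : measurableType d) (R : realType) (q : nat).
Variables (mu : {measure set T -> \bar R}) (D : set T).

(** The proof [mD] is an argument so that the submodule structure can be declared for [isL2 mD]
    without a side condition. *)
Definition isL2 (mD : measurable D) : {pred T -> 'rV[R[i]]_q} :=
  fun f => `[< forall j, inL2 mu D (fun t => f t 0 j) >].

Variable mD : measurable D.

Lemma isL2P (f : T -> 'rV[R[i]]_q) : reflect (forall j, inL2 mu D (fun t => f t 0 j)) (f \in isL2 mD).
Proof. exact: asboolP. Qed.

Fact isL2_submod_closed : submod_closed (isL2 mD).
Proof.
split; first by apply/isL2P => j; under eq_fun do rewrite mxE; exact: inL20.
move=> a f g /isL2P hf /isL2P hg; apply/isL2P => j; under eq_fun do rewrite !mxE.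
by apply: inL2D => //; exact: inL2Z.
Qed.

HB.instance Definition _ := GRing.isSubmodClosed.Build R[i] (T -> 'rV[R[i]]_q)
  (isL2 mD) isL2_submod_closed.

Record L2space := MkL2 { L2fun : T -> 'rV[R[i]]_q; L2funP : L2fun \in isL2 mD }.

HB.instance Definition _ := [isSub for L2fun].
HB.instance Definition _ := [Choice of L2space by <:].
HB.instance Definition _ := [SubChoice_isSubLmodule of L2space by <:].

Implicit Types f g : L2space.

Lemma L2_inL2 f j : inL2 mu D (fun t => L2fun f t 0 j).
Proof. by have /isL2P := L2funP f. Qed.

Lemma L2funD f g t j : L2fun (f + g) t 0 j = L2fun f t 0 j + L2fun g t 0 j.
Proof. by rewrite [LHS]mxE. Qed.

Lemma L2funZ a f t j : L2fun (a *: f) t 0 j = a * L2fun f t 0 j.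
Proof. by rewrite [LHS]mxE. Qed.

Lemma L2funN f t j : L2fun (- f) t 0 j = - L2fun f t 0 j.
Proof. by rewrite [LHS]mxE. Qed.

Lemma L2funB f g t j : L2fun (f - g) t 0 j = L2fun f t 0 j - L2fun g t 0 j.
Proof. by rewrite L2funD L2funN. Qed.

Variables (c : R) (c0 : 0 < c).

(** The weight c is 1 / (2 pi) on the circle and 1 on the probability space, where rows of length
    one are used. *)
Definition L2ip f g : R[i] :=
  c%:C%C * \sum_j cintegral mu D (fun t => L2fun f t 0 j * (L2fun g t 0 j)^*).

Lemma L2ip_lin a f g k : L2ip (a *: f + g) k = a * L2ip f k + L2ip g k.
Proof.
rewrite /L2ip mulrCA -mulrDr; congr (_ * _); rewrite mulr_sumr -big_split /=.
apply: eq_bigr => j _.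
have If := inL2_mulJ mD (L2_inL2 f j) (L2_inL2 k j).
have Ig := inL2_mulJ mD (L2_inL2 g j) (L2_inL2 k j).
rewrite -CI_Z// -CI_D//; last exact: inL1Z.
apply: eq_CI => // t _; have /= -> := L2funD (a *: f) g t j.
by have /= -> := L2funZ a f t j; rewrite mulrDl mulrA.
Qed.

Lemma L2ipC f g : L2ip g f = (L2ip f g)^*.
Proof.
rewrite /L2ip rmorphM/= conjCR; congr (_ * _); rewrite rmorph_sum /=.
apply: eq_bigr => j _.
rewrite -CI_J//; last by apply: inL2_mulJ => //; exact: L2_inL2.
by apply: eq_CI => // t _; rewrite rmorphM/= conjCK mulrC.
Qed.

Lemma L2ip_norm f :
  L2ip f f = (c * \sum_j RI mu D (fun t => normc (L2fun f t 0 j) ^+ 2))%:C%C.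
Proof.
rewrite /L2ip rmorphM/=; congr (_ * _); rewrite rmorph_sum /=.
apply: eq_bigr => j _; rewrite -CI_real.
by apply: eq_CI => // t _; rewrite mulcJ.
Qed.

Lemma Re_L2ip f :
  Re (L2ip f f) = c * \sum_j RI mu D (fun t => normc (L2fun f t 0 j) ^+ 2).
Proof. by rewrite L2ip_norm. Qed.

Lemma L2ip_ge0 f : 0 <= Re (L2ip f f).
Proof.
rewrite Re_L2ip mulr_ge0 ?(ltW c0)// sumr_ge0// => j _.
by apply: RI_ge0 => // t _; exact: sqr_ge0.
Qed.

Lemma L2_complete (u : nat -> L2space) :
  (forall e : R, 0 < e -> exists N, forall m n, (N <= m)%N -> (N <= n)%N ->
     Re (L2ip (u m - u n) (u m - u n)) < e) ->
  exists v, forall e : R, 0 < e -> exists N, forall n, (N <= n)%N ->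
     Re (L2ip (u n - v) (u n - v)) < e.
Proof.
move=> cu.
have rf j := @riesz_fischer _ T R mu D mD (fun n t => L2fun (u n) t 0 j).
have {}rf j : exists2 f, inL2 mu D f & forall e : R, 0 < e -> exists N, forall n, (N <= n)%N ->
    RI mu D (fun x => normc (L2fun (u n) x 0 j - f x) ^+ 2) < e.
  apply: rf; first by move=> n; exact: L2_inL2.
  move=> e e0; have [|N hN] := cu (c * e); first exact: mulr_gt0.
  exists N => m n Nm Nn; have := hN m n Nm Nn.
  rewrite Re_L2ip ltr_pM2l// (bigD1 j)//; apply: le_lt_trans.
  have -> : RI mu D (fun x => normc (L2fun (u m) x 0 j - L2fun (u n) x 0 j) ^+ 2) =
      RI mu D (fun t => normc (L2fun (u m - u n) t 0 j) ^+ 2).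
    by apply: eq_RI => // t _; rewrite L2funB.
  by rewrite lerDl sumr_ge0// => k _; apply: RI_ge0 => // t _; exact: sqr_ge0.
have [f hf] : {f : 'I_q -> T -> R[i] & forall j, inL2 mu D (f j) /\
    forall e : R, 0 < e -> exists N, forall n, (N <= n)%N ->
    RI mu D (fun x => normc (L2fun (u n) x 0 j - f j x) ^+ 2) < e}.
  by apply: (@choice _ _ (fun (j : 'I_q) (f : T -> R[i]) => inL2 mu D f /\
    forall e : R, 0 < e -> exists N, forall n, (N <= n)%N ->
    RI mu D (fun x => normc (L2fun (u n) x 0 j - f x) ^+ 2) < e)) => j; have [g] := rf j; exists g.
have fL : (fun t => \row_j f j t) \in isL2 mD.
  by apply/isL2P => j; under eq_fun do rewrite mxE; exact: (hf j).1.
exists (MkL2 fL) => e e0.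
have q0 : 0 < c * (q%:R + 1) by rewrite mulr_gt0// ltr_wpDl.
have e1 : 0 < e / (c * (q%:R + 1)) by rewrite divr_gt0.
have [N hN] : {N : 'I_q -> nat & forall j n, (N j <= n)%N ->
    RI mu D (fun x => normc (L2fun (u n) x 0 j - f j x) ^+ 2) < e / (c * (q%:R + 1))}.
  by apply: (@choice _ _ (fun (j : 'I_q) (N : nat) => forall n, (N <= n)%N ->
    RI mu D (fun x => normc (L2fun (u n) x 0 j - f j x) ^+ 2) < e / (c * (q%:R + 1)))) => j; exact: (hf j).2.
exists (\max_j N j)%N => n Nn; rewrite Re_L2ip.
apply: (@le_lt_trans _ _ (c * \sum_(j < q) e / (c * (q%:R + 1)))).
  rewrite ler_pM2l//; apply: ler_sum => j _; apply: ltW.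
  have -> : RI mu D (fun t => normc (L2fun (u n - MkL2 fL) t 0 j) ^+ 2) =
      RI mu D (fun t => normc (L2fun (u n) t 0 j - f j t) ^+ 2).
    by apply: eq_RI => // t _; rewrite L2funB [L2fun (MkL2 fL) t 0 j]mxE.
  by apply: hN; rewrite (leq_trans _ Nn)// leq_bigmax.
rewrite sumr_const card_ord -mulr_natl.
rewrite (_ : c * _ = e * (q%:R / (q%:R + 1))); last by field; rewrite !gt_eqF// ltr_wpDl.
by rewrite gtr_pMr// ltr_pdivrMr ?mul1r ?ltrDl// ltr_wpDl.
Qed.

Definition L2H : semiHilbert R := SemiHilbert L2ip_lin L2ipC L2ip_ge0 L2_complete.

End L2_rows.

(** * Fourier analysis on the circle *)

Section expi_theory.
Context {R : realType}.
Implicit Types x y : R.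

Lemma expi0 : expi (0 : R) = 1.
Proof. by apply: complex_ext; rewrite /= ?cos0 ?sin0. Qed.

Lemma expiD x y : expi (x + y) = expi x * expi y.
Proof.
apply: complex_ext; rewrite ?ReM ?ImM /= ?cosD ?sinD//.
by rewrite addrC.
Qed.

Lemma expiN x : expi (- x) = (expi x)^*.
Proof. by apply: complex_ext; rewrite ?ReJ ?ImJ /= ?cosN ?sinN. Qed.

Lemma normc_expi x : normc (expi x) = 1.
Proof. by rewrite /= cos2Dsin2 sqrtr1. Qed.

Lemma expi_pi : expi (pi : R) = -1.
Proof. by apply: complex_ext; rewrite ?ReN ?ImN /= ?cospi ?sinpi ?oppr0. Qed.

Lemma expi_nat n x : expi (n%:R * x) = expi x ^+ n.
Proof.
elim: n => [|n ih]; first by rewrite mul0r expi0 expr0.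
by rewrite -natr1 mulrDl mul1r expiD ih exprSr.
Qed.

Lemma expi_2pi : expi (2 * pi : R) = 1.
Proof. by rewrite expi_nat expi_pi sqrrN expr1n. Qed.

Lemma expi_intper (k : int) x : expi (k%:~R * (x + 2 * pi)) = expi (k%:~R * x).
Proof.
rewrite mulrDr expiD; suff -> : expi (k%:~R * (2 * pi) : R) = 1 by rewrite mulr1.
case: k => n.
  by rewrite -[(Posz n)%:~R]/(n%:R) expi_nat expi_2pi expr1n.
by rewrite NegzE mulrNz mulNr expiN -[(Posz n.+1)%:~R]/(n.+1%:R) expi_nat expi_2pi expr1n conjC1.
Qed.

Lemma continuous_Re_expi (a : R) : continuous (fun x : R => Re (expi (a * x))).
Proof.
move=> x; apply: (@continuous_comp _ _ _ (fun x => a * x) cos); last exact: continuous_cos.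
exact: mulrl_continuous.
Qed.

Lemma continuous_Im_expi (a : R) : continuous (fun x : R => Im (expi (a * x))).
Proof.
move=> x; apply: (@continuous_comp _ _ _ (fun x => a * x) sin); last exact: continuous_sin.
exact: mulrl_continuous.
Qed.

Lemma cmeas_expi (a : R) D : @cmeasurable _ (measurableTypeR R) R D (fun x => expi (a * x)).
Proof.
split; apply: measurable_funTS; apply: continuous_measurable_fun.
  exact: continuous_Re_expi.
exact: continuous_Im_expi.
Qed.

Lemma cmeas_expiN (a : R) D : @cmeasurable _ (measurableTypeR R) R D (fun x => expi (- (a * x))).
Proof.
under eq_fun do rewrite expiN; apply: cmeasJ; exact: cmeas_expi.
Qed.

End expi_theory.

(** * Invariance of integrals under reflection and rotation *)

Section measure_preserving.
Context {R : realType}.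
Notation lmu := (@lebesgue_measure R).
Variable phi : measurableTypeR R -> measurableTypeR R.
Hypothesis mphi : measurable_fun setT phi.
Hypothesis hphi : forall a b : R, a <= b ->
  (lmu (phi @^-1` `]a, b]) = (b - a)%:E)%E.

Let phim := MeasurableFun.Pack (MeasurableFun.Class (isMeasurableFun.Build _ _ _ _ _ mphi)).

(** Lebesgue measure is determined by its values on half-open intervals, where [hphi] gives them. *)
Lemma preserve_measure A : measurable A -> lmu A = pushforward lmu phi A.
Proof.
apply: (@lebesgue_measure_unique R (pushforward lmu phim)) => _ [[a b] _ <-] /=.
rewrite lebesgue_measure_itv /= lte_fin /pushforward.
case: ltP => ab; first by rewrite hphi ?ltW// EFinB.
by rewrite set_itv_ge ?preimage_set0 ?measure0// bnd_simp -leNgt.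
Qed.

Variable D : set (measurableTypeR R).
Hypothesis mD : measurable D.
Let mpD : measurable (phi @^-1` D).
Proof. by rewrite -(setTI (_ @^-1` _)); exact: mphi. Qed.

Lemma preserve_ge0_integral (f : R -> \bar R) : measurable_fun D f -> (forall x, D x -> (0 <= f x)%E) ->
  (\int[lmu]_(x in phi @^-1` D) f (phi x) = \int[lmu]_(x in D) f x)%E.
Proof.
move=> mf f0; rewrite [RHS](@eq_measure_integral _ _ _ _ (pushforward lmu phim)).
  rewrite (ge0_integral_pushforward (phi := phi))//.
  by move=> x; rewrite inE => /f0.
by move=> A mA _; exact: preserve_measure.
Qed.

Lemma preserve_meas (f : R -> R) : measurable_fun D f ->
  measurable_fun (phi @^-1` D) (fun x => f (phi x)).
Proof.
move=> mf; apply: (measurable_comp mD) => //; last exact: measurable_funTS.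
by move=> _ [x Dx <-].
Qed.

Lemma preserve_rint (f : R -> R) : rint lmu D f -> rint lmu (phi @^-1` D) (fun x => f (phi x)).
Proof.
move=> If; have mf := rint_meas If; apply/integrableP; split.
  by apply/measurable_EFinP; exact: preserve_meas.
have /integrableP[_] := If; apply: le_lt_trans.
rewrite -(preserve_ge0_integral (f := fun x => `|(f x)%:E|%E))//.
by apply: measurableT_comp => //; exact/measurable_EFinP.
Qed.

Lemma preserve_RI (f : R -> R) : rint lmu D f ->
  RI lmu (phi @^-1` D) (fun x => f (phi x)) = RI lmu D f.
Proof.
move=> If.
have pm x : f x = Num.max (f x) 0 - Num.max (- f x) 0.
  by case: (leP 0 (f x)) => h; rewrite ?oppr_ge0; [rewrite (max_idPr _) ?subr0// oppr_le0|
    rewrite (max_idPl _) ?sub0r ?opprK// oppr_ge0 ltW].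
have mf := rint_meas If.
have I1 : rint lmu D (fun x => Num.max (f x) 0).
  apply: (rint_le mD _ _ (rint_norm If)).
    by apply: measurable_maxr => //; exact: measurable_cst.
  by move=> x _; rewrite ger0_norm ?le_max ?lexx ?orbT// ge_max ler_norm normr_ge0.
have I2 : rint lmu D (fun x => Num.max (- f x) 0).
  apply: (rint_le mD _ _ (rint_norm If)).
    by apply: measurable_maxr; [exact: measurable_funN|exact: measurable_cst].
  by move=> x _; rewrite ger0_norm ?le_max ?lexx ?orbT// ge_max -normrN ler_norm normr_ge0.
have E (g : R -> R) : rint lmu D g -> (forall x, 0 <= g x) ->
    RI lmu (phi @^-1` D) (fun x => g (phi x)) = RI lmu D g.
  move=> Ig g0; rewrite /RI /Rintegral; congr fine.
  apply: (preserve_ge0_integral (f := fun x => (g x)%:E)).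
    by apply/measurable_EFinP; exact: rint_meas Ig.
  by move=> x _; rewrite lee_fin.
rewrite (_ : f = fun x => Num.max (f x) 0 - Num.max (- f x) 0); last exact/funext.
rewrite [RHS]RI_B// [LHS](RI_B mpD (preserve_rint I1) (preserve_rint I2)).
by rewrite (E _ I1) ?(E _ I2)// => x; rewrite le_max lexx orbT.
Qed.

Lemma preserve_ae (Q : R -> Prop) : {ae lmu, forall x, D x -> Q x} ->
  {ae lmu, forall x, (phi @^-1` D) x -> Q (phi x)}.
Proof.
move=> [N [mN N0 DN]]; exists (phi @^-1` N); split.
- by rewrite -(setTI (_ @^-1` _)); exact: mphi.
- by rewrite -[LHS]/(pushforward lmu phi N) -preserve_measure.
- by move=> x hx; apply: DN.
Qed.

End measure_preserving.

Section circle_invariance.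
Context {R : realType}.
Notation lmu := (@lebesgue_measure R).
Notation arc := (@circle_arc R : set (measurableTypeR R)).
Notation rintA := (rint lmu arc).
Notation RIA := (RI lmu arc).

Lemma marc : measurable arc.
Proof. exact: measurable_itv. Qed.

Lemma lmu_arc : lmu arc = (2 * pi)%:E.
Proof.
rewrite /circle_arc lebesgue_measure_itv /= lte_fin gtrN ?pi_gt0//.
by rewrite -EFinB opprK mulr_natl mulr2n.
Qed.

Lemma arc_lty : (lmu arc < +oo)%E.
Proof. by rewrite lmu_arc ltry. Qed.

Lemma lmu_preimage_opp (a b : R) : a <= b -> (lmu (-%R @^-1` `]a, b]) = (b - a)%:E)%E.
Proof.
move=> ab; rewrite (_ : _ @^-1` _ = `[- b, - a[%classic); last first.
  apply/seteqP; split => x /=; rewrite !in_itv /=.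
    by rewrite ltrNr lerNl andbC.
  by rewrite lerNl ltrNr andbC.
rewrite lebesgue_measure_itv /= lte_fin ltrN2.
move: ab; rewrite le_eqVlt => /orP[/eqP ->|->]; first by rewrite ltxx subrr.
by rewrite -EFinB opprK addrC.
Qed.

Lemma measurable_oppr' : measurable_fun setT (-%R : measurableTypeR R -> measurableTypeR R).
Proof. by apply: continuous_measurable_fun; exact: opp_continuous. Qed.

Lemma preimage_opp_arc : -%R @^-1` arc = arc.
Proof.
apply/seteqP; split => x /=; rewrite /circle_arc /= !in_itv /=.
  by rewrite lerN2 lerNl andbC.
by rewrite lerN2 lerNl andbC.
Qed.

Lemma RI_reflect (f : R -> R) : rintA f -> RIA (fun x => f (- x)) = RIA f.
Proof.
move=> If; rewrite -{1}preimage_opp_arc.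
exact: (preserve_RI measurable_oppr' lmu_preimage_opp marc If).
Qed.

Lemma rint_reflect (f : R -> R) : rintA f -> rintA (fun x => f (- x)).
Proof.
move=> If; rewrite -preimage_opp_arc.
exact: (preserve_rint measurable_oppr' lmu_preimage_opp marc If).
Qed.

Lemma ae_reflect (Q : R -> Prop) : {ae lmu, forall x, arc x -> Q x} ->
  {ae lmu, forall x, arc x -> Q (- x)}.
Proof.
move=> h; have := preserve_ae measurable_oppr' lmu_preimage_opp h.
by rewrite preimage_opp_arc.
Qed.

Lemma meas_reflect (f : R -> R) : measurable_fun arc f -> measurable_fun arc (fun x => f (- x)).
Proof.
move=> mf; rewrite -preimage_opp_arc.
exact: (preserve_meas measurable_oppr' marc mf).
Qed.

Lemma lmu_preimage_shift (t a b : R) : a <= b ->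
  lmu ((fun x : R => x + t) @^-1` `]a, b]) = (b - a)%:E.
Proof.
move=> ab; rewrite (_ : _ @^-1` _ = `]a - t, b - t]%classic); last first.
  by apply/seteqP; split => x /=; rewrite !in_itv /= ltrBlDr lerBrDr.
rewrite lebesgue_measure_itv /= lte_fin ltrD2r.
move: ab; rewrite le_eqVlt => /orP[/eqP ->|->]; first by rewrite ltxx subrr.
by rewrite -EFinB opprB addrA subrK.
Qed.

Lemma measurable_shift (t : R) :
  measurable_fun setT ((fun x => x + t) : measurableTypeR R -> measurableTypeR R).
Proof. by apply: continuous_measurable_fun => x; apply: cvgD => //; exact: cvg_cst. Qed.

Lemma rint_itv_bounded (a b : R) (b0 b1 : bool) (f : R -> R) (M : R) :
  @measurable_fun _ _ (measurableTypeR R) R setT f -> (forall x, `|f x| <= M) ->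
  rint lmu [set` Interval (BSide b0 a) (BSide b1 b)] f.
Proof.
move=> mf fM.
have mi : measurable ([set` Interval (BSide b0 a) (BSide b1 b)] : set (measurableTypeR R)).
  exact: measurable_itv.
apply: (rint_bounded mi (M := M)) => //.
  rewrite [X in (X < _)%E](lebesgue_measure_itv (Interval (BSide b0 a) (BSide b1 b))) /=.
  by case: ifP => // _; rewrite -EFinB ltry.
exact: measurable_funTS.
Qed.

Lemma RI_itv_shift (a b t : R) (f : R -> R) : rint lmu `]a + t, b + t] f ->
  RI lmu `]a, b] (fun x => f (x + t)) = RI lmu `]a + t, b + t] f.
Proof.
move=> If; have mi : measurable (`]a + t, b + t]%classic : set (measurableTypeR R)) by exact: measurable_itv.
rewrite -(preserve_RI (measurable_shift t) (@lmu_preimage_shift t) mi If).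
congr RI; apply/seteqP; split => x /=; rewrite !in_itv /=;
  by rewrite ltrD2r lerD2r.
Qed.

Lemma RI_arc_oc (f : R -> R) : rintA f -> RIA f = RI lmu `]- pi, pi] f.
Proof.
move=> If; rewrite /RI /circle_arc -Rintegral_itv_obnd_cbnd//.
apply: integrableS If => //; first exact: marc.
by move=> x /=; rewrite /circle_arc /= !in_itv /= => /andP[/ltW -> ->].
Qed.

(** Translation turns the arc into the interval from -pi + t to pi + t; by periodicity the part
    beyond pi is moved back by 2 pi. Half-open intervals make the pieces disjoint. *)
Lemma RI_rotate (f : R -> R) (t M : R) : @measurable_fun _ _ (measurableTypeR R) R setT f -> (forall x, `|f x| <= M) ->
  (forall x, f (x + 2 * pi) = f x) -> 0 <= t <= 2 * pi ->
  RIA (fun x => f (x + t)) = RIA f.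
Proof.
move=> mf fM fp /andP[t0 t2]; have pi0 := pi_gt0 R.
have mft : @measurable_fun _ _ (measurableTypeR R) R setT (fun x : R => f (x + t)).
  exact: (measurableT_comp mf (measurable_shift t)).
have ib a b b0 b1 := rint_itv_bounded a b b0 b1 mf fM.
rewrite !RI_arc_oc; last 2 first.
- exact: ib.
- exact: (rint_itv_bounded _ _ _ _ mft (fun x => fM _)).
rewrite RI_itv_shift//.
have U : `]- pi + t, pi + t]%classic = `]- pi + t, pi] `|` `]pi, pi + t] :> set R.
  by rewrite (@itv_bndbnd_setU _ _ _ (BRight pi))// bnd_simp; lra.
have U' : `]- pi, pi]%classic = `]- pi, - pi + t] `|` `]- pi + t, pi] :> set R.
  by rewrite (@itv_bndbnd_setU _ _ _ (BRight (- pi + t)))// bnd_simp; lra.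
rewrite U U' /RI !Rintegral_setU//=.
- rewrite addrC; congr (_ + _).
  have := @RI_itv_shift (- pi) (- pi + t) (2 * pi) f (ib _ _ _ _).
  rewrite (_ : - pi + 2 * pi = pi); last by lra.
  rewrite (_ : - pi + t + 2 * pi = pi + t); last by lra.
  by move=> e; apply: etrans (esym e) _; apply: eq_RI => // x _; rewrite fp.
- by rewrite -U'; exact: ib.
- apply/disj_setPS => x [/=]; rewrite !in_itv /= => /andP[_ h1] /andP[h2 _].
  by have := le_lt_trans h1 h2; rewrite ltxx.
- by rewrite -U; exact: ib.
- apply/disj_setPS => x [/=]; rewrite !in_itv /= => /andP[_ h1] /andP[h2 _].
  by have := le_lt_trans h1 h2; rewrite ltxx.
Qed.

(** For nonzero k, the rotation by pi / |k| leaves the integral unchanged and multiplies the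
    integrand by -1. *)
Lemma CI_expi (k : int) :
  cintegral lmu arc (fun x => expi (k%:~R * x)) = if k == 0 then (2 * pi)%:C%C else 0.
Proof.
have pi0 := pi_gt0 R.
case: eqVneq => [->|k0].
  have -> : (fun x : R => expi (0%:~R * x)) = (fun=> (1%:C)%C).
    by apply/funext => x; rewrite mul0r expi0.
  rewrite (CI_real lmu arc (fun=> 1)) RI_cst//; [|exact: marc|exact: arc_lty].
  by rewrite mul1r; congr (_%:C%C); exact: (congr1 fine lmu_arc).
have mC (a : R) : @measurable_fun _ _ (measurableTypeR R) R setT (fun x : R => Re (expi (a * x))).
  exact: continuous_measurable_fun (@continuous_Re_expi R a).
have mS (a : R) : @measurable_fun _ _ (measurableTypeR R) R setT (fun x : R => Im (expi (a * x))).
  exact: continuous_measurable_fun (@continuous_Im_expi R a).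
have bC (a x : R) : `|Re (expi (a * x))| <= 1 by rewrite -(normc_expi (a * x)) Re_le_normc.
have bS (a x : R) : `|Im (expi (a * x))| <= 1 by rewrite -(normc_expi (a * x)) Im_le_normc.
have rot t : 0 <= t <= 2 * pi ->
    cintegral lmu arc (fun x => expi (k%:~R * (x + t))) = cintegral lmu arc (fun x => expi (k%:~R * x)).
  move=> ht; apply: complex_ext => /=.
    by apply: (RI_rotate (mC k%:~R) (bC k%:~R) _ ht) => x; rewrite expi_intper.
  by apply: (RI_rotate (mS k%:~R) (bS k%:~R) _ ht) => x; rewrite expi_intper.
have IL : inL1 lmu arc (fun x => expi (k%:~R * x)).
  apply: (inL1_le marc (g := fun=> 1)); first exact: cmeas_expi.
    by move=> x _; rewrite normc_expi.
  by apply: (rint_bounded marc arc_lty (M := 1)) => // x _; rewrite normr1.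
have k1 : (1 : R) <= `|k|%:~R.
  by rewrite -[1]/(1%:~R) ler_int -gtz0_ge1 normr_gt0.
have h : (0 : R) <= pi / `|k|%:~R <= (2 * pi : R).
  have k0' : (0 : R) < `|k|%:~R by exact: lt_le_trans k1.
  rewrite divr_ge0 ?(ltW pi0) ?(ltW k0')//= ler_pdivrMr//.
  by move: k1 k0'; move: (`|k|%:~R : R) => K *; nra.
have := rot _ h.
have e : forall x, expi (k%:~R * (x + pi / `|k|%:~R)) = -1 * expi (k%:~R * x) :> R[i].
  move=> x; rewrite mulrDr expiD mulrC; congr (_ * _).
  case: (lerP 0 k) => hk.
    by rewrite ger0_norm// mulrCA divff ?mulr1 ?expi_pi// intr_eq0.
  rewrite ltr0_norm// rmorphN/= invrN mulrCA mulrN divff ?mulrN1 ?intr_eq0//.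
  by apply: complex_ext; rewrite ?ReN ?ImN /= ?cosN ?sinN ?cospi ?sinpi ?oppr0.
under [X in cintegral _ _ X]eq_fun do rewrite e.
rewrite CI_Z//; last exact: marc.
move: (cintegral _ _ _) => z hz; apply: (mulfI (_ : (2 : R[i]) != 0)).
  by rewrite pnatr_eq0.
by rewrite mulr0 mulr_natl mulr2n -{1}hz mulN1r addNr.
Qed.

End circle_invariance.

(** * Polynomials approximating the indicator of an interval *)

Section step_polynomials.
Context {R : realType}.

Lemma bernoulli_ge (y : R) n : 0 <= y <= 1 -> 1 - n%:R * y <= (1 - y) ^+ n.
Proof.
move=> /andP[y0 y1]; elim: n => [|n ih]; first by rewrite mul0r subr0 expr0.
have y1' : 0 <= 1 - y by rewrite subr_ge0.
rewrite exprS; apply: le_trans (ler_wpM2l y1' ih).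
have n0 : 0 <= n%:R * (y * y) by rewrite mulr_ge0// mulr_ge0.
by rewrite -natr1; lra.
Qed.

Lemma bernoulli_le (y : R) n : 0 <= y -> 1 + n%:R * y <= (1 + y) ^+ n.
Proof.
move=> y0; elim: n => [|n ih]; first by rewrite mul0r addr0 expr0.
have y1' : 0 <= 1 + y by rewrite addr_ge0.
rewrite exprS; apply: le_trans (ler_wpM2l y1' ih).
have n0 : 0 <= n%:R * (y * y) by rewrite mulr_ge0// mulr_ge0.
by rewrite -natr1; lra.
Qed.

(* These polynomials converge to the indicator of ]1/2, 1] on [0, 1]; evaluated at
   an affine function of cos (t - a) they approximate indicators of arcs by
   trigonometric polynomials. *)
Definition step n (x : R) : R := 1 - (1 - x ^+ n) ^+ (2 ^ n).

Lemma step_itv n x : 0 <= x <= 1 -> 0 <= step n x <= 1.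
Proof.
move=> /andP[x0 x1]; have h1 : 0 <= x ^+ n <= 1 by rewrite exprn_ge0//= exprn_ile1.
move: h1; rewrite /step; move: (x ^+ n) => y /andP[y0 y1].
have h : 0 <= (1 - y) ^+ (2 ^ n) <= 1.
  by rewrite exprn_ge0 ?subr_ge0//= exprn_ile1 ?subr_ge0// lerBlDr lerDl.
by move: h => /andP[? ?]; apply/andP; split; lra.
Qed.

Lemma step_lt n x : 0 <= x <= 1 -> step n x <= (2 * x) ^+ n.
Proof.
move=> /andP[x0 x1]; have h1 : 0 <= x ^+ n <= 1 by rewrite exprn_ge0//= exprn_ile1.
have := bernoulli_ge (2 ^ n) h1; rewrite natrX -exprMn /step; lra.
Qed.

(** With y = x^n and N = 2^n, (1 - y)^N (1 + y)^N <= 1, and (1 + y)^N >= N y = (2x)^n by Bernoulli's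
    inequality. *)
Lemma step_gt n x : 0 < x <= 1 -> 1 - step n x <= (2 * x) ^- n.
Proof.
move=> /andP[x0 x1]; have h1 : 0 <= x ^+ n <= 1 by rewrite exprn_ge0 ?(ltW x0)//= exprn_ile1// ltW.
rewrite /step opprB addrC subrK.
have xn : 0 < (2 * x) ^+ n by rewrite exprn_gt0// mulr_gt0.
have b := bernoulli_le (2 ^ n) (proj1 (andP h1)); rewrite natrX -exprMn in b.
rewrite -[leRHS]mul1r ler_pdivlMr//.
apply: (@le_trans _ _ ((1 - x ^+ n) ^+ (2 ^ n) * (1 + x ^+ n) ^+ (2 ^ n))).
  rewrite ler_wpM2l//; last by apply: le_trans b; rewrite lerDr.
  by rewrite exprn_ge0// subr_ge0; case/andP: h1.
rewrite -exprMn -subr_sqr expr1n exprn_ile1//.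
  by rewrite subr_ge0 exprn_ile1//; case/andP: h1.
by rewrite lerBlDr lerDl sqr_ge0.
Qed.

Lemma step_cvg0 x : 0 <= x < 2^-1 -> step n x @[n --> \oo] --> (0 : R).
Proof.
move=> /andP[x0 x1]; have x01 : 0 <= x <= 1 by rewrite x0/=; lra.
apply: (@squeeze_cvgr _ _ _ _ (fun=> 0) (fun n => (2 * x) ^+ n)).
- by apply: nearW => n; rewrite step_lt// (andP (step_itv n x01)).1.
- exact: cvg_cst.
- by apply: cvg_expr; rewrite ger0_norm ?mulr_ge0//; lra.
Qed.

Lemma step_cvg1 x : 2^-1 < x <= 1 -> step n x @[n --> \oo] --> (1 : R).
Proof.
move=> /andP[x0 x1]; have x01 : 0 <= x <= 1 by apply/andP; split; lra.
have x02 : 0 < x <= 1 by apply/andP; split; lra.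
have h : (fun n => 1 - (2 * x)^-1 ^+ n) @ \oo --> (1 - 0 : R).
  apply: cvgB; first exact: cvg_cst.
  apply: cvg_expr; rewrite ger0_norm ?invr_ge0 ?invf_lt1; lra.
rewrite subr0 in h.
apply: (@squeeze_cvgr _ _ _ _ (fun n => 1 - (2 * x)^-1 ^+ n) (fun=> 1)) => //.
- apply: nearW => n; rewrite (andP (step_itv n x01)).2 andbT.
  by have := step_gt n x02; rewrite exprVn; lra.
- exact: cvg_cst.
Qed.

End step_polynomials.

(** * Uniqueness of Fourier coefficients *)

Section fourier_uniqueness.
Context {R : realType}.
Notation lmu := (@lebesgue_measure R).
Notation arc := (@circle_arc R : set (measurableTypeR R)).
Notation CI := (cintegral lmu arc).
Notation L1 := (inL1 lmu arc).
Variable g : R -> R[i].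
Hypothesis g1 : L1 g.
Hypothesis g0 : forall k : int, CI (fun x => expi (k%:~R * x) * g x) = 0.

Let cosE (a x : R) : (cos (x - a))%:C%C = 2^-1 * ((expi a)^* * expi x + expi a * expi (- x)).
Proof.
rewrite -!expiN -!expiD (_ : - a + x = x - a); last by rewrite addrC.
rewrite (_ : a - x = - (x - a)); last by rewrite opprB.
rewrite expiN; apply: (mulfI (_ : (2 : R[i]) != 0)); first by rewrite pnatr_eq0.
rewrite mulVKf ?pnatr_eq0//; apply: complex_ext; rewrite ?ReM ?ImM ?ReD ?ImD ?ReJ ?ImJ /=.
  by ring.
by ring.
Qed.

Let mcos (a : R) D : @measurable_fun _ _ (measurableTypeR R) R D (fun x : R => cos (x - a)).
Proof.
apply: measurable_funTS; apply: continuous_measurable_fun => x.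
apply: (@continuous_comp _ _ _ (fun x => x - a) cos); last exact: continuous_cos.
by apply: cvgB => //; exact: cvg_cst.
Qed.

Let mpoly_cos (a : R) (p : {poly R}) D :
  @measurable_fun _ _ (measurableTypeR R) R D (fun x : R => p.[cos (x - a)]).
Proof.
elim/poly_ind: p => [|p c ih].
  by under eq_fun do rewrite horner0; exact: measurable_cst.
under eq_fun do rewrite hornerMXaddC.
by apply: measurable_funD; [apply: measurable_funM|exact: measurable_cst].
Qed.

Lemma horner_bounded (p : {poly R}) : exists M, forall s, `|s| <= 1 -> `|p.[s]| <= M.
Proof.
elim/poly_ind: p => [|p c [M hM]].
  by exists 0 => s _; rewrite horner0 normr0.
exists (M + `|c|) => s hs; rewrite hornerMXaddC (le_trans (ler_normD _ _))// lerD2r normrM.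
by apply: le_trans (hM _ hs); rewrite ler_piMr.
Qed.

Let abs_cos (x : R) : `|cos x| <= 1.
Proof. by rewrite -(normc_expi x); exact: (Re_le_normc (expi x)). Qed.

Let L1p (a : R) (p : {poly R}) (k : int) :
  L1 (fun x => expi (k%:~R * x) * (p.[cos (x - a)])%:C%C * g x).
Proof.
have [M hM] := horner_bounded p.
apply: (inL1_bmul (marc (R := R)) (M := M)) => //.
  by apply: cmeasM; [exact: cmeas_expi|apply: cmeas_real; exact: mpoly_cos].
by move=> x _; rewrite normcM normc_expi mul1r normc_real; exact: hM.
Qed.

(** A factor cos (x - a) shifts the frequency by 1 and -1, so the induction on p has to carry all
    k. *)
Lemma trig_poly_orth (a : R) (p : {poly R}) (k : int) :
  CI (fun x => expi (k%:~R * x) * (p.[cos (x - a)])%:C%C * g x) = 0.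
Proof.
elim/poly_ind: p k => [|p c ih] k.
  transitivity (CI (fun=> 0)); last exact: CI_0.
  by apply: eq_CI => x _; rewrite horner0 mulr0 mul0r.
transitivity (CI (fun x => 2^-1 * (expi a)^* * (expi ((k + 1)%:~R * x) * (p.[cos (x - a)])%:C%C * g x)
   + 2^-1 * expi a * (expi ((k - 1)%:~R * x) * (p.[cos (x - a)])%:C%C * g x)
   + c%:C%C * (expi (k%:~R * x) * g x))).
  apply: eq_CI => x _.
  have e1 : expi ((k + 1)%:~R * x) = expi (k%:~R * x) * expi x.
    by rewrite -expiD intrD mulrDl mul1r.
  have e2 : expi ((k - 1)%:~R * x) = expi (k%:~R * x) * expi (- x).
    by rewrite -expiD intrB mulrBl mul1r.
  have -> : ((p * 'X + c%:P).[cos (x - a)])%:C%C = (p.[cos (x - a)])%:C%C * (cos (x - a))%:C%C + c%:C%C.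
    by rewrite hornerMXaddC rmorphD /= rmorphM.
  by rewrite cosE e1 e2; ring.
have k1 := ih (k + 1); have k2 := ih (k - 1).
have L3 : L1 (fun x => expi (k%:~R * x) * g x).
  have := L1p 0 1 k; under eq_fun do rewrite hornerE mulr1.
  by [].
have La := inL1Z marc (2^-1 * (expi a)^*) (L1p a p (k + 1)).
have Lb := inL1Z marc (2^-1 * expi a) (L1p a p (k - 1)).
rewrite (CI_D marc (inL1D marc La Lb) (inL1Z marc _ L3)) (CI_D marc La Lb).
by rewrite !(CI_Z marc)// k1 k2 g0 !mulr0 !addr0.
Qed.

Let RIg (h : R -> R) : @measurable_fun _ _ (measurableTypeR R) R arc h -> (exists M, forall x, `|h x| <= M) ->
  rint lmu arc (fun x => h x * Re (g x)) /\ rint lmu arc (fun x => h x * Im (g x)).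
Proof.
move=> mh [M hM].
have : L1 (fun x => (h x)%:C%C * g x).
  apply: (inL1_bmul marc (M := M) _ _ g1); first exact: cmeas_real.
  by move=> x _; rewrite normc_real.
move=> hh; have [h1 h2] := proj1 (inL1P _ marc _) hh; split.
  by apply: (eq_rint marc _ h1) => x _; rewrite ReM /= mul0r subr0.
by apply: (eq_rint marc _ h2) => x _; rewrite ImM /= mul0r addr0.
Qed.

Let poly_orth_re (a : R) (p : {poly R}) : RI lmu arc (fun x => p.[cos (x - a)] * Re (g x)) = 0 /\
  RI lmu arc (fun x => p.[cos (x - a)] * Im (g x)) = 0.
Proof.
have := trig_poly_orth a p 0.
rewrite (_ : CI _ = CI (fun x => (p.[cos (x - a)])%:C%C * g x)); last first.
  by apply: eq_CI => x _; rewrite mul0r expi0 mul1r.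
move=> [h1 h2]; split.
  by rewrite -[RHS]h1; apply: eq_RI => x _; rewrite ReM /= mul0r subr0.
by rewrite -[RHS]h2; apply: eq_RI => x _; rewrite ImM /= mul0r addr0.
Qed.

Let step_poly n (c : R) : exists p : {poly R}, forall s, p.[s] = step n ((s + 1) / (2 * (c + 1))).
Proof.
exists (1 - (1 - ((2 * (c + 1))^-1 *: ('X + 1)) ^+ n) ^+ (2 ^ n)) => s.
by rewrite /step !(hornerE, horner_exp) mulrC.
Qed.

(** |x - a| may reach 2 pi - r; the cosine decreases on [0, pi] and is folded back beyond pi. The
    four excluded points are those where |x - a| is r or 2 pi - r, that is, where equality holds. *)
Lemma arc_cos (a r x : R) : - pi <= a - r -> a + r <= pi -> 0 < r <= pi / 2 -> - pi <= x <= pi ->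
  x != a - r -> x != a + r -> x != a - r + 2 * pi -> x != a + r - 2 * pi ->
  if (a - r < x < a + r) then cos r < cos (x - a) else cos (x - a) < cos r.
Proof.
move=> h1 h2 /andP[r0 r1] /andP[x1 x2] n1 n2 n3 n4.
have pi0 := pi_gt0 R.
have E (y : R) : cos y = cos `|y|.
  by case: (leP 0 y) => h; [rewrite ger0_norm|rewrite ltr0_norm// cosN].
rewrite [cos (x - a)]E; set y := `|x - a|.
have y0 : 0 <= y by exact: normr_ge0.
have y2 : y <= 2 * pi - r by rewrite /y ler_norml; apply/andP; split; lra.
have yr : y != r.
  rewrite /y; case: (leP 0 (x - a)) => h'; rewrite ?(ger0_norm h') ?(ltr0_norm h');
    apply/eqP => h; [move/eqP: n2|move/eqP: n1]; apply; lra.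
have y3 : y != 2 * pi - r.
  rewrite /y; case: (leP 0 (x - a)) => h'; rewrite ?(ger0_norm h') ?(ltr0_norm h');
    apply/eqP => h; [move/eqP: n3|move/eqP: n4]; apply; lra.
have rI : r \in `[0, pi] by rewrite in_itv /=; apply/andP; split; lra.
have -> : (a - r < x < a + r) = (y < r).
  by rewrite /y ltr_norml; congr (_ && _); apply/idP/idP => ?; lra.
case: ltP => hy.
  by rewrite ltr_cos// in_itv /=; apply/andP; split; lra.
have ry : r < y by rewrite lt_neqAle eq_sym yr.
case: (lerP y pi) => yp.
  by rewrite ltr_cos// in_itv /= y0.
rewrite (_ : cos y = cos (2 * pi - y)); last first.
  by rewrite (_ : 2 * pi - y = - y + pi *+ 2) ?cosD2pi ?cosN// mulr2n; ring.
have y4 : y < 2 * pi - r by rewrite lt_neqAle y3.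
by rewrite ltr_cos// ?in_itv /=; [lra|apply/andP; split; lra].
Qed.

Let ae_neq (p : R) : {ae lmu, forall x : R, x != p}.
Proof.
exists [set p]; split; [exact: measurable_set1|exact: lebesgue_measure_set1|].
by move=> x /= /negP; rewrite negbK => /eqP.
Qed.

(** The step polynomials of the normalised cos (x - a) are polynomials in cos (x - a) that stay in
    [0, 1] and converge almost everywhere to the indicator of the arc; dominated convergence applies
    with majorant |G|. *)
Let arc_int (G : R -> R) (a r : R) : rint lmu arc G ->
  (forall h : R -> R, @measurable_fun _ _ (measurableTypeR R) R arc h ->
    (exists M, forall x, `|h x| <= M) -> rint lmu arc (fun x => h x * G x)) ->
  (forall p : {poly R}, RI lmu arc (fun x => p.[cos (x - a)] * G x) = 0) ->
  - pi <= a - r -> a + r <= pi -> 0 < r <= pi / 2 ->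
  RI lmu (`]a - r, a + r[ : set (measurableTypeR R)) G = 0.
Proof.
move=> IG hG Gp h1 h2 hr; have /andP[r0 r1] := hr; have pi0 := pi_gt0 R.
pose c := cos r.
(* As c >= 0, (cos + 1) / (2 (c + 1)) stays in [0, 1], and it takes the threshold 1/2 of [step]
   exactly at cos = c. *)
have c0 : 0 <= c by apply: cos_ge0_pihalf; apply/andP; split; lra.
pose S n (x : R) := step n ((cos (x - a) + 1) / (2 * (c + 1))).
have Sp n : exists p : {poly R}, forall x : R, p.[cos (x - a)] = S n x.
  by have [p hp] := step_poly n c; exists p => x; rewrite hp.
have Sx (x : R) : 0 <= (cos (x - a) + 1) / (2 * (c + 1)) <= 1.
  have := abs_cos (x - a); rewrite ler_norml => /andP[? ?].
  have d0 : 0 < 2 * (c + 1) by lra.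
  by rewrite ler_pdivlMr// ler_pdivrMr// mul0r mul1r; apply/andP; split; lra.
have mS n : @measurable_fun _ _ (measurableTypeR R) R arc (S n).
  have [p hp] := Sp n; rewrite (_ : S n = fun x => p.[cos (x - a)]); last by apply/funext => x; rewrite hp.
  exact: mpoly_cos.
have bS n x : `|S n x| <= 1.
  by have /andP[s0 s1] := step_itv n (Sx x); rewrite ger0_norm.
pose J (x : R) : R := if a - r < x < a + r then 1 else 0.
have mJ : @measurable_fun _ _ (measurableTypeR R) R arc J.
  apply: measurable_fun_if => //; first exact: marc.
  have -> : (fun x : R => a - r < x < a + r) = (fun x : R => (a - r < x) && (x < a + r)) by [].
  by apply: measurable_and; apply: measurable_fun_ltr => //; exact: measurable_cst.
have [I1 I2] : rint lmu arc (fun x => J x * G x) /\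
    RI lmu arc (fun x => S n x * G x) @[n --> \oo] --> RI lmu arc (fun x => J x * G x).
  apply: (RI_dct marc (g := fun x => `|G x|)).
  - by move=> n; apply: measurable_funM => //; exact: rint_meas IG.
  - by apply: measurable_funM => //; exact: rint_meas IG.
  - have := ae_and (ae_neq (a - r)) (ae_and (ae_neq (a + r))
      (ae_and (ae_neq (a - r + 2 * pi)) (ae_neq (a + r - 2 * pi)))).
    apply: ae_sub => x [n1 [n2 [n3 n4]]]; rewrite /circle_arc /= in_itv /= => hx.
    apply: cvgMl; have := arc_cos h1 h2 hr hx n1 n2 n3 n4; rewrite /J.
    have /andP[s0 s1] := Sx x.
    case: ifP => _ hc.
      by apply: step_cvg1; rewrite s1 andbT ltr_pdivlMr; [rewrite mulrA mulVf// mul1r ltrD2r|lra].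
    by apply: step_cvg0; rewrite s0/= ltr_pdivrMr; [rewrite mulrA mulVf// mul1r ltrD2r|lra].
  - exact: rint_norm.
  - by move=> n x _; rewrite normrM ler_piMl.
have S0 n : RI lmu arc (fun x => S n x * G x) = 0.
  have [p hp] := Sp n; rewrite -[RHS](Gp p); apply: eq_RI => x _; by rewrite hp.
have J0 : RI lmu arc (fun x => J x * G x) = 0.
  rewrite -(cvg_lim _ I2)//; under eq_fun do rewrite S0; exact: lim_cst.
rewrite -[RHS]J0 /RI.
have sub : (`]a - r, a + r[%classic : set R) `<=` arc.
  by move=> x; rewrite /circle_arc /= !in_itv /= => /andP[? ?]; apply/andP; split; lra.
rewrite -[X in Rintegral _ X _](setIidr sub) Rintegral_mkcondr; apply: eq_Rintegral => x _.
rewrite patchE /J; case: ifPn => hx.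
  by move: hx; rewrite inE /= in_itv /= => ->; rewrite mul1r.
case: ifPn; rewrite ?mul0r// => hx'; move: hx; rewrite notin_setE /= in_itv /=.
by rewrite hx'.
Qed.

Let arc_int' (G : R -> R) (u v : R) : rint lmu arc G ->
  (forall a r : R, - pi <= a - r -> a + r <= pi -> 0 < r <= pi / 2 ->
     RI lmu (`]a - r, a + r[ : set (measurableTypeR R)) G = 0) ->
  - pi <= u -> u < v -> v <= pi -> v - u <= pi ->
  RI lmu (`]u, v] : set (measurableTypeR R)) G = 0.
Proof.
move=> IG h hu uv hv d.
have IS (b0 b1 : bool) : rint lmu ([set` Interval (BSide b0 u) (BSide b1 v)] : set (measurableTypeR R)) G.
  apply: integrableS IG => //; first exact: marc.
  by apply: subset_itvScc; rewrite ?bnd_simp; case: b0 b1 => [] []; rewrite ?bnd_simp.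
have := h ((u + v) / 2) ((v - u) / 2).
rewrite (_ : (u + v) / 2 - (v - u) / 2 = u); last by lra.
rewrite (_ : (u + v) / 2 + (v - u) / 2 = v); last by lra.
move=> <- //; last by apply/andP; split; lra.
by rewrite /RI Rintegral_itv_bndo_bndc//; exact: (IS false true).
Qed.

(** The indefinite integral of G from -pi vanishes identically on the arc, and almost everywhere its
    derivative is G. *)
Let ae_zero (G : R -> R) : rint lmu arc G ->
  (forall a r : R, - pi <= a - r -> a + r <= pi -> 0 < r <= pi / 2 ->
     RI lmu (`]a - r, a + r[ : set (measurableTypeR R)) G = 0) ->
  {ae lmu, forall x : R, arc x -> G x = 0}.
Proof.
move=> IG h; have pi0 := pi_gt0 R.
have piece := arc_int' IG h.
have IS (u v : R) : - pi <= u -> v <= pi -> rint lmu (`]u, v] : set (measurableTypeR R)) G.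
  move=> hu hv; apply: integrableS IG => //; first exact: marc.
  by apply: subset_itvScc; rewrite ?bnd_simp.
have F0 (x : R) : - pi < x -> x <= pi -> RI lmu (`]- pi, x] : set (measurableTypeR R)) G = 0.
  (* [piece] covers lengths up to pi, so longer intervals are cut at 0. *)
  move=> x1 x2; case: (lerP x 0) => x0; first by apply: piece => //; lra.
  have U : `]- pi, x]%classic = `]- pi, 0] `|` `]0, x] :> set R.
    by rewrite (@itv_bndbnd_setU _ _ _ (BRight 0))// bnd_simp; lra.
  rewrite U /RI Rintegral_setU//=.
  - have -> : \int[lmu]_(x in `]- pi, 0%R]) G x = 0 by apply: piece => //; lra.
    by rewrite add0r; apply: piece => //; lra.
  - by rewrite -U; apply: IS => //; lra.
  - apply/disj_setPS => y [/=]; rewrite !in_itv /= => /andP[_ h1] /andP[h2 _].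
    by have := le_lt_trans h1 h2; rewrite ltxx.
pose f := G \_ (`]- pi, pi]%classic : set R).
have If : lmu.-integrable setT (EFin \o f).
  have mi : measurable (`]- pi, pi]%classic : set (measurableTypeR R)) by exact: measurable_itv.
  have := proj1 (@integrable_mkcond _ (measurableTypeR R) R lmu _ (fun x : measurableTypeR R => (G x)%:E) mi) (IS (- pi) pi (lexx _) (lexx _)).
  by rewrite restrict_EFin.
have Fz (x : R) : - pi < x < pi -> \int[lmu]_(t in `]-oo, x]) f t = 0.
  move=> /andP[x1 x2]; rewrite -[RHS](F0 x x1 (ltW x2)) /RI /f -Rintegral_mkcondr.
  congr Rintegral; apply/seteqP; split => y /=; rewrite !in_itv /=.
    by move=> [-> /andP[-> _]].
  by move=> /andP[h1 h2]; rewrite h1 h2 (le_trans h2 (ltW x2)).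
have lf : locally_integrable [set: R] f by apply: open_integrable_locally => //; exact: openT.
have intf (y : R) : lmu.-integrable `]-oo, y] (EFin \o f).
  by apply: integrableS If.
have := FTC1Ny intf lf; move=> /= hF.
have := ae_and hF (ae_and (ae_neq (- pi)) (ae_neq pi)).
apply: ae_sub => x [[_ hx] [n1 n2]]; rewrite /circle_arc /= in_itv /= => /andP[h1 h2].
have x1 : - pi < x by rewrite lt_neqAle eq_sym n1.
have x2 : x < pi by rewrite lt_neqAle n2.
have fx : f x = G x by rewrite /f patchE mem_set//= in_itv /= x1 ltW.
rewrite -fx -hx derive1E (@near_eq_derive _ _ _ _ (cst 0)) ?derive_cst//.
near=> y; apply: Fz; apply/andP; split; near: y.
  exact: lt_nbhsr.
exact: lt_nbhsl.
Unshelve. all: by end_near. Qed.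

Theorem fourier_unique : {ae lmu, forall x : R, arc x -> g x = 0}.
Proof.
have [I1 I2] := proj1 (inL1P _ marc _) g1.
have h1 : {ae lmu, forall x : R, arc x -> Re (g x) = 0}.
  apply: (ae_zero I1) => a r h1 h2 hr; apply: (arc_int I1) => //.
    by move=> h mh bh; exact: (RIg mh bh).1.
  by move=> p; exact: (poly_orth_re a p).1.
have h2 : {ae lmu, forall x : R, arc x -> Im (g x) = 0}.
  apply: (ae_zero I2) => a r h2 h3 hr; apply: (arc_int I2) => //.
    by move=> h mh bh; exact: (RIg mh bh).2.
  by move=> p; exact: (poly_orth_re a p).2.
apply: ae_sub (ae_and h1 h2) => x [e1 e2] ax.
by apply: complex_ext; rewrite ?e1 ?e2.
Qed.

End fourier_uniqueness.

(** * Fourier coefficients of Hardy functions *)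

Section bisection.
Context {R : realType}.

Lemma nested_intervals (a b : nat -> R) :
  (forall n, a n <= a n.+1) -> (forall n, b n.+1 <= b n) -> (forall n, a n <= b n) ->
  exists s, forall n, a n <= s <= b n.
Proof.
move=> ha hb hab.
have am m n : (m <= n)%N -> a m <= a n.
  by move=> /subnK<-; elim: (n - m)%N => // k ih; rewrite addSn (le_trans ih).
have bm m n : (m <= n)%N -> b n <= b m.
  by move=> /subnK<-; elim: (n - m)%N => // k ih; rewrite addSn (le_trans _ ih).
have ab m n : a m <= b n.
  by rewrite (le_trans (am _ _ (leq_maxl m n)))// (le_trans (hab _))// bm// leq_maxr.
have ne : range a !=set0 by exists (a 0%N), 0%N.
exists (sup (range a)) => n; apply/andP; split.
  by apply: ub_le_sup; [exists (b 0%N) => _ [m _ <-]|exists n].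
by apply: ge_sup => // _ [m _ <-].
Qed.

(** Goursat's bisection, detached from integrals: a subadditive function of rectangles that is of
    smaller order than the squared size at every point cannot be positive, since some quarter always
    keeps a quarter of its value and the quarters shrink to a point. *)
Lemma bisection_le0 (N : R -> R -> R -> R -> R) (a0 b0 c0 d0 : R) :
  a0 <= b0 -> c0 <= d0 ->
  (forall a m b c d, a0 <= a -> a <= m -> m <= b -> b <= b0 -> c0 <= c -> c <= d -> d <= d0 ->
     N a b c d <= N a m c d + N m b c d) ->
  (forall a b c m d, a0 <= a -> a <= b -> b <= b0 -> c0 <= c -> c <= m -> m <= d -> d <= d0 ->
     N a b c d <= N a b c m + N a b m d) ->
  (forall s t, a0 <= s <= b0 -> c0 <= t <= d0 -> forall e, 0 < e ->
     exists2 r, 0 < r & forall a b c d, a0 <= a -> b <= b0 -> c0 <= c -> d <= d0 ->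
       a <= s <= b -> c <= t <= d -> b - a <= r -> d - c <= r ->
       N a b c d <= e * ((b - a) + (d - c)) ^+ 2) ->
  N a0 b0 c0 d0 <= 0.
Proof.
move=> ab0 cd0 Ns Nt Nloc; rewrite leNgt; apply/negP => N0.
pose n4 (Q : (R * R) * (R * R)) := N Q.1.1 Q.1.2 Q.2.1 Q.2.2.
pose ms (Q : (R * R) * (R * R)) := (Q.1.1 + Q.1.2) / 2.
pose mt (Q : (R * R) * (R * R)) := (Q.2.1 + Q.2.2) / 2.
(* Halve in the first coordinate, then in the second, each time keeping the half with the larger N:
   the value loses at most a factor 4 while both sides are halved. *)
pose hs Q := let Q1 := ((Q.1.1, ms Q), Q.2) in let Q2 := ((ms Q, Q.1.2), Q.2) in
  if n4 Q2 <= n4 Q1 then Q1 else Q2.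
pose ht Q := let Q1 := (Q.1, (Q.2.1, mt Q)) in let Q2 := (Q.1, (mt Q, Q.2.2)) in
  if n4 Q2 <= n4 Q1 then Q1 else Q2.
pose Q n := iter n (fun Q => ht (hs Q)) ((a0, b0), (c0, d0)).
pose ok (Q : (R * R) * (R * R)) := [/\ a0 <= Q.1.1, Q.1.1 <= Q.1.2, Q.1.2 <= b0 &
   [/\ c0 <= Q.2.1, Q.2.1 <= Q.2.2 & Q.2.2 <= d0]].
have hsP (P : (R * R) * (R * R)) : ok P -> [/\ ok (hs P), n4 P <= 2 * n4 (hs P),
    (hs P).1.2 - (hs P).1.1 = (P.1.2 - P.1.1) / 2, (hs P).2 = P.2 &
    P.1.1 <= (hs P).1.1 /\ (hs P).1.2 <= P.1.2].
  move: P => [[a b] [c d]] [/= h1 h2 h3 [h4 h5 h6]].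
  have := @Ns a (ms ((a, b), (c, d))) b c d h1.
  rewrite /hs /n4 /= /ms /=; set m := (a + b) / 2 => h.
  have am : a <= m by rewrite /m; lra.
  have mb : m <= b by rewrite /m; lra.
  have {}h := h am mb h3 h4 h5 h6.
  case: ifP => hN; split => //=; rewrite /ok /=.
  - by split => //; rewrite (le_trans mb).
  - lra.
  - rewrite /m; lra.
  - by split => //; rewrite (le_trans h1).
  - move/negbT: hN; rewrite -ltNge; lra.
  - rewrite /m; lra.
have htP (P : (R * R) * (R * R)) : ok P -> [/\ ok (ht P), n4 P <= 2 * n4 (ht P),
    (ht P).2.2 - (ht P).2.1 = (P.2.2 - P.2.1) / 2, (ht P).1 = P.1 &
    P.2.1 <= (ht P).2.1 /\ (ht P).2.2 <= P.2.2].
  move: P => [[a b] [c d]] [/= h1 h2 h3 [h4 h5 h6]].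
  have := @Nt a b c (mt ((a, b), (c, d))) d h1 h2 h3 h4.
  rewrite /ht /n4 /= /mt /=; set m := (c + d) / 2 => h.
  have am : c <= m by rewrite /m; lra.
  have mb : m <= d by rewrite /m; lra.
  have {}h := h am mb h6.
  case: ifP => hN; split => //=; rewrite /ok /=.
  - by split => //; split => //; rewrite (le_trans mb).
  - lra.
  - rewrite /m; lra.
  - by split => //; split => //; rewrite (le_trans h4).
  - move/negbT: hN; rewrite -ltNge; lra.
  - rewrite /m; lra.
have Qok n : ok (Q n).
  elim: n => [|n ih]; first by split.
  by rewrite /Q iterS; have [/htP[]] := hsP _ ih.
pose z n : R := 2 ^- n.
have z0 n : 0 < z n by rewrite /z invr_gt0 exprn_gt0.
have zS n : z n.+1 = z n / 2 by rewrite /z exprS invfM mulrC.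
have Qdim n : [/\ (Q n).1.2 - (Q n).1.1 = (b0 - a0) * z n,
    (Q n).2.2 - (Q n).2.1 = (d0 - c0) * z n & N a0 b0 c0 d0 * z n ^+ 2 <= n4 (Q n)].
  elim: n => [|n [i1 i2 i3]]; first by rewrite /z expr0 invr1 expr1n !mulr1.
  rewrite /Q iterS -/(Q n).
  have [k1 k2 k3 k4 _] := hsP _ (Qok n); have [l1 l2 l3 l4 _] := htP _ k1.
  rewrite l4 l3 k3 k4 i1 i2 zS; split; try ring.
  rewrite (_ : (z n / 2) ^+ 2 = z n ^+ 2 / 4); last by field.
  rewrite mulrA; move: (N _ _ _ _ * _) i3 => u i3; lra.
have [s hs'] : exists s, forall n, (Q n).1.1 <= s <= (Q n).1.2.
  apply: nested_intervals => n; rewrite /Q ?iterS -/(Q n).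
  - have [k1 _ _ _ [k5 _]] := hsP _ (Qok n); have [l1 _ _ -> _] := htP _ k1; exact: k5.
  - have [k1 _ _ _ [_ k5]] := hsP _ (Qok n); have [l1 _ _ -> _] := htP _ k1; exact: k5.
  - by have [] := Qok n.
have [t ht'] : exists t, forall n, (Q n).2.1 <= t <= (Q n).2.2.
  apply: nested_intervals => n; rewrite /Q ?iterS -/(Q n).
  - have [k1 _ _ <- _] := hsP _ (Qok n); have [l1 _ _ _ [l5 _]] := htP _ k1; exact: l5.
  - have [k1 _ _ <- _] := hsP _ (Qok n); have [l1 _ _ _ [_ l5]] := htP _ k1; exact: l5.
  - by have [_ _ _ []] := Qok n.
pose X := ((b0 - a0) + (d0 - c0)) ^+ 2.
have X0 : 0 <= X by exact: sqr_ge0.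
(* X is the squared size of the initial rectangle; with + 1 the choice makes sense for a degenerate
   rectangle and the final inequality N <= N X / (X + 1) is contradictory. *)
have e0 : 0 < N a0 b0 c0 d0 / (X + 1) by rewrite divr_gt0//; lra.
have [r r0 hr] := Nloc s t (hs' 0%N) (ht' 0%N) _ e0.
pose L := (b0 - a0) + (d0 - c0).
have L0 : 0 <= L by rewrite /L; lra.
have [n hn] : exists n, L * z n <= r.
  have : (L * (2^-1 : R) ^+ n) @[n --> \oo] --> L * 0.
    by apply: cvgMr; apply: cvg_expr; rewrite ger0_norm ?invf_lt1 ?ltr1n.
  rewrite mulr0 => /cvgrPdist_le/(_ _ r0)[n _ /(_ n (leqnn n))].
  rewrite sub0r normrN ger0_norm; last by rewrite mulr_ge0// exprn_ge0// invr_ge0.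
  by rewrite exprVn => h; exists n.
have [q1 q2 q3] := Qdim n; have [w1 w2 w3 [w4 w5 w6]] := Qok n.
have := hr _ _ _ _ w1 w3 w4 w6 (hs' n) (ht' n).
rewrite q1 q2 -mulrDl exprMn -/X.
have zn := ltW (z0 n).
have g1 : (b0 - a0) * z n <= r by rewrite (le_trans _ hn)// ler_wpM2r// /L; lra.
have g2 : (d0 - c0) * z n <= r by rewrite (le_trans _ hn)// ler_wpM2r// /L; lra.
move=> /(_ g1 g2) h; have {h} := le_trans q3 h.
rewrite [leRHS]mulrA ler_pM2r ?exprn_gt0// mulrAC ler_pdivlMr; last lra.
rewrite ler_pM2l//; lra.
Qed.

End bisection.

(** * Cauchy's theorem for rectangles *)

Section goursat.
Context {R : realType}.
Notation lmu := (@lebesgue_measure R).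
Notation io a b := (`]a, b]%classic : set (measurableTypeR R)).
Notation ci a b g := (cintegral lmu (io a b) g).
Implicit Types (g : R -> R[i]).

Let mio (a b : R) : measurable (io a b).
Proof. exact: measurable_itv. Qed.

Definition ctsat g (x : R) := forall e : R, 0 < e -> exists2 d, 0 < d &
  forall y, `|y| <= d -> normc (g (x + y) - g x) <= e.

Lemma ctsat_inL1 g (a b : R) : (forall x, a <= x <= b -> ctsat g x) -> inL1 lmu (io a b) g.
Proof.
move=> cg; apply/(inL1P _ (mio a b)).
have sub : io a b `<=` `[a, b] by apply: subset_itvr; rewrite bnd_simp.
have mc : measurable (`[a, b] : set (measurableTypeR R)) by exact: measurable_itv.
have cont (k : R[i] -> R) : (forall u v, `|k u - k v| <= normc (u - v)) ->
    rint lmu (io a b) (fun x => k (g x)).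
  move=> hk; apply: (integrableS mc (mio a b) sub).
  apply: continuous_compact_integrable; first exact: segment_compact.
  apply: continuous_in_subspaceT => x; rewrite inE /= in_itv /= => hx.
  apply/cvgrPdist_le => e e0; have [d d0 hd] := cg x hx e e0.
  near=> y; rewrite distrC (le_trans (hk _ _))//.
  rewrite -[in X in normc X](subrKC x y); apply: hd.
  near: y; apply/nbhs_ballP; exists d => //= y; rewrite /ball /= distrC => /ltW; exact.
split; apply: cont => u v; first by rewrite -ReB Re_le_normc.
by rewrite -ImB Im_le_normc.
Unshelve. all: by end_near. Qed.

Lemma ci_add g (a m b : R) : a <= m -> m <= b -> inL1 lmu (io a b) g ->
  ci a b g = ci a m g + ci m b g.
Proof.
move=> am mb /(inL1P _ (mio a b))[g1 g2].
have U : `]a, b]%classic = `]a, m] `|` `]m, b] :> set R.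
  by rewrite (@itv_bndbnd_setU _ _ _ (BRight m))// bnd_simp.
have dj : [disjoint `]a, m]%classic & (`]m, b]%classic : set R)].
  apply/disj_setPS => y [/=]; rewrite !in_itv /= => /andP[_ h1] /andP[h2 _].
  by have := le_lt_trans h1 h2; rewrite ltxx.
by apply: complex_ext; rewrite ?ReD ?ImD /=; rewrite U Rintegral_setU// -?U.
Qed.

Lemma ci_sub g (a b a' b' : R) : a <= a' -> b' <= b -> inL1 lmu (io a b) g -> inL1 lmu (io a' b') g.
Proof.
move=> ha hb [[m1 m2] Ig].
have sub : io a' b' `<=` io a b.
  by apply: subset_itv; rewrite bnd_simp.
split; last by apply: integrableS sub Ig => //; exact: mio.
by split; [apply: measurable_funS m1|apply: measurable_funS m2] => //; exact: mio.
Qed.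

Lemma ci_cst (c : R[i]) (a b : R) : a <= b -> ci a b (fun=> c) = c * (b - a)%:C%C.
Proof.
move=> ab.
have e (r : R) : \int[lmu]_(x in io a b) r = r * (b - a).
  rewrite Rintegral_cst//=; first by rewrite lebesgue_measure_itv /= lte_fin; case: ltP => //= h; congr (_ * _); lra.
by apply: complex_ext; rewrite ?ReM ?ImM /= !e; ring.
Qed.

Lemma ci_bound g (a b M : R) : a <= b -> inL1 lmu (io a b) g ->
  (forall x, a <= x <= b -> normc (g x) <= M) -> normc (ci a b g) <= M * (b - a).
Proof.
move=> ab Ig gM; rewrite (le_trans (normc_CI (mio a b) Ig))//.
have -> : M * (b - a) = RI lmu (io a b) (fun=> M).
  rewrite /RI Rintegral_cst//=; first by rewrite lebesgue_measure_itv /= lte_fin; case: ltP => //= h; congr (_ * _); lra.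
have lt : (lmu (io a b) < +oo)%E by rewrite lebesgue_measure_itv /=; case: ifP => //; rewrite -EFinB ltry.
apply: (RI_le (mio a b)).
- exact: inL1_rint Ig.
- by apply: (rint_bounded _ lt (M := `|M|)) => //; exact: measurable_cst.
- by move=> x /=; rewrite in_itv /= => /andP[h1 h2]; apply: gM; rewrite (ltW h1).
Qed.

(** Total differentiability in two real variables with multiplication by A as differential; this
    form of the differential contains the Cauchy-Riemann equations. *)
Definition cdiff (G : R -> R -> R[i]) (s t : R) (A : R[i]) := forall e : R, 0 < e ->
  exists2 d, 0 < d & forall x y, `|x| <= d -> `|y| <= d ->
    normc (G (s + x) (t + y) - G s t - A * (x +i* y)%C) <= e * (`|x| + `|y|).

Lemma cdiff_cts G s t A : cdiff G s t A -> forall e : R, 0 < e -> exists2 d, 0 < d &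
  forall x y, `|x| <= d -> `|y| <= d -> normc (G (s + x) (t + y) - G s t) <= e.
Proof.
move=> dG e e0; have [d d0 hd] := dG 1 ltr01.
have A0 := normc_ge0 A.
have D0 : 0 < e / (2 * (1 + normc A)) by rewrite divr_gt0//; lra.
exists (Num.min d (e / (2 * (1 + normc A)))); first by rewrite lt_min d0.
move=> x y; rewrite !le_min => /andP[x1 x2] /andP[y1 y2].
rewrite -[X in normc X](subrK (A * (x +i* y)%C)) (le_trans (le_normcD _ _))//.
rewrite normcM (le_trans (lerD (hd _ _ x1 y1) (ler_wpM2l A0 (normc_le (x +i* y)%C))))//=.
rewrite -mulrDl; have := lerD x2 y2.
rewrite (_ : e / _ + e / _ = e / (1 + normc A)); last by field; apply: lt0r_neq0; lra.
by rewrite ler_pdivlMr; [rewrite mulrC|lra].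
Qed.

Lemma cdiff_ctsat1 G s t A : cdiff G s t A -> ctsat (fun x => G x t) s.
Proof.
move=> dG e e0; have [d d0 hd] := cdiff_cts dG e0; exists d => // x x1.
by have := hd x 0 x1; rewrite normr0 addr0; apply; exact: ltW.
Qed.

Lemma cdiff_ctsat2 G s t A : cdiff G s t A -> ctsat (G s) t.
Proof.
move=> dG e e0; have [d d0 hd] := cdiff_cts dG e0; exists d => // x x1.
by have := hd 0 x; rewrite normr0 addr0; apply=> //; exact: ltW.
Qed.

(** The counterclockwise boundary integral of G (ds + i dt). *)
Let rect (G : R -> R -> R[i]) (a b c d : R) : R[i] :=
  ci a b (fun s => G s c - G s d) + (0 +i* 1)%C * ci c d (fun t => G b t - G a t).

(** An affine function B + A (z - z0) has boundary integral 0. Its increments between opposite sides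
    are the constants [z1] and [z2]; once they are subtracted, only the error e remains on each
    side. *)
Let rect_approx (G : R -> R -> R[i]) (A B : R[i]) (s0 t0 e a b c d : R) : a <= b -> c <= d ->
  inL1 lmu (io a b) (fun s => G s c - G s d) -> inL1 lmu (io c d) (fun t => G b t - G a t) ->
  (forall s t, a <= s <= b -> c <= t <= d ->
     normc (G s t - B - A * ((s - s0) +i* (t - t0))%C) <= e) ->
  normc (rect G a b c d) <= (e + e) * ((b - a) + (d - c)).
Proof.
move=> ab cd I1 I2 h.
have la (x y : R) (z : R[i]) : inL1 lmu (io x y) (fun=> z).
  have [xy|xy] := lerP x y.
    by apply: ctsat_inL1 => u _ e0 e00; exists 1 => // v _; rewrite subrr normc0 ltW.
  by rewrite set_itv_ge ?bnd_simp -?leNgt 1?ltW//; split; [exact: cmeas_cst|exact: integrable_set0].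
pose z1 := A * (0 +i* (c - d))%C; pose z2 := A * ((b - a) +i* 0)%C.
have -> : rect G a b c d = ci a b (fun s => G s c - G s d - z1) +
    (0 +i* 1)%C * ci c d (fun t => G b t - G a t - z2).
  rewrite (CI_B (mio a b) I1 (la _ _ _)) (CI_B (mio c d) I2 (la _ _ _)) !ci_cst// /rect.
  set u := ci a b _; set v := ci c d _; rewrite /z1 /z2; case: (A) => A1 A2.
  by apply: complex_ext; rewrite ?(ReD, ImD, ReB, ImB, ReM, ImM) /=; ring.
rewrite (le_trans (le_normcD _ _))// mulrDr lerD//.
  apply: ci_bound => //; first by apply: inL1B => //; exact: mio.
  move=> s hs; have h1 := h s c hs; have h2 := h s d hs.
  rewrite (_ : _ - z1 = (G s c - B - A * ((s - s0) +i* (c - t0))%C) -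
      (G s d - B - A * ((s - s0) +i* (d - t0))%C)); last first.
    rewrite /z1; case: (A) => A1 A2; move: (G s c) (G s d) (B) => [? ?] [? ?] [? ?].
    by apply: complex_ext; rewrite ?(ReD, ImD, ReB, ImB, ReM, ImM) /=; ring.
  by rewrite (le_trans (le_normcD _ _))// normcN lerD// ?h1 ?h2// lexx ?cd.
rewrite normcM (_ : normc (0 +i* 1)%C = 1); last by rewrite /= expr0n expr1n add0r sqrtr1.
rewrite mul1r; apply: ci_bound => //; first by apply: inL1B => //; exact: mio.
move=> t ht; have h1 := h b t; have h2 := h a t.
rewrite (_ : _ - z2 = (G b t - B - A * ((b - s0) +i* (t - t0))%C) -
    (G a t - B - A * ((a - s0) +i* (t - t0))%C)); last first.
  rewrite /z2; case: (A) => A1 A2; move: (G b t) (G a t) (B) => [? ?] [? ?] [? ?].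
  by apply: complex_ext; rewrite ?(ReD, ImD, ReB, ImB, ReM, ImM) /=; ring.
by rewrite (le_trans (le_normcD _ _))// normcN lerD// ?h1 ?h2// lexx ?ab.
Qed.

(* Here G (s, t) is F (s + i t), and [cdiff] says that F has complex derivative A. *)
Theorem goursat (G : R -> R -> R[i]) (a0 b0 c0 d0 : R) : a0 <= b0 -> c0 <= d0 ->
  (forall s t, a0 <= s <= b0 -> c0 <= t <= d0 -> exists A, cdiff G s t A) ->
  ci a0 b0 (fun s => G s c0 - G s d0) + (0 +i* 1)%C * ci c0 d0 (fun t => G b0 t - G a0 t) = 0.
Proof.
move=> ab0 cd0 dG; apply: normc_eq0; apply/eqP; rewrite eq_le normc_ge0 andbT.
have L1 t : c0 <= t <= d0 -> inL1 lmu (io a0 b0) (fun s => G s t).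
  by move=> ht; apply: ctsat_inL1 => s hs; have [A] := dG s t hs ht; exact: cdiff_ctsat1.
have L2 s : a0 <= s <= b0 -> inL1 lmu (io c0 d0) (fun t => G s t).
  by move=> hs; apply: ctsat_inL1 => t ht; have [A] := dG s t hs ht; exact: cdiff_ctsat2.
have I1 a b c d : a0 <= a -> b <= b0 -> c0 <= c -> c <= d -> d <= d0 ->
    inL1 lmu (io a b) (fun s => G s c - G s d).
  move=> *; apply: inL1B; first exact: mio.
    by apply: (ci_sub (a := a0) (b := b0)) => //; apply: L1; apply/andP; split=> //; lra.
  by apply: (ci_sub (a := a0) (b := b0)) => //; apply: L1; apply/andP; split=> //; lra.
have I2 a b c d : a0 <= a -> a <= b -> b <= b0 -> c0 <= c -> d <= d0 ->
    inL1 lmu (io c d) (fun t => G b t - G a t).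
  move=> *; apply: inL1B; first exact: mio.
    by apply: (ci_sub (a := c0) (b := d0)) => //; apply: L2; apply/andP; split=> //; lra.
  by apply: (ci_sub (a := c0) (b := d0)) => //; apply: L2; apply/andP; split=> //; lra.
rewrite -/(rect G a0 b0 c0 d0).
apply: (bisection_le0 (N := fun a b c d => normc (rect G a b c d))) => //.
- move=> a m b c d *; rewrite (_ : rect G a b c d = rect G a m c d + rect G m b c d) ?le_normcD//.
  rewrite /rect (@ci_add _ a m b)//; last by apply: I1.
  rewrite [X in _ + _ * X](_ : _ = ci c d (fun t => G m t - G a t) + ci c d (fun t => G b t - G m t)).
    by ring.
  rewrite -CI_D; [|exact: mio|apply: I2 => //; lra|apply: I2 => //; lra].
  by apply: eq_CI => t _; ring.
- move=> a b c m d *; rewrite (_ : rect G a b c d = rect G a b c m + rect G a b m d) ?le_normcD//.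
  rewrite /rect (@ci_add _ c m d)//; last by apply: I2.
  rewrite [X in X + _](_ : _ = ci a b (fun s => G s c - G s m) + ci a b (fun s => G s m - G s d)).
    by ring.
  rewrite -CI_D; [|exact: mio|apply: I1 => //; lra|apply: I1 => //; lra].
  by apply: eq_CI => t _; ring.
move=> s t hs ht e e0; have [A hA] := dG s t hs ht.
have e20 : 0 < e / 2 by lra.
have [r r0 hr] := hA _ e20; exists r => // a b c d w1 w2 w3 w4 /andP[s1 s2] /andP[t1 t2] ra rc.
rewrite (_ : e * _ = (e / 2 * ((b - a) + (d - c)) + e / 2 * ((b - a) + (d - c))) *
  ((b - a) + (d - c))); last by field.
have ab := le_trans s1 s2; have cd := le_trans t1 t2.
apply: (@rect_approx G A (G s t) s t) => //; [exact: I1|exact: I2|].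
move=> x y /andP[x1 x2] /andP[y1 y2].
have X1 : `|x - s| <= b - a by rewrite ler_norml; apply/andP; split; lra.
have Y1 : `|y - t| <= d - c by rewrite ler_norml; apply/andP; split; lra.
have := hr (x - s) (y - t) (le_trans X1 ra) (le_trans Y1 rc); rewrite !subrKC => h.
by rewrite (le_trans h)// ler_wpM2l ?(ltW e20)// lerD.
Qed.

End goursat.

(** * Logarithmic polar coordinates *)

Section polar.
Context {R : realType}.

Lemma derivable_eps (K : numFieldType) (f : K^o -> K^o) (x : K^o) : derivable f x 1 ->
  forall e : K, 0 < e -> exists2 d : K, 0 < d &
    forall h : K, `|h| < d -> `|f (x + h) - f x - 'D_1 f x * h| <= e * `|h|.
Proof.
move=> hA e e0.
move/cvgrPdist_le : hA => /(_ e e0)[d /= d0 hd]; exists d => // h hh.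
have [->|h0] := eqVneq h 0; first by rewrite addr0 mulr0 subrr subr0 !normr0 mulr0.
have := hd h; rewrite /= sub0r normrN => /(_ hh h0).
rewrite -(ler_pM2r (x := `|h|)) ?normr_gt0// -normrM; apply: le_trans.
rewrite distrC mulrBl [_ *: 1]mulr1 [h + x]addrC /GRing.scale /= mulrAC mulVf// mul1r.
by rewrite le_eqVlt eqxx.
Qed.

Lemma cderivable_eps (f : R[i] -> R[i]) (z : R[i]^o) :
  derivable (f : R[i]^o -> R[i]^o) z 1 ->
  exists A : R[i], forall e : R, 0 < e -> exists2 d : R, 0 < d &
    forall u, normc u <= d -> normc (f (z + u) - f z - A * u) <= e * normc u.
Proof.
move=> /derivable_eps hA; exists ('D_1 (f : R[i]^o -> R[i]^o) z) => e e0.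
have e0' : 0 < (e%:C)%C by rewrite ltcR.
have [d d0 hd] := hA _ e0'.
move: d d0 hd => [d d'] /=; rewrite ltcE /= => /andP[/eqP-> d0] hd.
exists (d / 2); first by rewrite divr_gt0.
move=> u hu; have lt : normc u < d by lra.
by have := hd u; rewrite normcE ltcR => /(_ lt); rewrite normcE -rmorphM lecR.
Qed.

Lemma rderivable_eps (f : R -> R) (x l : R) : is_derive (x : R^o) 1 (f : R^o -> R^o) l ->
  forall e : R, 0 < e -> exists2 d : R, 0 < d &
    forall h : R, `|h| <= d -> `|f (x + h) - f x - l * h| <= e * `|h|.
Proof.
move=> [df dl] e e0; have [d d0 hd] := derivable_eps df e0.
exists (d / 2); first by rewrite divr_gt0.
move=> h hh; rewrite -dl; apply: hd; lra.
Qed.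

(** This is exp (s + i t): the punctured disk becomes the half-plane s < 0 and circles about 0
    become vertical segments, so that the theorem for rectangles applies to annuli. *)
Definition epolar (s t : R) : R[i] := (expR s)%:C%C * expi t.

Lemma normc_epolar s t : normc (epolar s t) = expR s.
Proof. by rewrite normcM normc_real normc_expi mulr1 gtr0_norm ?expR_gt0. Qed.

Lemma epolarD s t x y : epolar (s + x) (t + y) = epolar s t * epolar x y.
Proof. by rewrite /epolar expRD expiD rmorphM /=; ring. Qed.

Lemma epolar_cdiff0 : cdiff epolar 0 0 1.
Proof.
move=> e e0; pose e1 := Num.min (e / 8) 1.
have e10 : 0 < e1 by rewrite lt_min ltr01 divr_gt0.
have e1e : e1 <= e / 8 by rewrite ge_min lexx.
have e11 : e1 <= 1 by rewrite ge_min lexx orbT.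
have [d1 d10 h1] := rderivable_eps (is_derive_expR (0 : R)) e10.
have [d2 d20 h2] := rderivable_eps (is_derive_cos (0 : R)) e10.
have [d3 d30 h3] := rderivable_eps (is_derive_sin (0 : R)) e10.
exists (Num.min e1 (Num.min d1 (Num.min d2 d3))); first by rewrite lt_min e10 /= lt_min d10 /= lt_min d20.
move=> x y; rewrite !le_min => /and4P[/andP[x00 x0] x1 _ _] /and4P[_ _ y2 y3].
move/h1 : x1; move/h2: y2; move/h3: y3.
rewrite !add0r expR0 cos0 sin0 oppr0 !mul0r !mul1r !(subr0, addr0) => hs hc hx.
rewrite /epolar expR0 expi0 mulr1.
pose a := expR x - 1 - x; pose b := cos y - 1; pose c := sin y - y.
(* The remainders a, b, c of exp, cos and sin are of smaller order; the cross term i x y is small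
   because |x| <= e / 8, and |1 + x| <= 2 because |x| <= 1. *)
have -> : (expR x)%:C%C * expi y - 1%:C%C - (x +i* y)%C =
   (a%:C)%C * expi y + ((1 + x)%:C)%C * (b +i* c)%C + (0 +i* (x * y))%C.
  apply: complex_ext; rewrite ?(ReD, ImD, ReB, ImB, ReM, ImM) /= /a /b /c; ring.
have bc : normc (b +i* c)%C <= e1 * `|y| + e1 * `|y|.
  by rewrite (le_trans (normc_le _))//= lerD.
rewrite (le_trans (le_normcD _ _))// (le_trans (lerD (le_normcD _ _) (lexx _)))//.
rewrite !normcM !normc_real normc_expi mulr1.
have n1 : normc (0 +i* (x * y))%C <= e / 8 * `|y|.
  by rewrite (le_trans (normc_le _))//= normr0 add0r normrM ler_wpM2r.
have n2 : `|1 + x| * normc (b +i* c)%C <= (e1 * `|y| + e1 * `|y|) * 2.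
  rewrite [leRHS]mulrC ler_pM ?normc_ge0// (le_trans (ler_normD _ _))// normr1.
  by rewrite lerD2l.
have n3 : `|a| <= e1 * `|x| by [].
have m1 : e1 * `|x| <= e / 8 * `|x| by rewrite ler_wpM2r.
have m2 : e1 * `|y| <= e / 8 * `|y| by rewrite ler_wpM2r.
have key (u1 u2 u3 u4 u5 u6 u7 : R) : u1 <= e / 8 * u7 -> u2 <= (u5 + u5) * 2 -> u3 <= u4 ->
    u4 <= e / 8 * u6 -> u5 <= e / 8 * u7 -> 0 <= u6 -> 0 <= u7 -> u3 + u2 + u1 <= e * (u6 + u7).
  move=> k1 k2 k3 k4 k5 k6 k7; have := mulr_ge0 (ltW e0) k6; have := mulr_ge0 (ltW e0) k7.
  by move=> ? ?; nra.
exact: key n1 n2 n3 m1 m2 _ _.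
Qed.

Lemma epolar_cdiff s t : cdiff epolar s t (epolar s t).
Proof.
move=> e e0; have N0 : 0 < normc (epolar s t) by rewrite normc_epolar expR_gt0.
have e1 : 0 < e / normc (epolar s t) by rewrite divr_gt0.
have [d d0 hd] := epolar_cdiff0 e1; exists d => // x y hx hy.
rewrite epolarD (_ : _ - _ - _ = epolar s t * (epolar (0 + x) (0 + y) - epolar 0 0 - 1 * (x +i* y)%C)).
  by rewrite normcM (le_trans (ler_wpM2l (ltW N0) (hd _ _ hx hy)))// mulrA mulrCA mulfV ?mulr1 ?lt0r_neq0.
by rewrite !add0r /(epolar 0 0) expR0 expi0 mul1r; ring.
Qed.

Lemma cdiff_comp (f : R[i] -> R[i]) s t :
  derivable (f : R[i]^o -> R[i]^o) (epolar s t) 1 ->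
  exists A, cdiff (fun x y => f (epolar x y)) s t A.
Proof.
move=> /cderivable_eps[A hA]; pose E := epolar s t; exists (A * E) => e e0.
have nA := normc_ge0 A; have nE := normc_ge0 E.
pose e1 := e / (2 * (normc A + 1)); pose e2 := e / (2 * (normc E + 1)).
have e10 : 0 < e1 by rewrite divr_gt0//; lra.
have e20 : 0 < e2 by rewrite divr_gt0//; lra.
have [d1 d10 h1] := hA e2 e20.
have [d2 d20 h2] := @epolar_cdiff s t _ e10.
have [d3 d30 h3] := @epolar_cdiff s t _ ltr01.
have [d4 d40 h4] := cdiff_cts (@epolar_cdiff s t) d10.
exists (Num.min d2 (Num.min d3 d4)); first by rewrite !lt_min d20 d30.
move=> x y; rewrite !le_min => /and3P[x2 x3 x4] /and3P[y2 y3 y4].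
have {}h4 := h4 _ _ x4 y4; have {}h3 := h3 _ _ x3 y3; have {}h2 := h2 _ _ x2 y2.
move: h2 h3 h4; rewrite -/E; set u := epolar (s + x) (t + y) - E => h2 h3 h4.
have := h1 _ h4; rewrite -/E /u subrKC -/u => {}h1.
have xy0 : 0 <= `|x| + `|y| by rewrite addr_ge0.
have nu : normc u <= (normc E + 1) * (`|x| + `|y|).
  rewrite -[X in normc X](subrK (E * (x +i* y)%C)) (le_trans (le_normcD _ _))//.
  by rewrite normcM mulrDl addrC lerD// ler_wpM2l// (le_trans (normc_le _)).
rewrite (_ : _ - _ - _ = (f (epolar (s + x) (t + y)) - f E - A * u) + A * (u - E * (x +i* y)%C)); last by ring.
rewrite (le_trans (le_normcD _ _))// normcM.
have k1 : e2 * normc u <= e / 2 * (`|x| + `|y|).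
  rewrite (le_trans (ler_wpM2l (ltW e20) nu))// mulrA ler_wpM2r// /e2.
  by rewrite le_eqVlt; apply/orP; left; apply/eqP; field; apply: lt0r_neq0; lra.
have k2 : normc A * normc (u - E * (x +i* y)%C) <= e / 2 * (`|x| + `|y|).
  rewrite (le_trans (ler_wpM2l nA h2))// mulrA ler_wpM2r// /e1.
  rewrite mulrA ler_pdivrMr; last lra.
  rewrite (_ : e / 2 * _ = e * (normc A + 1)); [|by field].
  by rewrite [leRHS]mulrC ler_wpM2r ?(ltW e0)//; lra.
by rewrite (le_trans (lerD (le_trans h1 k1) k2))// -mulrDl -splitr.
Qed.

End polar.

(** * From circles inside the disk to the boundary *)

Section hardy.
Context {R : realType}.
Notation lmu := (@lebesgue_measure R).
Notation arc := (@circle_arc R : set (measurableTypeR R)).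

(** Truncation: g <= min (g, L) + g^2 / L. The first term converges by dominated convergence, the
    second has integral at most M / L, and L = 2 (M + 1) / e makes it at most e / 2. *)
Lemma L2_bounded_cvg_L1 (g : nat -> R -> R) (M : R) :
  (forall n, @measurable_fun _ _ (measurableTypeR R) R arc (g n)) ->
  (forall n x, 0 <= g n x) ->
  {ae lmu, forall x : R, arc x -> g n x @[n --> \oo] --> 0} ->
  (forall n, rint lmu arc (fun x => g n x ^+ 2) /\ RI lmu arc (fun x => g n x ^+ 2) <= M) ->
  RI lmu arc (g n) @[n --> \oo] --> 0.
Proof.
move=> mg g0 cg g2; have M0 : 0 <= M.
  by apply: le_trans (g2 0%N).2; apply: RI_ge0 => x _; exact: sqr_ge0.
have mm (L : R) n : @measurable_fun _ _ (measurableTypeR R) R arc (fun x => Num.min (g n x) L).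
  by apply: measurable_minr => //; exact: measurable_cst.
have rc (c : R) : rint lmu arc (fun=> c).
  by apply: (rint_bounded marc arc_lty (M := `|c|)) => [|x _ /=]; [exact: measurable_cst|].
have m0 (L : R) : 0 < L -> RI lmu arc (fun x => Num.min (g n x) L) @[n --> \oo] --> 0.
  move=> L0.
  have Z : RI lmu arc (cst 0 : R -> R) = 0 by rewrite /RI /Rintegral integral0.
  rewrite -Z.
  apply: (proj2 (@RI_dct _ _ _ lmu arc marc (fun n x => Num.min (g n x) L) (cst 0) (cst L)
    (mm L) (@measurable_cst _ _ _ _ _ _) _ _ _)).
  - apply: ae_sub cg => x cx /cx {}cx.
    apply: (@squeeze_cvgr _ _ _ _ (fun=> 0) (fun n => g n x)) => //; last exact: cvg_cst.
    by apply: nearW => n; rewrite le_min g0 ltW//= ge_min lexx.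
  - exact: rc.
  - by move=> n x _ /=; rewrite ger0_norm ?ge_min ?lexx ?orbT// le_min g0 ltW.
have rm (L : R) n : 0 < L -> rint lmu arc (fun x => Num.min (g n x) L).
  move=> L0; apply: (rint_bounded marc arc_lty (M := L)) => // x _ /=.
  by rewrite ger0_norm ?ge_min ?lexx ?orbT// le_min g0 ltW.
have rg n : rint lmu arc (g n).
  apply: (rint_le marc (mg n) (g := fun x => 1 + g n x ^+ 2)).
    move=> x _; rewrite ger0_norm//; have := sqr_ge0 (g n x - 1); have := g0 n x.
    by move: (g n x) => u *; nra.
  apply: rintD; [exact: marc|exact: rc|exact: (g2 n).1].
apply/cvgrPdist_le => e e0; pose L := 2 * (M + 1) / e.
have L0 : 0 < L by rewrite divr_gt0//; lra.
have e2 : 0 < e / 2 by lra.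
move/cvgrPdist_le : (m0 L L0) => /(_ _ e2) near1; near=> n.
rewrite sub0r normrN ger0_norm; last by apply: RI_ge0 => x _; exact: g0.
have s1 : RI lmu arc (g n) <= RI lmu arc (fun x => Num.min (g n x) L + L^-1 * g n x ^+ 2).
  apply: (RI_le marc (rg n)).
    by apply: (rintD marc (rm L n L0)); apply: (rintZ marc _ (g2 n).1).
  move=> x _; case: (leP (g n x) L) => h; first by rewrite lerDl mulr_ge0// ?sqr_ge0// invr_ge0 ltW.
  have -> : g n x = L^-1 * (L * g n x) by rewrite mulrA mulVf ?mul1r ?lt0r_neq0.
  rewrite ler_wpDl ?(ltW L0)// ler_wpM2l ?invr_ge0 ?(ltW L0)//.
  have Eg : L^-1 * (L * g n x) = g n x by rewrite mulrA mulVf ?mul1r ?lt0r_neq0.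
  by rewrite Eg expr2 ler_wpM2r// ltW.
rewrite (le_trans s1)// RI_D; [|exact: marc|exact: rm|exact: (rintZ marc _ (g2 n).1)].
rewrite RI_Z; [|exact: marc|exact: (g2 n).1].
have s2 : L^-1 * RI lmu arc (fun x => g n x ^+ 2) <= e / 2.
  rewrite mulrC ler_pdivrMr// (le_trans (g2 n).2)// /L.
  by rewrite (_ : e / 2 * _ = M + 1); [lra|field; apply: lt0r_neq0].
have s3 : RI lmu arc (fun x => Num.min (g n x) L) <= e / 2.
  have : `|0 - RI lmu arc (fun x => Num.min (g n x) L)| <= e / 2 by near: n.
  by rewrite sub0r normrN ger0_norm// ; apply: RI_ge0 => x _; rewrite le_min g0 ltW.
by rewrite (le_trans (lerD s3 s2))// -splitr.
Unshelve. all: by end_near. Qed.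

Lemma epolar_per (s t : R) : epolar s (t + 2 * pi) = epolar s t.
Proof. by rewrite /epolar expiD expi_2pi mulr1. Qed.

Lemma CI_arc_oc (g : R -> R[i]) : inL1 lmu arc g ->
  cintegral lmu arc g = cintegral lmu (`]- pi, pi]%classic : set (measurableTypeR R)) g.
Proof.
move=> /(inL1P _ marc _)[g1 g2]; apply: complex_ext => /=.
  by rewrite -[LHS]/(RI lmu arc (fun x => Re (g x))) RI_arc_oc.
by rewrite -[LHS]/(RI lmu arc (fun x => Im (g x))) RI_arc_oc.
Qed.

Lemma ctsat_inL1_arc (g : R -> R[i]) : (forall x, ctsat g x) -> inL1 lmu arc g.
Proof.
move=> cg; have /(_ (- pi - 1) pi)[] := fun a b => @ctsat_inL1 R g a b (fun x _ => cg x).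
move=> [m1 m2] Ig.
have mio : measurable (`]- pi - 1, pi]%classic : set (measurableTypeR R)) by exact: measurable_itv.
have sub : arc `<=` `]- pi - 1, pi]%classic.
  by move=> x; rewrite /circle_arc /= !in_itv /= => /andP[h1 ->]; rewrite andbT; lra.
split; last exact: (integrableS mio marc sub).
by split; [exact: measurable_funS m1|exact: measurable_funS m2].
Qed.

(** In logarithmic polar coordinates the sides t = pi and t = -pi of a rectangle cancel by
    periodicity, so the mean over a circle does not depend on its radius; for radii tending to 0 it
    tends to F 0. *)
Lemma circle_mean (F : R[i] -> R[i]) (s : R) : s < 0 ->
  (forall z : R[i]^o, `|z| < 1 -> derivable (F : R[i]^o -> R[i]^o) z 1) ->
  inL1 lmu arc (fun t => F (epolar s t)) /\
  cintegral lmu arc (fun t => F (epolar s t)) = (2 * pi)%:C%C * F 0.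
Proof.
move=> s0 dF; have pi0 := pi_gt0 R.
have dE (u t : R) : u < 0 -> exists A, cdiff (fun x y => F (epolar x y)) u t A.
  by move=> u0; apply: cdiff_comp; apply: dF; rewrite normcE normc_epolar ltcR expR_lt1.
have IL (u : R) : u < 0 -> inL1 lmu arc (fun t => F (epolar u t)).
  by move=> u0; apply: ctsat_inL1_arc => t; have [A] := dE u t u0; exact: cdiff_ctsat2.
have IL' (u : R) : u < 0 -> inL1 lmu (`]- pi, pi]%classic : set (measurableTypeR R)) (fun t => F (epolar u t)).
  by move=> u0; apply: ctsat_inL1 => t _; have [A] := dE u t u0; exact: cdiff_ctsat2.
split; first exact: IL.
have indep (u v : R) : u <= v -> v < 0 ->
    cintegral lmu arc (fun t => F (epolar u t)) = cintegral lmu arc (fun t => F (epolar v t)).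
  move=> uv v0; have u0 := le_lt_trans uv v0.
  have pp : - pi <= (pi : R) by lra.
  have := @goursat R (fun x y => F (epolar x y)) u v (- pi) pi uv pp.
  rewrite (_ : (fun x => _ - _) = fun=> 0); last first.
    by apply/funext => x; have := epolar_per x (- pi); rewrite (_ : - pi + 2 * pi = pi) => [->|]; rewrite ?subrr//; ring.
  rewrite CI_0 add0r => H.
  have {H} : (0 +i* 1)%C * (cintegral lmu `]- pi, pi] (fun t => F (epolar v t) - F (epolar u t))) = 0.
    by apply: H => x y /andP[_ h] _; apply: dE; exact: le_lt_trans h v0.
  rewrite CI_B; [|exact: measurable_itv|exact: IL'|exact: IL'].
  rewrite (CI_arc_oc (IL u u0)) (CI_arc_oc (IL v v0)).
  move: (cintegral _ _ _) (cintegral _ _ _) => z1 z2 H.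
  apply/esym/eqP; rewrite -subr_eq0; apply/eqP/normc_eq0.
  have := congr1 (@normc R) H; rewrite normcM normc0 (_ : normc (0 +i* 1)%C = 1) ?mul1r//.
  by rewrite /= expr0n expr1n add0r sqrtr1.
apply/eqP; rewrite -subr_eq0; apply/eqP/normc_eq0/eqP; rewrite eq_le normc_ge0 andbT.
rewrite -[leRHS](mul0r (2 * pi)); apply/ler_addgt0Pr => e e0; rewrite mul0r add0r.
have e1 : 0 < e / (2 * pi) by rewrite divr_gt0//; lra.
have F0 : derivable (F : R[i]^o -> R[i]^o) 0 1 by apply: dF; rewrite normr0.
have [A hA] := cderivable_eps F0.
have [d d0 hd] := hA 1 ltr01.
have nA := normc_ge0 A.
pose r := Num.min d (e / (2 * pi) / (1 + normc A)).
have r0 : 0 < r by rewrite lt_min d0 divr_gt0//; lra.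
pose u := Num.min s (ln r).
have us : u <= s by rewrite ge_min lexx.
have u0 : u < 0 by exact: le_lt_trans us s0.
have ur : expR u <= r by rewrite -[leRHS]lnK ?posrE// ler_expR ge_min lexx orbT.
rewrite -(indep u s us s0).
have -> : (2 * pi)%:C%C * F 0 = cintegral lmu arc (fun=> F 0).
  rewrite CI_arc_oc; last by apply: ctsat_inL1_arc => x e' e'0; exists 1 => // y _; rewrite subrr normc0 ltW.
  rewrite ci_cst; last by lra.
  by rewrite mulrC (_ : pi - - pi = 2 * pi)//; lra.
have Ic : inL1 lmu arc (fun=> F 0).
  by apply: ctsat_inL1_arc => x e' e'0; exists 1 => // y _; rewrite subrr normc0 ltW.
rewrite -CI_B; [|exact: marc|exact: IL|by []].
rewrite CI_arc_oc; last by apply: inL1B => //; [exact: marc|exact: IL].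
rewrite (le_trans (ci_bound (M := e / (2 * pi)) _ _ _))//.
- by lra.
- apply: inL1B; [exact: measurable_itv|exact: IL'|].
  by apply: ctsat_inL1 => x _ e' e'0; exists 1 => // y _; rewrite subrr normc0 ltW.
- move=> t _; have nr : normc (epolar u t) <= d by rewrite normc_epolar (le_trans ur)// ge_min lexx.
  have := hd _ nr; rewrite add0r mul1r => h.
  rewrite -[X in normc X](subrK (A * epolar u t)) (le_trans (le_normcD _ _))//.
  rewrite normcM (le_trans (lerD h (lexx _)))// normc_epolar -[X in X + _]mul1r -mulrDl.
  have : expR u <= e / (2 * pi) / (1 + normc A) by rewrite (le_trans ur)// ge_min lexx orbT.
  by rewrite ler_pdivlMr; [rewrite mulrC|lra].
- rewrite opprK -mulr2n -[pi *+ 2]mulr_natl divfK//; apply: lt0r_neq0; lra.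
Qed.

Let rr (n : nat) : R := 1 - n.+2%:R^-1.

Let rr01 n : 0 < rr n < 1.
Proof.
rewrite /rr subr_gt0 invf_lt1 ?ltr0n// ltr1n /=.
have : 0 < n.+2%:R^-1 :> R by rewrite invr_gt0.
by move: (n.+2%:R^-1) => u ?; lra.
Qed.

Let rr_cvg : rr n @[n --> \oo] --> (1 : R).
Proof.
rewrite -[X in _ --> X](subr0 (1 : R)); apply: cvgB; first exact: cvg_cst.
have := @cvg_harmonic R; rewrite -(cvg_shiftS (fun n => n.+1%:R^-1 : R)) => /=.
exact.
Qed.

(** The integrals against e^(ikx), k >= 0, are the coefficients at the frequencies -k. On the circle
    of radius r_n they come from [circle_mean] for f z^k. Radial convergence is only almost
    everywhere, but the bounded L2 means turn it into convergence in L1. *)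
Theorem hardy2_fourier (f : R[i] -> R[i]) (k : nat) : hardy2 f ->
  cintegral lmu arc (fun x => expi (k%:R * x) * f (expi x)) =
  if k == 0%N then (2 * pi)%:C%C * f 0 else 0.
Proof.
move=> [df [C fC] f2 flim].
pose g n (x : R) := f ((rr n)%:C%C * expi x).
have gE n x : g n x = f (epolar (ln (rr n)) x).
  by rewrite /g /epolar lnK// posrE; have /andP[] := rr01 n.
have l0 n : ln (rr n) < 0 by apply: ln_lt0; exact: rr01.
have mean (m : nat) n : inL1 lmu arc (fun x => g n x * epolar (ln (rr n)) x ^+ m) /\
    cintegral lmu arc (fun x => g n x * epolar (ln (rr n)) x ^+ m) = (2 * pi)%:C%C * (f 0 * 0 ^+ m).
  under eq_fun do rewrite gE.
  apply: (@circle_mean (fun z => f z * z ^+ m) (ln (rr n)) (l0 n)) => z z1.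
  apply: (@derivableM _ _ (f : R[i]^o -> R[i]^o) (fun z : R[i]^o => z ^+ m)); first exact: df.
  exact: exprn_derivable.
have Ig n : inL1 lmu arc (g n) by have [] := mean 0%N n; under eq_fun do rewrite expr0 mulr1.
have gk n : cintegral lmu arc (fun x => expi (k%:R * x) * g n x) =
    if k == 0%N then (2 * pi)%:C%C * f 0 else 0.
  have := (mean k n).2; case: k => [|k].
    rewrite expr0 mulr1 eqxx => <-; apply: eq_CI => x _.
    by rewrite mul0r expi0 expr0 mulr1 mul1r.
  rewrite expr0n /= !mulr0 => H.
  have r0 : (rr n)%:C%C != 0 by rewrite eq_complex /= eqxx andbT; have /andP[/lt0r_neq0] := rr01 n.
  apply: (mulfI (expf_neq0 k.+1 r0)); rewrite mulr0 -[RHS]H -CI_Z; last 2 first.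
  - exact: marc.
  - apply: (inL1_bmul marc _ (M := 1)) (Ig n); last by move=> x _; rewrite normc_expi.
    exact: cmeas_expi.
  apply: eq_CI => x _; rewrite /epolar lnK; last by rewrite posrE; have /andP[] := rr01 n.
  by rewrite exprMn expi_nat; ring.
pose D n (x : R) := normc (g n x - f (expi x)).
have If := inL2_L1 marc arc_lty f2.
have mD n : cmeasurable arc (fun x => g n x - f (expi x)).
  by apply: cmeasB; [exact: (Ig n).1|exact: If.1].
have mgn n : @measurable_fun _ _ (measurableTypeR R) R arc (fun x => normc (g n x) ^+ 2).
  by apply: measurable_funX; apply: measurable_normc; exact: (Ig n).1.
have g2 n : rint lmu arc (fun x => normc (g n x) ^+ 2) /\ RI lmu arc (fun x => normc (g n x) ^+ 2) <= C.
  have /andP[r0 r1] := rr01 n.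
  have h : (\int[lmu]_(x in arc) (normc (g n x) ^+ 2)%:E <= C%:E)%E.
    by apply: fC; rewrite r1 ltW.
  have I : rint lmu arc (fun x => normc (g n x) ^+ 2).
    apply/integrableP; split; first exact/measurable_EFinP.
    under eq_integral do rewrite gee0_abs ?lee_fin ?sqr_ge0//.
    exact: le_lt_trans h (ltry _).
  by split=> //; move: h; rewrite (RI_EFin marc I) lee_fin.
have D0 : RI lmu arc (D n) @[n --> \oo] --> 0.
  apply: (@L2_bounded_cvg_L1 D (2 * (C + RI lmu arc (fun x => normc (f (expi x)) ^+ 2)))).
  - by move=> n; exact: measurable_normc.
  - by move=> n x; exact: normc_ge0.
  - apply: ae_sub flim => x fx /fx /cvgrPdist_le fl.
    apply/cvgrPdist_le => e e0; have e0' : 0 < e%:C%C by rewrite ltcR.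
    have [d /= d0 hd] := fl _ e0'.
    move/cvgrPdist_lt : rr_cvg => /(_ d d0) near1; near=> n.
    rewrite sub0r normrN ger0_norm ?normc_ge0// /D -normcN opprB -lecR.
    apply: hd; last by have /andP[] := rr01 n.
    by rewrite /ball /=; near: n.
  - move=> n; have I2 := inL2_rint f2.
    have I3 := rintZ marc 2 (rintD marc (g2 n).1 I2).
    have le x : arc x -> `|D n x ^+ 2| <= 2 * (normc (g n x) ^+ 2 + normc (f (expi x)) ^+ 2).
      by move=> _; rewrite ger0_norm ?sqr_ge0// (le_trans (normcD_sqr _ _))// normcN.
    have I4 : rint lmu arc (fun x => D n x ^+ 2).
      by apply: (rint_le marc _ le I3); apply: measurable_funX; exact: measurable_normc.
    split=> //; apply: (@le_trans _ _ (RI lmu arc (fun x => 2 * (normc (g n x) ^+ 2 + normc (f (expi x)) ^+ 2)))).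
      by apply: (RI_le marc I4 I3) => x Ax; rewrite (le_trans (ler_norm _))// le.
    by rewrite RI_Z ?RI_D ?ler_pM2l ?lerD2r//; [exact: (g2 n).2|exact: marc|exact: (g2 n).1|exact: marc|apply: rintD => //; [exact: marc|exact: (g2 n).1]].
have Iexp (u : R -> R[i]) : inL1 lmu arc u -> inL1 lmu arc (fun x => expi (k%:R * x) * u x).
  move=> Iu; apply: (inL1_bmul marc _ (M := 1)) Iu; last by move=> x _; rewrite normc_expi.
  exact: cmeas_expi.
apply/eqP; rewrite -subr_eq0; apply/eqP/normc_eq0/eqP; rewrite eq_le normc_ge0 andbT.
rewrite -(cvg_lim _ D0)//; apply: limr_ge; first by apply/cvg_ex; exists 0.
apply: nearW => n; rewrite -(gk n) -normcN opprB -CI_B; [|exact: marc|exact: Iexp|exact: Iexp].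
have Ie := inL1B marc (Iexp _ (Ig n)) (Iexp _ If).
rewrite (le_trans (normc_CI marc Ie))// le_eqVlt; apply/orP; left; apply/eqP.
by apply: eq_RI => x _; rewrite -mulrBr normcM normc_expi mul1r.
Unshelve. all: by end_near. Qed.

End hardy.

(** * Jensen's inequality for determinants *)

Section jensen.
Context {R : realType}.
Notation lmu := (@lebesgue_measure R).
Notation arc := (@circle_arc R : set (measurableTypeR R)).
Implicit Types (b c : R[i]) (m : nat).

Lemma RI_arc_cst (k : R) : RI lmu arc (fun=> k) = k * (2 * pi).
Proof. by rewrite (RI_cst marc k arc_lty); congr (_ * _); exact: (congr1 fine (@lmu_arc R)). Qed.

Lemma rint_arc_cst (k : R) : rint lmu arc (fun=> k).
Proof. by apply: (rint_bounded marc arc_lty (M := `|k|)) => [|x _ //]; exact: measurable_cst. Qed.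

Let nf c m (x : R) : R := normc (1 - c * expi (m%:R * x)) ^+ 2.

Let meas_nf c m D : @measurable_fun _ _ (measurableTypeR R) R D (nf c m).
Proof.
apply: measurable_funX; apply: measurable_normc; apply: cmeasB; first exact: cmeas_cst.
by apply: cmeasM; [exact: cmeas_cst|exact: cmeas_expi].
Qed.

Let nf_bounds c m x : normc c < 1 -> (1 - normc c) ^+ 2 <= nf c m x <= (1 + normc c) ^+ 2.
Proof.
move=> c1; have c0 := normc_ge0 c.
have e : normc (c * expi (m%:R * x)) = normc c by rewrite normcM normc_expi mulr1.
have h1 : normc (1 - c * expi (m%:R * x)) <= 1 + normc c.
  by rewrite (le_trans (le_normcD _ _))// normcN normc1 e.
have h2 : 1 - normc c <= normc (1 - c * expi (m%:R * x)).
  rewrite lerBlDr -e -[X in X <= _](@normc1 R) -[X in normc X <= _](subrK (c * expi (m%:R * x))).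
  exact: le_normcD.
apply/andP; split; rewrite /nf ler_pXn2r ?nnegrE ?normc_ge0//; first by rewrite subr_ge0 ltW.
by rewrite addr_ge0.
Qed.

Let nf_gt0 c m x : normc c < 1 -> 0 < nf c m x.
Proof.
move=> c1; have /andP[h _] := nf_bounds m x c1.
by apply: lt_le_trans h; rewrite exprn_gt0// subr_gt0.
Qed.

(** The upper bound too is governed by K, since (1 + |c|) (1 - K) <= 1. Any K >= |c| is allowed so
    that one bound serves all the powers c^(2^n). *)
Let ln_nf c m x (K : R) : normc c <= K -> K < 1 -> `|ln (nf c m x)| <= - ln ((1 - K) ^+ 2).
Proof.
move=> cK K1; have c1 := le_lt_trans cK K1; have c0 := normc_ge0 c.
have /andP[h1 h2] := nf_bounds m x c1.
have k0 : 0 < (1 - K) ^+ 2 by rewrite exprn_gt0// subr_gt0.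
have kk : (1 - K) ^+ 2 <= (1 - normc c) ^+ 2.
  by rewrite ler_pXn2r ?nnegrE ?subr_ge0 ?(ltW K1) ?(ltW c1)// lerD2l lerN2.
rewrite ler_norml opprK; apply/andP; split.
  by rewrite ler_ln ?posrE ?nf_gt0// (le_trans kk).
rewrite -lnV ?posrE//; rewrite ler_ln ?posrE ?nf_gt0 ?invr_gt0// (le_trans h2)//.
rewrite -[leRHS]div1r ler_pdivlMr// -exprMn -[leRHS](expr1n _ 2).
rewrite ler_pXn2r ?nnegrE//; last first.
  by rewrite mulr_ge0//; lra.
by nra.
Qed.

Let J c m := RI lmu arc (fun x => ln (nf c m x)).

Let rint_nf c m : normc c < 1 -> rint lmu arc (fun x => ln (nf c m x)).
Proof.
move=> c1; apply: (rint_bounded marc arc_lty (M := - ln ((1 - normc c) ^+ 2))).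
  by apply: measurableT_comp; [exact: measurable_ln|exact: meas_nf].
by move=> x _; exact: ln_nf.
Qed.

(* |1 - c z| |1 + c z| = |1 - c^2 z^2|, and a rotation exchanges the two factors. *)
Let J_double c m : (0 < m)%N -> normc c < 1 -> J (c ^+ 2) (2 * m) = 2 * J c m.
Proof.
move=> m0 c1; have c0 := normc_ge0 c.
have rot : J (- c) m = J c m.
  have mR : 0 < m%:R :> R by rewrite ltr0n.
  rewrite /J -(@RI_rotate R (fun x => ln (nf c m x)) (pi / m%:R) (- ln ((1 - normc c) ^+ 2))).
  - apply: eq_RI => x _; congr ln; rewrite /nf mulrDr expiD [m%:R * (pi / _)]mulrC divfK ?lt0r_neq0// expi_pi.
    by congr (normc _ ^+ 2); ring.
  - by apply: measurableT_comp; [exact: measurable_ln|exact: meas_nf].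
  - by move=> x; exact: ln_nf.
  - by move=> x; rewrite /nf -[m%:R]/(m%:Z%:~R) expi_intper.
  - have pi0 := pi_gt0 R; rewrite divr_ge0 ?(ltW pi0)//= ler_pdivrMr//.
    rewrite -mulrA mulrCA ler_peMr ?(ltW pi0)// -natrM ler1n muln_gt0 m0//.
have cN : normc (- c) < 1 by rewrite normcN.
rewrite mulr2n mulrDl !mul1r -{1}rot -RI_D; [|exact: marc|exact: rint_nf|exact: rint_nf].
apply: eq_RI => x _; rewrite -lnM ?posrE ?nf_gt0//; congr ln.
rewrite /nf -exprMn -normcM; congr (normc _ ^+ 2).
rewrite natrM -mulrA expi_nat; ring.
Qed.

(** By [J_double], 2^n J c 1 is again a value of J, at c^(2^n) and frequency 2^n, and these values
    are bounded uniformly in n. *)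
Lemma jensen0 c : normc c < 1 -> J c 1 = 0.
Proof.
move=> c1; have c0 := normc_ge0 c.
have iter n : J (c ^+ (2 ^ n)) (2 ^ n) = 2 ^+ n * J c 1.
  elim: n => [|n ih]; first by rewrite expn0 !expr1 expr0 mul1r.
  rewrite expnSr exprM mulnC J_double ?expn_gt0// ?ih ?exprS ?mulrA//.
  by rewrite normcX exprn_ilt1// -lt0n expn_gt0.
pose K : R := - ln ((1 - normc c) ^+ 2) * (2 * pi).
have bnd n : `|J c 1| <= K * (2^-1) ^+ n.
  rewrite exprVn ler_pdivlMr ?exprn_gt0// mulrC -[X in X * _](ger0_norm (exprn_ge0 n _))//.
  rewrite -normrM -iter.
  have cn : normc (c ^+ (2 ^ n)) <= normc c.
    rewrite normcX -(prednK (n := 2 ^ n)) ?expn_gt0// exprS ler_piMr// exprn_ile1//.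
    exact: ltW.
  have cn1 := le_lt_trans cn c1.
  rewrite (le_trans (RI_norm marc (rint_nf _ _)))// /K.
  rewrite (le_trans (RI_le marc (rint_norm (rint_nf _ cn1)) (g := fun=> - ln ((1 - normc c) ^+ 2)) _ _))//.
  - exact: rint_arc_cst.
  - by move=> x _; exact: ln_nf.
  - by rewrite RI_arc_cst.
apply/eqP; rewrite -normr_eq0 eq_le normr_ge0 andbT.
have : (K * (2^-1 : R) ^+ n) @[n --> \oo] --> K * 0.
  by apply: cvgMr; apply: cvg_expr; rewrite ger0_norm ?invf_lt1 ?ltr1n.
rewrite mulr0 => cK; rewrite -(cvg_lim _ cK)//; apply: limr_ge; first by apply/cvg_ex; exists 0.
by apply: nearW.
Qed.

(** Adding e moves the zero off the unit circle. Comparing coefficients, k solves k^2 - (1 + |b|^2 +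
    e) k + |b|^2 = 0 and c = b / k; the larger root gives k > 1 and |c| < 1, so the mean of the
    logarithm is ln k > 0. *)
Let linear_factor b (e : R) : 0 < e -> exists k c, [/\ 1 < k, normc c < 1 &
  forall x, normc (1 - b * expi x) ^+ 2 + e = k * nf c 1 x].
Proof.
move=> e0; pose t := normc b; have t0 : 0 <= t := normc_ge0 b.
pose S := 1 + t ^+ 2 + e.
have S2t : 2 * t < S by rewrite /S; have := sqr_ge0 (1 - t); rewrite sqrrB; lra.
have Dg : 0 < S ^+ 2 - 4 * t ^+ 2.
  rewrite (_ : _ - _ = (S - 2 * t) * (S + 2 * t)); last by ring.
  by rewrite mulr_gt0//; lra.
pose s := Num.sqrt (S ^+ 2 - 4 * t ^+ 2).
have s2 : s ^+ 2 = S ^+ 2 - 4 * t ^+ 2 by rewrite sqr_sqrtr ?ltW.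
have s0 : 0 < s by rewrite sqrtr_gt0.
pose k := (S + s) / 2.
have k2 : k ^+ 2 - S * k + t ^+ 2 = 0.
  by rewrite /k (_ : _ + _ = (s ^+ 2 - (S ^+ 2 - 4 * t ^+ 2)) / 4); [rewrite s2; lra|field].
have k1 : 1 < k.
  rewrite ltNge; apply/negP => h.
  have hS : S ^+ 2 - 4 * t ^+ 2 <= (2 - S) ^+ 2.
    rewrite -s2 ler_pXn2r ?nnegrE ?(ltW s0)//; rewrite /k in h; lra.
  by move: hS; rewrite /S; nra.
have kt : t < k by rewrite /k; lra.
have k0 : 0 < k by lra.
exists k, (b / k%:C%C); split => //.
  rewrite normcM normcV normc_real gtr0_norm// ltr_pdivrMr// mul1r//.
move=> x; rewrite /nf mul1r.
have kC : k%:C%C != 0 by rewrite eq_complex /= eqxx andbT lt0r_neq0.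
have E (z : R[i]) : normc (1 - z) ^+ 2 = 1 + normc z ^+ 2 - 2 * Re z.
  by rewrite !normc2 !(ReB, ImB) /=; ring.
rewrite !E !normcM normcV normc_real gtr0_norm// !normc_expi !mulr1 -/t.
have -> : Re (b / k%:C%C * expi x) = Re (b * expi x) / k.
  have -> : b / k%:C%C * expi x = (k^-1)%:C%C * (b * expi x) by rewrite fmorphV /=; ring.
  by case: (b * expi x) => u v /=; ring.
have -> : 1 + t ^+ 2 - 2 * Re (b * expi x) + e = S - 2 * Re (b * expi x) by rewrite /S; ring.
have -> : S = k + t ^+ 2 / k.
  have kn := lt0r_neq0 k0; apply: (mulIf kn); rewrite [RHS]mulrDl [_ / k * k]divfK//.
  by rewrite -[LHS]addr0 -k2; ring.
by field; exact: lt0r_neq0.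
Qed.

Let lf b e x := normc (1 - b * expi x) ^+ 2 + e.

Let meas_lf b e D : @measurable_fun _ _ (measurableTypeR R) R D (lf b e).
Proof.
apply: measurable_funD; last exact: measurable_cst.
have := @meas_nf b 1 D; rewrite /nf; by under eq_fun do rewrite mul1r.
Qed.

Let lf_gt0 b e x : 0 < e -> 0 < lf b e x.
Proof. by move=> e0; rewrite ltr_wpDl// sqr_ge0. Qed.

Let jensen_lf b (e : R) : 0 < e -> rint lmu arc (fun x => ln (lf b e x)) /\ 0 <= RI lmu arc (fun x => ln (lf b e x)).
Proof.
move=> e0; have [k [c [k1 c1 h]]] := linear_factor b e0.
have k0 : 0 < k by lra.
have E : (fun x => ln (lf b e x)) = (fun x => ln k + ln (nf c 1 x)).
  by apply/funext => x; rewrite /lf h lnM ?posrE// nf_gt0.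
have Ik := rint_arc_cst (ln k).
rewrite E; split; first by apply: (rintD marc Ik); exact: rint_nf.
rewrite RI_D//; [|exact: marc|exact: rint_nf].
rewrite -/(J c 1) jensen0// addr0 RI_arc_cst.
by rewrite mulr_ge0 ?ln_ge0 ?ltW// mulr_gt0// pi_gt0.
Qed.

Let prodf (s : seq R[i]) (e x : R) := \prod_(b <- s) lf b e x.

Let prodf_gt0 s (e x : R) : 0 < e -> 0 < prodf s e x.
Proof. by move=> e0; apply: prodr_gt0 => b _; exact: lf_gt0. Qed.

Let jensen_prod s (e : R) : 0 < e ->
  rint lmu arc (fun x => ln (prodf s e x)) /\ 0 <= RI lmu arc (fun x => ln (prodf s e x)).
Proof.
move=> e0; elim: s => [|b s [I1 I2]].
  rewrite /prodf; under eq_fun do rewrite big_nil ln1.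
  by split; [exact: rint_arc_cst|exact: RI_ge0].
have E : (fun x => ln (prodf (b :: s) e x)) = (fun x => ln (lf b e x) + ln (prodf s e x)).
  by apply/funext => x; rewrite /prodf big_cons lnM ?posrE ?lf_gt0//; exact: prodf_gt0.
have [I3 I4] := jensen_lf b e0.
by rewrite E; split; [exact: (rintD marc)|rewrite (RI_D marc) ?addr_ge0].
Qed.

Let lf_le b x : normc (1 - b * expi x) ^+ 2 <= (1 + normc b) ^+ 2.
Proof.
rewrite ler_pXn2r ?nnegrE ?normc_ge0//; last by rewrite addr_ge0// normc_ge0.
by rewrite (le_trans (le_normcD _ _))// normcN normc1 normcM normc_expi mulr1.
Qed.

Let prodf_le s : exists2 B : R, 0 <= B & forall x, prodf s 0 x <= B.
Proof.
elim: s => [|b s [B B0 hB]]; first by exists 1 => // x; rewrite /prodf big_nil.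
exists ((1 + normc b) ^+ 2 * B); first by rewrite mulr_ge0// sqr_ge0.
move=> x; rewrite /prodf big_cons ler_pM//; first by rewrite /lf addr0 sqr_ge0.
  by apply: prodr_ge0 => c _; rewrite /lf addr0 sqr_ge0.
  by rewrite /lf addr0 lf_le.
exact: hB.
Qed.

(** Jensen's inequality is known when t is added to each factor and wanted when e is added to the
    product; the two are compared uniformly in x. *)
Let prodf_approx s (e : R) : 0 < e -> exists2 d, 0 < d &
  forall x t, 0 <= t -> t <= d -> prodf s t x <= prodf s 0 x + e.
Proof.
elim: s e => [|b s ih] e e0.
  by exists 1 => // x t _ _; rewrite /prodf !big_nil lerDl ltW.
have [B B0 hB] := prodf_le s.
pose C := (1 + normc b) ^+ 2 + 1 + B.
have C0 : 0 < C by rewrite /C -addrA ltr_wpDl ?sqr_ge0//; lra.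
have e1 : 0 < Num.min 1 (e / (2 * C)) by rewrite lt_min ltr01 divr_gt0//; lra.
have [d d0 hd] := ih _ e1; exists (Num.min d (e / (2 * C))).
  by rewrite lt_min d0 divr_gt0//; lra.
move=> x t t0; rewrite le_min => /andP[td te].
have := hd x t t0 td; have := hB x; rewrite /prodf !big_cons -/(prodf s t x) -/(prodf s 0 x).
have p0 : 0 <= prodf s 0 x by apply: prodr_ge0 => c _; rewrite /lf addr0 sqr_ge0.
have m1 : Num.min 1 (e / (2 * C)) <= 1 by rewrite ge_min lexx.
have m2 : Num.min 1 (e / (2 * C)) <= e / (2 * C) by rewrite ge_min lexx orbT.
have F : lf b t x = lf b 0 x + t by rewrite /lf addr0.
have f0 : 0 <= lf b 0 x by rewrite /lf addr0 sqr_ge0.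
have f1 : lf b 0 x <= (1 + normc b) ^+ 2 by rewrite /lf addr0 lf_le.
rewrite F; move: m1 m2 (ltW e1); set v := Num.min _ _; move: (prodf s t x) (prodf s 0 x) p0 => p p' p0 m1 m2 v0 h1 h2.
have H : (lf b 0 x + t) * p <= (lf b 0 x + t) * (p' + v) by rewrite ler_wpM2l// addr_ge0.
rewrite (le_trans H)//.
have -> : (lf b 0 x + t) * (p' + v) = lf b 0 x * p' + (lf b 0 x * v + t * (p' + v)) by ring.
rewrite lerD2l.
have g1 : lf b 0 x * v <= (1 + normc b) ^+ 2 * (e / (2 * C)) by rewrite ler_pM.
have g2 : t * (p' + v) <= e / (2 * C) * (B + 1) by rewrite ler_pM// ?addr_ge0// lerD.
rewrite (le_trans (lerD g1 g2))// [X in X + _]mulrC -mulrDr.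
rewrite [leLHS](_ : _ = e / (2 * C) * C); last by rewrite /C; ring.
by rewrite invfM mulrA divfK ?lt0r_neq0//; lra.
Qed.

(** As g(0) = 1 all roots a of g are nonzero, so g is the product of the factors 1 - z / a. The
    summand e keeps the logarithm bounded when roots lie on the circle. *)
Theorem jensen_poly (g : {poly R[i]}) (e : R) : g.[0] = 1 -> 0 < e ->
  rint lmu arc (fun x => ln (normc g.[expi x] ^+ 2 + e)) /\
  0 <= RI lmu arc (fun x => ln (normc g.[expi x] ^+ 2 + e)).
Proof.
move=> g0 e0; have [r hr] := closed_field_poly_normal g.
set l := lead_coef g in hr.
have hg z : g.[z] = l * \prod_(a <- r) (z - a).
  by rewrite hr hornerZ horner_prod; congr (_ * _); apply: eq_bigr => a _; rewrite hornerXsubC.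
have r0 a : a \in r -> a != 0.
  move=> ar; apply/eqP => a0; move: g0; rewrite hg (big_rem a)//= a0 subr0 mul0r mulr0 => /eqP.
  by rewrite eq_sym oner_eq0.
pose s := [seq a^-1 | a <- r].
have gE x : normc g.[expi x] ^+ 2 = prodf s 0 x.
  have -> : g.[expi x] = \prod_(a <- r) (1 - a^-1 * expi x).
    rewrite -[RHS]mul1r -[X in X * _]g0 !hg -mulrA -big_split /=; congr (_ * _).
    rewrite big_seq [RHS]big_seq; apply: eq_bigr => a /r0 a0.
    by rewrite sub0r mulrBr mulr1 mulNr mulrA mulfV// mul1r; ring.
  rewrite /prodf big_map; elim: (r) => [|a t ih]; first by rewrite !big_nil normc1 expr1n.
  by rewrite !big_cons normcM exprMn ih /lf addr0.
have [d d0 hd] := prodf_approx s e0.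
have [I1 I2] := jensen_prod s d0.
have le x : ln (prodf s d x) <= ln (normc g.[expi x] ^+ 2 + e).
  have := hd x d (ltW d0) (lexx _); rewrite -gE => h.
  by rewrite ler_ln ?posrE//; [exact: prodf_gt0|rewrite ltr_wpDl// sqr_ge0].
have [B B0 hB] := prodf_le s.
have Ig : rint lmu arc (fun x => ln (normc g.[expi x] ^+ 2 + e)).
  apply: (rint_bounded marc arc_lty (M := `|ln e| + `|ln (B + e)|)).
    apply: measurableT_comp; first exact: measurable_ln.
    under eq_fun do rewrite gE /prodf.
    apply: measurable_funD; last exact: measurable_cst.
    elim: (s) => [|b t ih]; first by under eq_fun do rewrite big_nil; exact: measurable_cst.
    by under eq_fun do rewrite big_cons; apply: measurable_funM => //; exact: meas_lf.
  move=> x _; have h1 : ln e <= ln (normc g.[expi x] ^+ 2 + e).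
    by rewrite ler_ln ?posrE ?lerDr ?sqr_ge0// ltr_wpDl// sqr_ge0.
  have h2 : ln (normc g.[expi x] ^+ 2 + e) <= ln (B + e).
    by rewrite ler_ln ?posrE ?lerD2r ?gE//; [rewrite -gE ltr_wpDl// sqr_ge0|lra].
  move: h1 h2; move: (ln _) (ln e) (ln (B + e)) => u v w h1 h2.
  rewrite ler_norml; have := ler_norm w; have := ler_norm (- v); rewrite normrN.
  have := normr_ge0 w; have := normr_ge0 v => *; apply/andP; split; lra.
by split => //; apply: le_trans I2 _; apply: (RI_le marc I1 Ig) => x _; exact: le.
Qed.

End jensen.

Section adjoint.
Context {R : realType}.

Lemma adjmxM m n p (A : 'M[R[i]]_(m, n)) (B : 'M[R[i]]_(n, p)) : adjmx (A *m B) = adjmx B *m adjmx A.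
Proof. by rewrite /adjmx trmx_mul map_mxM. Qed.

Lemma adjmxK m n (A : 'M[R[i]]_(m, n)) : adjmx (adjmx A) = A.
Proof. by rewrite /adjmx trmxCK. Qed.

Lemma adjmxD m n (A B : 'M[R[i]]_(m, n)) : adjmx (A + B) = adjmx A + adjmx B.
Proof. by apply/matrixP => i j; rewrite !(adjmxE, mxE) rmorphD. Qed.

Lemma adjmxN m n (A : 'M[R[i]]_(m, n)) : adjmx (- A) = - adjmx A.
Proof. by apply/matrixP => i j; rewrite !(adjmxE, mxE) rmorphN. Qed.

Lemma adjmxB m n (A B : 'M[R[i]]_(m, n)) : adjmx (A - B) = adjmx A - adjmx B.
Proof. by rewrite adjmxD adjmxN. Qed.

Lemma adjmxZ m n (c : R[i]) (A : 'M[R[i]]_(m, n)) : adjmx (c *: A) = c^* *: adjmx A.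
Proof. by apply/matrixP => i j; rewrite !(adjmxE, mxE) rmorphM. Qed.

Lemma adjmx1 n : adjmx 1%:M = 1%:M :> 'M[R[i]]_n.
Proof. by apply/matrixP => i j; rewrite !(adjmxE, mxE) rmorph_nat eq_sym. Qed.

Lemma adjmx_real n (c : R) : adjmx (c%:C%C)%:M = (c%:C%C)%:M :> 'M[R[i]]_n.
Proof. by apply/matrixP => i j; rewrite !(adjmxE, mxE) rmorphMn /= conjCR eq_sym. Qed.

Lemma det_adjmx n (A : 'M[R[i]]_n) : \det (adjmx A) = (\det A)^*.
Proof. by rewrite /adjmx det_map_mx det_tr. Qed.

Lemma unitmx_adj n (A : 'M[R[i]]_n) : (adjmx A \in unitmx) = (A \in unitmx).
Proof. by rewrite !unitmxE det_adjmx !unitfE conjC_eq0. Qed.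

Lemma adjmx_inv n (A : 'M[R[i]]_n) : A \in unitmx -> adjmx (invmx A) = invmx (adjmx A).
Proof.
move=> uA; have uA' : adjmx A \in unitmx by rewrite unitmx_adj.
by rewrite -[LHS]mulmx1 -(mulmxV uA') mulmxA -adjmxM mulmxV// adjmx1 mul1mx.
Qed.

End adjoint.

(** * Determinants and traces of positive semidefinite matrices *)

Section psd.
Context {R : realType}.
Variable q : nat.
Implicit Types A M : 'M[R[i]]_q.
Notation T A := (Re (\tr A)).
Notation "e %:S" := ((e%:C%C)%:M : 'M[R[i]]_q) (at level 2, format "e %:S").

Lemma psdD M A : psdmx M -> psdmx A -> psdmx (M + A).
Proof.
move=> [h1 h2] [h3 h4]; split; first by rewrite adjmxD h1 h3.
by move=> v; rewrite mulmxDr mulmxDl mxE addr_ge0.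
Qed.

Lemma psd_conj M (B : 'M[R[i]]_q) : psdmx M -> psdmx (adjmx B *m M *m B).
Proof.
move=> [h1 h2]; split; first by rewrite !adjmxM adjmxK h1 mulmxA.
by move=> v; have := h2 (B *m v); rewrite adjmxM !mulmxA.
Qed.

Lemma psd_real (e : R) : 0 <= e -> psdmx e%:S.
Proof.
move=> e0; split; first exact: adjmx_real.
move=> v; rewrite mul_mx_scalar -scalemxAl mxE mulr_ge0 ?lecR// mxE sumr_ge0// => i _.
by rewrite adjmxE mulrC mulcJ lecR sqr_ge0.
Qed.

Lemma psd_mulJ (B : 'M[R[i]]_q) : psdmx (B *m adjmx B).
Proof.
have := @psd_conj 1%:S (adjmx B) (psd_real ler01).
by rewrite adjmxK mulmx1.
Qed.

Lemma psdZ (e : R) M : 0 <= e -> psdmx M -> psdmx (e%:C%C *: M).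
Proof.
move=> e0 [h1 h2]; split; first by rewrite adjmxZ conjCR h1.
by move=> v; rewrite -scalemxAr -scalemxAl mxE mulr_ge0// lecR.
Qed.

Lemma psd_inv M : psdmx M -> M \in unitmx -> psdmx (invmx M).
Proof.
move=> pM uM; have := psd_conj (invmx M) pM.
by rewrite (adjmx_inv uM) pM.1 (mulVmx uM) mul1mx.
Qed.

Lemma psd_spectral M : psdmx M -> exists (U : 'M[R[i]]_q) (l : 'I_q -> R),
  [/\ U *m adjmx U = 1%:M, adjmx U *m U = 1%:M, forall i, 0 <= l i &
    M = adjmx U *m diag_mx (\row_i (l i)%:C%C) *m U].
Proof.
move=> [h1 h2]; have nM : M \is normalmx by apply/normalmxP; rewrite -/(adjmx M) h1.
pose U := spectralmx M; have Uu : U \is unitarymx := spectral_unitarymx M.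
have UJ : U *m adjmx U = 1%:M by exact/unitarymxP.
have JU : adjmx U *m U = 1%:M := mulmx1C UJ.
have UV : adjmx U = invmx U by exact/esym/invmx_unitary.
have [D Msp] : exists D, M = adjmx U *m diag_mx D *m U.
  by exists (spectral_diag M); rewrite UV; exact/orthomx_spectralP.
have dE i : 0 <= D 0 i.
  have := h2 (adjmx U *m delta_mx i 0); rewrite adjmxM adjmxK Msp.
  rewrite -!mulmxA [U *m (adjmx U *m delta_mx _ _)]mulmxA UJ mul1mx.
  rewrite [U *m (adjmx U *m _)]mulmxA UJ mul1mx -colE.
  have -> : adjmx (delta_mx i 0) = delta_mx 0 i :> 'M[R[i]]_(1, q).
    by apply/matrixP => a b; rewrite adjmxE !mxE rmorph_nat andbC.
  by rewrite -rowE !mxE eqxx mulr1n.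
exists U, (fun i => Re (D 0 i)); split => //.
  by move=> i; have := dE i; rewrite lecE => /andP[_].
rewrite {1}Msp; congr (_ *m diag_mx _ *m _); apply/matrixP => a b; rewrite mxE ord1.
by have := dE b; rewrite lecE /= => /andP[/eqP h _]; apply: complex_ext.
Qed.

Lemma psd_det_tr M : psdmx M -> exists l : 'I_q -> R, [/\ forall i, 0 <= l i,
   forall e : R, \det (M + e%:S) = (\prod_i (l i + e))%:C%C & T M = \sum_i l i].
Proof.
move=> /psd_spectral[U [l [UJ JU l0 ->]]]; exists l; split => // [e|].
  have -> : adjmx U *m diag_mx (\row_i (l i)%:C%C) *m U + e%:S =
      adjmx U *m diag_mx (\row_i (l i + e)%:C%C) *m U.
    have -> : diag_mx (\row_i (l i + e)%:C%C) = diag_mx (\row_i (l i)%:C%C) + e%:S.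
      apply/matrixP => a b; rewrite !mxE rmorphD /=.
      by case: eqP => [->|_]; rewrite ?eqxx ?mulr1n ?mulr0n ?addr0.
    by rewrite mulmxDr mulmxDl mul_mx_scalar -scalemxAl JU scalemx1.
  rewrite !det_mulmx mulrAC -det_mulmx JU det1 mul1r det_diag rmorph_prod.
  by apply: eq_bigr => i _; rewrite mxE.
rewrite mxtrace_mulC mulmxA UJ mul1mx mxtrace_diag Re_sum.
by apply: eq_bigr => i _; rewrite mxE.
Qed.

Lemma psd_detD_ge M (e : R) : psdmx M -> 0 <= e ->
  [/\ \det (M + e%:S) = (Re (\det (M + e%:S)))%:C%C, e ^+ q <= Re (\det (M + e%:S)) &
    Re (\det M) <= Re (\det (M + e%:S))].
Proof.
move=> /psd_det_tr[l [l0 hd _]] e0.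
have -> : Re (\det M) = \prod_i l i.
  have := hd 0; rewrite (_ : 0%:S = 0) ?addr0 => [->|]; last by rewrite raddf0.
  by apply: eq_bigr => i _; rewrite addr0.
rewrite hd /=; split => //; last by apply: ler_prod => i _; rewrite l0 lerDl.
rewrite -[X in _ ^+ X]card_ord -prodr_const; apply: ler_prod => i _.
by rewrite e0 lerDr l0.
Qed.

(** The last bound is 1 + x <= exp x at x = l_i - 1 for each eigenvalue l_i, multiplied over i. *)
Lemma psd_det M : psdmx M -> [/\ \det M = (Re (\det M))%:C%C, 0 <= Re (\det M), 0 <= T M &
  Re (\det M) <= expR (T M - q%:R)].
Proof.
move=> /psd_det_tr[l [l0 hd hT]].
have -> : \det M = (\prod_i l i)%:C%C.
  have := hd 0; rewrite (_ : 0%:S = 0) ?addr0 => [->|]; last by rewrite raddf0.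
  by congr (_%:C%C); apply: eq_bigr => i _; rewrite addr0.
rewrite hT /=; split => //; [exact: prodr_ge0|exact: sumr_ge0|].
rewrite -[X in X%:R]card_ord -sum1_card natr_sum -sumrB expR_sum.
apply: ler_prod => i _; rewrite l0 /=; have := expR_ge1Dx (l i - 1).
by rewrite addrC subrK.
Qed.

Lemma TD A M : T (A + M) = T A + T M. Proof. by rewrite mxtraceD ReD. Qed.
Lemma TB A M : T (A - M) = T A - T M. Proof. by rewrite linearB /= ReB. Qed.
Lemma TZ (e : R) A : T (e%:C%C *: A) = e * T A.
Proof. by rewrite mxtraceZ ReM /= mul0r subr0. Qed.

Lemma T_normc A : T (adjmx A *m A) = \sum_i \sum_j normc (A i j) ^+ 2.
Proof.
rewrite exchange_big Re_sum; apply: eq_bigr => j _; rewrite mxE Re_sum.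
by apply: eq_bigr => i _; rewrite adjmxE mulrC mulcJ.
Qed.

Lemma T_normcJ A : T (A *m adjmx A) = \sum_i \sum_j normc (A i j) ^+ 2.
Proof. by rewrite mxtrace_mulC T_normc. Qed.

(** The form is nonnegative at s a - s^-1 d with s^2 = t, which bounds the cross terms. *)
Lemma T_young (u a d : 'M[R[i]]_q) (t : R) : psdmx u -> 0 < t ->
  T (adjmx (a + d) *m u *m (a + d)) <=
    (1 + t) * T (adjmx a *m u *m a) + (1 + t^-1) * T (adjmx d *m u *m d).
Proof.
move=> pu t0; pose s := Num.sqrt t.
have s2 : s ^+ 2 = t by rewrite sqr_sqrtr ?ltW.
have s0 : s != 0 by rewrite sqrtr_eq0 -ltNge.
pose F (x y : 'M[R[i]]_q) := T (adjmx x *m u *m y).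
have FD (x1 x2 y1 y2 : 'M[R[i]]_q) : F (x1 + x2) (y1 + y2) = F x1 y1 + F x2 y1 + (F x1 y2 + F x2 y2).
  by rewrite /F adjmxD mulmxDr !mulmxDl !TD.
have FZ (c c' : R) (x y : 'M[R[i]]_q) : F (c%:C%C *: x) (c'%:C%C *: y) = c * c' * F x y.
  by rewrite /F adjmxZ conjCR -!scalemxAl -scalemxAr scalerA -rmorphM TZ.
have [_ _ h _] := psd_det (psd_conj (s%:C%C *: a + (- s^-1)%:C%C *: d) pu).
have {h} : 0 <= F (s%:C%C *: a + (- s^-1)%:C%C *: d) (s%:C%C *: a + (- s^-1)%:C%C *: d) by exact: h.
rewrite -/(F (a + d) (a + d)) -/(F a a) -/(F d d) !FD !FZ.
rewrite !mulrN !mulNr opprK -!expr2 exprVn s2 mulfV// mulVf// => h.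
rewrite [(1 + t) * _]mulrDl [(1 + t^-1) * _]mulrDl !mul1r; move: h; rewrite !mul1r; move: (t * F a a) (t^-1 * F d d) (F a a) (F d d) (F a d) (F d a) => *; lra.
Qed.

(* Arithmetic-geometric mean, det M <= exp (tr M - q), applied to
   M = p^* (a a^* + e)^-1 p. *)
Lemma logdet_young (a p : 'M[R[i]]_q) (e eta t : R) : 0 < e -> 0 < eta -> 0 < t ->
  ln (normc (\det p) ^+ 2 + eta * e ^+ q) - ln (Re (\det (a *m adjmx a + e%:S))) <=
  t * q%:R + (1 + t^-1) / e * (\sum_i \sum_j normc ((p - a) i j) ^+ 2) + eta * expR q%:R.
Proof.
move=> e0 eta0 t0; pose S : 'M[R[i]]_q := a *m adjmx a; pose H : 'M[R[i]]_q := S + e%:S.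
have pS : psdmx S by exact: psd_mulJ.
have pH : psdmx H := psdD pS (psd_real (ltW e0)).
have ES : S = H - e%:S by rewrite /H addrK.
have [dH1 dH2 _] := psd_detD_ge pS (ltW e0); rewrite -/H in dH1 dH2 *.
have dH0 : 0 < Re (\det H) by apply: lt_le_trans dH2; exact: exprn_gt0.
have uH : H \in unitmx by rewrite unitmxE unitfE dH1 eq_complex /= eqxx andbT lt0r_neq0.
pose u : 'M[R[i]]_q := invmx H; have pu : psdmx u by exact: psd_inv.
have [_ _ Tu _] := psd_det pu.
have [d [pE dE]] : exists d, p = a + d /\ p - a = d by exists (p - a); rewrite subrKC.
(* tr (a^* u a) = tr (S u) = q - e tr u. *)
have Ta : T (adjmx a *m u *m a) <= q%:R.
  rewrite mxtrace_mulC mulmxA -/S ES mulmxBl (mulmxV uH) TB.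
  rewrite mul_scalar_mx TZ mxtrace1 /= lerBlDr.
  by rewrite (_ : Re q%:R = q%:R) ?lerDl ?mulr_ge0 ?(ltW e0)//; rewrite -(rmorph_nat (real_complex R)).
have Td : T (adjmx d *m u *m d) <= e^-1 * (\sum_i \sum_j normc (d i j) ^+ 2).
  (* This shows u <= 1 / e for Hermitian matrices: as S = H - e commutes with u = H^-1, the
     difference is a congruence of a positive semidefinite matrix. *)
  have E : (e^-1)%:S - u = adjmx u *m ((e^-1)%:C%C *: (S *m adjmx S + e%:C%C *: S)) *m u.
    rewrite pS.1 pu.1 (_ : S *m S + _ = H *m S); last by rewrite mulmxDl mul_scalar_mx.
    rewrite -scalemxAr -scalemxAl mulmxA (mulVmx uH) mul1mx ES mulmxBl (mulmxV uH).
    rewrite mul_scalar_mx scalerBr scalerA -rmorphM mulVf ?lt0r_neq0// scale1r.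
    by rewrite scalemx1.
  have pE' : psdmx ((e^-1)%:S - u).
    rewrite E; apply: psd_conj; apply: psdZ; first by rewrite invr_ge0 ltW.
    by apply: psdD; [exact: psd_mulJ|apply: psdZ => //; exact: ltW].
  have [_ _ h _] := psd_det (psd_conj d pE').
  by move: h; rewrite mulmxBr mulmxBl TB mul_mx_scalar -scalemxAl TZ T_normc subr_ge0.
pose M := adjmx p *m u *m p; have [M1 M2 M3 M4] := psd_det (psd_conj p pu).
have dM : Re (\det M) = normc (\det p) ^+ 2 / Re (\det H).
  rewrite !det_mulmx det_adjmx det_inv dH1 mulrC mulrA mulcJ -fmorphV -rmorphM //.
(* Since tr M >= 0, adding eta to exp (tr M - q) costs at most the factor 1 + eta exp q, which is at
   most exp (eta exp q). *)
have h1 : ln (Re (\det M) + eta) <= T M - q%:R + eta * expR q%:R.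
  have x0 : 0 < expR (T M - q%:R) + eta by rewrite addr_gt0// expR_gt0.
  apply: (@le_trans _ _ (ln (expR (T M - q%:R) + eta))).
    by rewrite ler_ln ?posrE ?lerD2r// ltr_wpDl.
  rewrite -[X in _ <= X]expRK ler_ln ?posrE ?expR_gt0// [leRHS]expRD.
  apply: (@le_trans _ _ (expR (T M - q%:R) * (1 + eta * expR q%:R))).
    rewrite mulrDr mulr1 lerD2l mulrCA -expRD subrK ler_peMr ?(ltW eta0)//.
    by rewrite -expR0 ler_expR.
  by rewrite ler_wpM2l ?expR_ge0// expR_ge1Dx.
have h2 : ln (normc (\det p) ^+ 2 + eta * e ^+ q) - ln (Re (\det H)) <= ln (Re (\det M) + eta).
  rewrite -ln_div ?posrE//; last by rewrite ltr_wpDl ?sqr_ge0// mulr_gt0// exprn_gt0.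
  rewrite ler_ln ?posrE.
  - by rewrite mulrDl dM lerD2l ler_pdivrMr// ler_wpM2l// ltW.
  - by rewrite divr_gt0// ltr_wpDl ?sqr_ge0// mulr_gt0// exprn_gt0.
  - by rewrite ltr_wpDl.
have := T_young a d pu t0; rewrite -pE -/M => h3.
have h4 : (1 + t) * T (adjmx a *m u *m a) <= (1 + t) * q%:R by rewrite ler_wpM2l//; lra.
have ti : 0 < t^-1 by rewrite invr_gt0.
have h5 : (1 + t^-1) * T (adjmx d *m u *m d) <= (1 + t^-1) / e * (\sum_i \sum_j normc (d i j) ^+ 2).
  by rewrite -mulrA ler_wpM2l//; lra.
move: h1 h2 h3 h4 h5; rewrite dE [(1 + t) * q%:R]mulrDl mul1r.
move: (ln _ - ln _) (ln (_ + eta)) (T M) (_ / e * _) (eta * expR _) => v1 v2 v3 v4 v5.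
move: (_ * T _) ((1 + t^-1) * T _) (t * q%:R) => v6 v7 v8; lra.
Qed.

End psd.

(** * The innovations of an outer factor *)

Section circle_space.
Context {R : realType}.
Variable q : nat.
Notation lmu := (@lebesgue_measure R).
Notation arc := (@circle_arc R : set (measurableTypeR R)).
Notation CI := (cintegral lmu arc).

Lemma ic_gt0 : 0 < (2 * pi)^-1 :> R.
Proof. by rewrite invr_gt0 mulr_gt0 ?pi_gt0. Qed.

Definition circ := @L2H _ (measurableTypeR R) R q lmu arc marc _ ic_gt0.
Notation fn := (@L2fun _ (measurableTypeR R) R q lmu arc marc).
(** Total, with default 0, so that square-integrability is asked for only where [cvecE] is used. *)
Definition cvec (f : R -> 'rV[R[i]]_q) : circ :=
  if pselect (f \in @isL2 _ (measurableTypeR R) R q lmu arc marc) is left h then MkL2 h else 0.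

Lemma cvecE (f : R -> 'rV[R[i]]_q) : (forall j, inL2 lmu arc (fun x => f x 0 j)) -> fn (cvec f) = f.
Proof. by move=> hf; rewrite /cvec; case: pselect => // n; case: n; apply/isL2P. Qed.

Definition fe (x : circ) (t : R) (j : 'I_q) : R[i] := fn x t 0 j.

Lemma fnD (x y : circ) t j : fe (x + y) t j = fe x t j + fe y t j.
Proof. exact: L2funD. Qed.
Lemma fnZ a (x : circ) t j : fe (a *: x) t j = a * fe x t j.
Proof. exact: L2funZ. Qed.
Lemma fnB (x y : circ) t j : fe (x - y) t j = fe x t j - fe y t j.
Proof. exact: L2funB. Qed.
Lemma fn_sum I (r : seq I) (P : pred I) (F : I -> circ) t j :
  fe (\sum_(i <- r | P i) F i) t j = \sum_(i <- r | P i) fe (F i) t j.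
Proof.
elim/big_rec2 : _ => [|i y1 y2 _ <-]; first by rewrite /fe [LHS]mxE.
exact: fnD.
Qed.

Lemma fn_L2 (x : circ) j : inL2 lmu arc (fun t => fe x t j).
Proof. exact: L2_inL2. Qed.

Lemma fn_ip (x y : circ) : ip x y =
  ((2 * pi)^-1)%:C%C * \sum_j CI (fun t => fe x t j * (fe y t j)^*).
Proof. by []. Qed.

Lemma fn_nrm2 (x : circ) : nrm2 x =
  (2 * pi)^-1 * \sum_j RI lmu arc (fun t => normc (fe x t j) ^+ 2).
Proof. exact: Re_L2ip. Qed.

Lemma fn_null (x : circ) : nrm x = 0 <->
  forall j, {ae lmu, forall t : R, arc t -> fe x t j = 0}.
Proof.
split=> [/nrm_eq0|h].
  rewrite fn_nrm2 => /eqP; rewrite mulf_eq0 gt_eqF ?ic_gt0//= psumr_eq0 => [/allP h j|j _]; last first.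
    by apply: RI_ge0 => t _; exact: sqr_ge0.
  have /eqP := h j (mem_index_enum _).
  move/(RI_eq0_ae marc (inL2_rint (fn_L2 x j))) => /(_ (fun t _ => sqr_ge0 _)).
  apply: ae_sub => t ht /ht /eqP; rewrite sqrf_eq0 => /eqP; exact: normc_eq0.
apply/nrm_eq0; rewrite fn_nrm2 big1 ?mulr0// => j _.
rewrite (RI_ae marc (g := fun=> 0)) ?RI_arc_cst ?mul0r//.
- by apply: measurable_funX; apply: measurable_normc; case: (fn_L2 x j).
- by apply: ae_sub (h j) => t ht /ht ->; rewrite normc0 expr0n.
Qed.

Lemma fn_eq (x y : circ) : nrm (x - y) = 0 <->
  forall j, {ae lmu, forall t : R, arc t -> fe x t j = fe y t j}.
Proof.
split=> [/fn_null h j|h].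
  by apply: ae_sub (h j) => t ht /ht /eqP; rewrite fnB subr_eq0 => /eqP.
by apply/fn_null => j; apply: ae_sub (h j) => t ht /ht; rewrite fnB => ->; rewrite subrr.
Qed.

Lemma expi_L2 (k : int) : inL2 lmu arc (fun x => expi (k%:~R * x)).
Proof.
have := inL2_bmul marc (cmeas_expi k%:~R arc) (M := 1) _ (inL2_cst marc 1 arc_lty).
by under eq_fun do rewrite mulr1; apply => x _; rewrite normc_expi.
Qed.

Definition expv (p : int * 'I_q) : circ := cvec (fun x => \row_j (expi (p.1%:~R * x) *+ (j == p.2))).

Lemma expvE p t j : fe (expv p) t j = expi (p.1%:~R * t) *+ (j == p.2).
Proof.
rewrite /fe cvecE ?mxE// => i; under eq_fun do rewrite mxE.
by case: eqP => _; [exact: expi_L2|exact: inL20].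
Qed.

Lemma ip_expv (x : circ) (k : int) (j : 'I_q) : ip x (expv (k, j)) =
  ((2 * pi)^-1)%:C%C * CI (fun t => expi ((- k)%:~R * t) * fe x t j).
Proof.
rewrite fn_ip (bigD1 j)//= big1 ?addr0 => [|i ij].
  congr (_ * _); apply: eq_CI => t _.
  by rewrite expvE /= eqxx mulr1n -expiN mulrC rmorphN mulNr.
by rewrite -[RHS](CI_0 lmu arc); apply: eq_CI => t _; rewrite expvE /= (negbTE ij) mulr0n conjC0 mulr0.
Qed.

Lemma expv_orthonormal k l i j : ip (expv (k, i)) (expv (l, j)) = ((k == l) && (i == j))%:R.
Proof.
rewrite ip_expv; under eq_CI do rewrite expvE /=.
have pi2 : (2 * pi)%:C%C != 0 :> R[i].
  by rewrite eq_complex /= eqxx andbT mulf_neq0// lt0r_neq0// pi_gt0.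
case: (eqVneq i j) => _; last first.
  rewrite andbF /= (_ : (fun t => _) = fun=> 0) ?CI_0 ?mulr0//.
  by apply/funext => t; rewrite mulr0n mulr0.
rewrite andbT.
under eq_CI do rewrite mulr1n -expiD -mulrDl -rmorphD /=.
rewrite CI_expi addrC subr_eq0; case: eqP => _; last by rewrite mulr0.
by rewrite -rmorphM /= mulVf// mulf_neq0// lt0r_neq0// pi_gt0.
Qed.

Lemma expv_complete (x : circ) : (forall k j, ip x (expv (k, j)) = 0) -> nrm x = 0.
Proof.
move=> h; apply/fn_null => j; apply: fourier_unique.
  by apply: inL2_L1; [exact: marc|exact: arc_lty|exact: fn_L2].
move=> k; have := h (- k) j; rewrite ip_expv opprK => /eqP.
by rewrite mulf_eq0 eq_complex /= eqxx andbT gt_eqF ?ic_gt0//= => /eqP.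
Qed.

(** The difference of x and its projection onto the exponentials of K has all Fourier coefficients
    0, hence is null. *)
Lemma exp_support (K : int * 'I_q -> Prop) (x : circ) :
  (forall p, ~ K p -> ip x (expv p) = 0) -> clspan expv K x.
Proof.
move=> h; have cS := csub_clspan expv K.
apply: (csub_null cS (pj_in cS x)).
apply: expv_complete => k j; have [Kp|nKp] := pselect (K (k, j)).
  by apply: pj_orth; exact: clspan_gen.
rewrite ipBl h// (_ : ip (pj cS x) _ = 0) ?subrr//.
apply: (clspan_sub (csub_orth _) _ (pj_in cS x)) => -[k' j'] Kp' /=.
apply: etrans (expv_orthonormal _ _ _ _) _; case: andP => // -[/eqP e1 /eqP e2]; case: nKp; by rewrite -e1 -e2.
Qed.

End circle_space.

Section patch.
Context {R : realType} (q : nat).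
Notation arc := (@circle_arc R : set (measurableTypeR R)).

(** Turns an identity B = G valid almost everywhere into one valid everywhere, for a modified but
    still measurable F. The test is the vanishing of a sum of squares, which makes the exceptional
    set measurable. *)
Lemma measurable_patch (F B : R -> 'M[R[i]]_q) (G N : 'M[R[i]]_q) :
  (forall i j, cmeasurable arc (fun x => F x i j)) ->
  (forall i j, cmeasurable arc (fun x => B x i j)) ->
  exists F' : R -> 'M[R[i]]_q, [/\ forall i j, cmeasurable arc (fun x => F' x i j),
    forall x, B x = G -> F' x = F x & forall x, B x <> G -> F' x = N].
Proof.
move=> mF mB; pose bad x : R := \sum_i \sum_j normc (B x i j - G i j) ^+ 2.
have s0 x i : 0 <= \sum_j normc (B x i j - G i j) ^+ 2.
  by apply: sumr_ge0 => j _; exact: sqr_ge0.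
exists (fun x => if bad x == 0 then F x else N); split.
- move=> i j; rewrite (_ : (fun x => _) = fun x => if bad x == 0 then F x i j else N i j); last first.
    by apply/funext => x; case: ifP.
  apply: cmeas_if; [exact: marc| |exact: mF|exact: cmeas_cst].
  apply: measurable_fun_eqr; last exact: measurable_cst.
  apply: measurable_sum => k; apply: measurable_sum => l; apply: measurable_funX.
  by apply: measurable_normc; apply: cmeasB => //; exact: cmeas_cst.
- move=> x Gx; case: ifPn => //; rewrite /bad Gx.
  by rewrite big1 ?eqxx// => i _; rewrite big1// => j _; rewrite subrr normc0 expr0n.
- move=> x nG; case: ifPn => //; rewrite psumr_eq0// => /allP hb; case: nG; apply/matrixP => i j.
  have /implyP/(_ isT) := hb i (mem_index_enum _).
  rewrite psumr_eq0 => [/allP/(_ j (mem_index_enum _))|k _]; last exact: sqr_ge0.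
  by rewrite sqrf_eq0 => /eqP/normc_eq0/eqP; rewrite subr_eq0 => /eqP.
Qed.

End patch.

(** * Jensen's inequality for square-integrable analytic matrices *)

Section jensen_H2.
Context {R : realType}.
Notation lmu := (@lebesgue_measure R).
Notation arc := (@circle_arc R : set (measurableTypeR R)).
Notation CI := (cintegral lmu arc).

(** Only positive frequencies are left in f; the factor 'X records this absence of a constant term,
    which later gives the approximating matrices the value 1 at 0. *)
Lemma poly_approx (f : R -> R[i]) (e : R) : inL2 lmu arc f ->
  (forall k : nat, CI (fun x => expi (k%:R * x) * f x) = 0) -> 0 < e ->
  exists r : {poly R[i]}, RI lmu arc (fun x => normc ((r * 'X).[expi x] - f x) ^+ 2) < e.
Proof.
move=> fL f0 e0; pose v : circ 1 := cvec (fun x => \row_(j < 1) f x).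
have vE t j : fe v t j = f t.
  by rewrite /fe cvecE ?mxE// => i; under eq_fun do rewrite mxE.
have cl : clspan (@expv R 1) (fun p => 0 < p.1) v.
  apply: exp_support => -[k j] k0; rewrite ip_expv.
  have {}k0 : k <= 0 by rewrite leNgt; exact/negP.
  have -> : - k = `|k|%N%:Z by rewrite -(ler0_norm k0).
  by under eq_CI do rewrite vE; rewrite f0 mulr0.
have : 0 < Num.sqrt (e * (2 * pi)^-1) by rewrite sqrtr_gt0 mulr_gt0// ic_gt0.
case/cl => s ls; rewrite nrm_lt2 ?sqrtr_ge0// sqr_sqrtr; last by rewrite mulr_ge0 ?(ltW e0)// ltW// ic_gt0.
have [r hr] : exists r : {poly R[i]}, forall t, fe s t 0 = (r * 'X).[expi t].
  elim: ls => [|a [k j] w k0 _ [r hr]].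
    by exists 0 => t; rewrite mul0r horner0 /fe [LHS]mxE.
  exists (a *: 'X^(`|k|%N.-1) + r) => t.
  rewrite fnD fnZ expvE /= ord1 eqxx mulr1n hr mulrDl hornerD; congr (_ + _).
  rewrite -scalerAl hornerZ -exprSr hornerXn; congr (_ * _).
  have kn : (0 < `|k|)%N by rewrite absz_gt0 gt_eqF.
  by rewrite prednK// -expi_nat -[(`|k|%N)%:R]/((`|k|%N%:Z)%:~R) gez0_abs// ltW.
rewrite fn_nrm2 big_ord_recl big_ord0 addr0 mulrC ltr_pM2r ?ic_gt0// => h.
exists r; apply: le_lt_trans h; rewrite le_eqVlt; apply/orP; left; apply/eqP.
by apply: eq_RI => t _; rewrite fnB vE hr -normcN opprB.
Qed.

Variable q : nat.
Variable a : R -> 'M[R[i]]_q.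
Hypothesis a2 : forall i j, inL2 lmu arc (fun x => a x i j).
Hypothesis a0 : forall i j (k : nat), CI (fun x => expi (k%:R * x) * (a x i j - (i == j)%:R)) = 0.
Notation gp e := (fun x => Re (\det (a x *m adjmx (a x) + ((e%:C%C)%:M : 'M[R[i]]_q)))).

Let cm i j : cmeasurable arc (fun x => a x i j).
Proof. by case: (a2 i j). Qed.

Let meas_gp (e : R) : @measurable_fun _ _ (measurableTypeR R) R arc (gp e).
Proof.
suff [] : cmeasurable arc (fun x => \det (a x *m adjmx (a x) + ((e%:C%C)%:M : 'M[R[i]]_q))) by [].
apply: cmeas_det => i j; under eq_fun do rewrite mxE.
apply: cmeasD; last exact: cmeas_cst.
by apply: cmeas_mulmx => //; exact: cmeas_adjmx.
Qed.

Let S2 x : R := \sum_i \sum_j normc (a x i j) ^+ 2.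

Let S2_ge0 x : 0 <= S2 x.
Proof. by apply: sumr_ge0 => i _; apply: sumr_ge0 => j _; exact: sqr_ge0. Qed.

Let rint_S2 : rint lmu arc S2.
Proof. by apply: (rint_sum marc) => i _; apply: (rint_sum marc) => j _; exact: inL2_rint (a2 i j). Qed.

Let gp_gt0 (e x : R) : 0 < e -> 0 < gp e x.
Proof.
move=> e0; have [_ h _] := psd_detD_ge (psd_mulJ (a x)) (ltW e0).
by apply: lt_le_trans h; exact: exprn_gt0.
Qed.

Let ln_gp_le (e x : R) : 0 < e -> ln (gp e x) <= S2 x + e * q%:R - q%:R.
Proof.
move=> e0.
have [_ _ _] := psd_det (psdD (psd_mulJ (a x)) (psd_real q (ltW e0))).
rewrite TD T_normcJ -/(S2 x).
have -> : Re (\tr ((e%:C%C)%:M : 'M[R[i]]_q)) = e * q%:R.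
  by rewrite mxtrace_scalar -(rmorphMn (real_complex R)) /= mulr_natr.
by move=> h; rewrite -ler_expR lnK// posrE gp_gt0.
Qed.

Let ln_gp_ge (e x : R) : 0 < e -> ln (e ^+ q) <= ln (gp e x).
Proof.
move=> e0; have [_ h _] := psd_detD_ge (psd_mulJ (a x)) (ltW e0).
by rewrite ler_ln ?posrE ?gp_gt0// exprn_gt0.
Qed.

Let rint_gp (e : R) : 0 < e -> rint lmu arc (fun x => ln (gp e x)).
Proof.
move=> e0; apply: (rint_le marc (g := fun x => S2 x + (e * q%:R + `|ln (e ^+ q)|))).
- by apply: measurableT_comp; [exact: measurable_ln|exact: meas_gp].
- move=> x _; have h1 := ln_gp_le x e0; have h2 := ln_gp_ge x e0; have h3 := S2_ge0 x.
  have h4 : 0 <= q%:R :> R by [].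
  have h5 : 0 <= e * q%:R by rewrite mulr_ge0// ltW.
  have h6 := ler_norm (- ln (e ^+ q)); have h7 := ler_norm (ln (e ^+ q)); rewrite normrN in h6.
  have key (u1 u2 u3 u4 u5 u6 : R) : u1 <= u2 + u3 - u4 -> u5 <= u1 -> 0 <= u2 -> 0 <= u4 ->
      0 <= u3 -> - u5 <= u6 -> u5 <= u6 -> `|u1| <= u2 + (u3 + u6).
    by move=> *; rewrite ler_norml; apply/andP; split; lra.
  exact: key h1 h2 h3 h4 h5 h6 h7.
- by apply: (rintD marc rint_S2); exact: rint_arc_cst.
Qed.

(** A polynomial matrix p with p(0) = 1 approximates a within dl in each entry. Jensen's inequality
    holds for det p, regularised by eta e^q, and [logdet_young] compares its logarithm with that of
    [gp e]. *)
Let jensen_gp_bound (e t eta dl : R) : 0 < e -> 0 < t -> 0 < eta -> 0 < dl ->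
  - RI lmu arc (fun x => ln (gp e x)) <=
  (t * q%:R + eta * expR q%:R) * (2 * pi) + (1 + t^-1) / e * (q%:R * (q%:R * dl)).
Proof.
move=> e0 t0 eta0 dl0.
have [r hr] : {r : 'I_q -> 'I_q -> {poly R[i]} & forall i j,
    RI lmu arc (fun x => normc ((r i j * 'X).[expi x] - (a x i j - (i == j)%:R)) ^+ 2) < dl}.
  have h i : {r : 'I_q -> {poly R[i]} & forall j,
    RI lmu arc (fun x => normc ((r j * 'X).[expi x] - (a x i j - (i == j)%:R)) ^+ 2) < dl}.
    apply: (@choice _ _ (fun (j : 'I_q) (r : {poly R[i]}) =>
      RI lmu arc (fun x => normc ((r * 'X).[expi x] - (a x i j - (i == j)%:R)) ^+ 2) < dl)) => j.
    apply: poly_approx => //; first by apply: (inL2B marc (a2 i j)); exact: (inL2_cst marc _ arc_lty).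
  by exists (fun i => projT1 (h i)) => i j; exact: (projT2 (h i)).
pose PP : 'M[{poly R[i]}]_q := \matrix_(i, j) ((i == j)%:R%:P + r i j * 'X).
pose p x : 'M[R[i]]_q := map_mx (horner_eval (expi x)) PP.
have dp x : \det (p x) = (\det PP).[expi x] by rewrite /p det_map_mx.
have PP0 : (\det PP).[0] = 1.
  rewrite -[LHS]/(horner_eval 0 (\det PP)) -det_map_mx -(det1 _ q); congr (\det _).
  apply/matrixP => i j; rewrite !mxE; change (((i == j)%:R%:P + r i j * 'X).[0] = (i == j)%:R).
  rewrite hornerD hornerC hornerM hornerX mulr0 addr0.
  by case: eqP.
have eta1 : 0 < eta * e ^+ q by rewrite mulr_gt0// exprn_gt0.
have [J1 J2] := jensen_poly PP0 eta1.
have pa x i j : (p x - a x) i j = (r i j * 'X).[expi x] - (a x i j - (i == j)%:R).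
  by rewrite !mxE /horner_eval hornerD hornerC; ring.
pose Q x : R := \sum_i \sum_j normc ((p x - a x) i j) ^+ 2.
have Qij i j : rint lmu arc (fun x => normc ((p x - a x) i j) ^+ 2).
  apply: inL2_rint; under eq_fun do rewrite pa.
  apply: (inL2B marc); last by apply: (inL2B marc (a2 i j)); exact: (inL2_cst marc _ arc_lty).
  under eq_fun do rewrite horner_coef.
  apply: (inL2_sum marc) => k _; apply: (inL2Z marc).
  by under eq_fun do rewrite -expi_nat -[k%:R]/((k%:Z)%:~R); exact: expi_L2.
have IQ : rint lmu arc Q by apply: (rint_sum marc) => i _; apply: (rint_sum marc).
have RQ : RI lmu arc Q <= q%:R * (q%:R * dl).
  rewrite /Q (RI_sum marc); last by move=> i _; apply: (rint_sum marc).
  rewrite [leRHS]mulr_natl -[X in _ *+ X](card_ord q) -sumr_const; apply: ler_sum => i _.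
  rewrite (RI_sum marc)// [leRHS]mulr_natl -[X in _ *+ X](card_ord q) -sumr_const.
  apply: ler_sum => j _; apply: ltW; apply: le_lt_trans (hr i j).
  by rewrite le_eqVlt; apply/orP; left; apply/eqP; apply: eq_RI => x _; rewrite pa.
have := RI_le marc (rintB marc J1 (rint_gp e0)) (g := fun x => (t * q%:R + eta * expR q%:R) + (1 + t^-1) / e * Q x) _ _.
rewrite (RI_B marc J1 (rint_gp e0)) (RI_D marc); last 2 first.
- exact: rint_arc_cst.
- exact: (rintZ marc).
rewrite RI_arc_cst (RI_Z marc)// => h.
have k0 : 0 <= (1 + t^-1) / e by rewrite divr_ge0 ?(ltW e0)// addr_ge0// invr_ge0 ltW.
have h2 : (1 + t^-1) / e * RI lmu arc Q <= (1 + t^-1) / e * (q%:R * (q%:R * dl)) by rewrite ler_wpM2l.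
have h3 := le_trans _ (le_trans (h _ _) (lerD (lexx _) h2)).
apply: h3.
- by rewrite lerBrDr addNr.
- by apply: (rintD marc); [exact: rint_arc_cst|exact: (rintZ marc)].
- move=> x _; have := logdet_young (a x) (p x) e0 eta0 t0; rewrite dp -/(Q x).
  by rewrite addrAC.
Qed.

Let jensen_gp (e : R) : 0 < e -> 0 <= RI lmu arc (fun x => ln (gp e x)).
Proof.
move=> e0; rewrite -oppr_le0; apply/ler_addgt0Pr => k k0; rewrite add0r.
have pi0 : 0 < 2 * pi :> R by rewrite mulr_gt0 ?pi_gt0.
have q0 : 0 <= q%:R :> R by [].
have pn : pi != 0 :> R by rewrite lt0r_neq0// pi_gt0.
have pn2 : 2 * pi != 0 :> R by exact: lt0r_neq0.
have q1 : q%:R + 1 != 0 :> R by rewrite lt0r_neq0//; lra.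
have q21 : q%:R ^+ 2 + 1 != 0 :> R by rewrite lt0r_neq0// ltr_wpDl// sqr_ge0.
(* Each of the three error terms is to be at most k / 3. dl is chosen last, since its factor c
   contains 1 / t. *)
pose t := k / (3 * (2 * pi) * (q%:R + 1)).
pose eta := k / (3 * (2 * pi) * expR q%:R).
pose c := (1 + t^-1) / e.
have t0 : 0 < t by rewrite divr_gt0// mulr_gt0//; lra.
have eta0 : 0 < eta by rewrite divr_gt0// mulr_gt0// ?expR_gt0//; lra.
have c0 : 0 < c by rewrite divr_gt0// addr_gt0// invr_gt0.
pose dl := k / (3 * c * (q%:R ^+ 2 + 1)).
have q2 : 0 <= q%:R ^+ 2 :> R by exact: sqr_ge0.
have dl0 : 0 < dl by rewrite divr_gt0// mulr_gt0//; lra.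
apply: le_trans (jensen_gp_bound e0 t0 eta0 dl0) _.
have h1 : t * q%:R * (2 * pi) <= k / 3.
  rewrite (_ : k / 3 = t * (q%:R + 1) * (2 * pi)); last first.
    rewrite /t; move: (2 * pi) pn2 => P Pn; by field; rewrite ?q1 ?Pn.
  by rewrite ler_wpM2r ?(ltW pi0)// ler_wpM2l ?(ltW t0)//; lra.
have h2 : eta * expR q%:R * (2 * pi) = k / 3.
  have en : expR q%:R != 0 :> R by rewrite lt0r_neq0// expR_gt0.
  by rewrite /eta; move: (2 * pi) pn2 (expR _) en => P Pn E En; field; rewrite ?En ?Pn.
have h3 : c * (q%:R * (q%:R * dl)) <= k / 3.
  rewrite (_ : k / 3 = c * ((q%:R ^+ 2 + 1) * dl)); last first.
    by rewrite /dl; field; rewrite (lt0r_neq0 c0) ?q21.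
  by rewrite ler_wpM2l ?(ltW c0)// mulrA -expr2 ler_wpM2r ?(ltW dl0)//; lra.
by rewrite -/c mulrDl h2; move: h1 h3; move: (t * _ * _) (c * _) => *; lra.
Qed.

(** The regularised inequalities pass to the limit e = 0: ln (gp e) lies between ln |det a|^2,
    integrable by hypothesis, and the integrable bound of [ln_gp_le]. *)
Theorem jensen_H2 : {ae lmu, forall x : R, arc x -> \det (a x) != 0} ->
  rint lmu arc (fun x => ln (normc (\det (a x)) ^+ 2)) ->
  0 <= RI lmu arc (fun x => ln (normc (\det (a x)) ^+ 2)).
Proof.
move=> d0 Id.
pose ep n : R := n.+1%:R^-1.
have ep0 n : 0 < ep n by rewrite invr_gt0.
have mdet : cmeasurable arc (fun x => \det (a x)) by exact: cmeas_det.
have mlog n : @measurable_fun _ _ (measurableTypeR R) R arc (fun x => ln (gp (ep n) x)).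
  exact: rint_meas (rint_gp (ep0 n)).
(* [RI_dct] asks for its majorant at every point; where det a vanishes ln (gp e) tends to -oo, hence
   the value 0 there. *)
pose F n x : R := if \det (a x) == 0 then 0 else ln (gp (ep n) x).
have mF n : @measurable_fun _ _ (measurableTypeR R) R arc (F n).
  apply: measurable_fun_if => //; [exact: marc|exact: measurable_ceq0|].
  by apply: measurable_funS (mlog n) => //; exact: marc.
have F0 n : 0 <= RI lmu arc (F n).
  rewrite (RI_ae marc (mF n) (mlog n)) ?jensen_gp//.
  by apply: ae_sub d0 => x hx /hx; rewrite /F => /negbTE ->.
have detE x : Re (\det (a x *m adjmx (a x))) = normc (\det (a x)) ^+ 2.
  by rewrite det_mulmx det_adjmx mulcJ.
have gp_ge n x : normc (\det (a x)) ^+ 2 <= gp (ep n) x.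
  by rewrite -detE; have [] := psd_detD_ge (psd_mulJ (a x)) (ltW (ep0 n)).
have gp_cvg x : gp (ep n) x @[n --> \oo] --> normc (\det (a x)) ^+ 2.
  have [l [l0 hd _]] := psd_det_tr (psd_mulJ (a x)).
  have -> : normc (\det (a x)) ^+ 2 = \prod_i l i.
    have := hd 0; rewrite -detE (_ : (_%:C%C)%:M = 0) ?raddf0// addr0 => -> /=.
    by apply: eq_bigr => i _; rewrite addr0.
  under eq_fun do rewrite hd /=.
  have key (s : seq 'I_q) : (\prod_(i <- s) (l i + ep n)) @[n --> \oo] --> \prod_(i <- s) l i.
    elim: s => [|i s ih].
      rewrite big_nil (_ : (fun n => _) = fun=> 1); first exact: cvg_cst.
      by apply/funext => n; rewrite big_nil.
    rewrite big_cons (_ : (fun n => _) = fun n => (l i + ep n) * \prod_(i <- s) (l i + ep n)).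
      apply: cvgM => //; rewrite -[X in _ --> X]addr0.
      by apply: cvgD; [exact: cvg_cst|exact: cvg_harmonic].
    by apply/funext => n; rewrite big_cons.
  exact: key.
have gp1 x : \det (a x) != 0 -> 0 < normc (\det (a x)) ^+ 2.
  move=> dx; rewrite exprn_gt0// lt_neqAle normc_ge0 andbT eq_sym.
  by apply: contra_neq dx; exact: normc_eq0.
have ep1 n : ep n <= 1 by rewrite /ep invf_le1// ler1n.
have [_ cF] : rint lmu arc (fun x => ln (normc (\det (a x)) ^+ 2)) /\
    RI lmu arc (F n) @[n --> \oo] --> RI lmu arc (fun x => ln (normc (\det (a x)) ^+ 2)).
  apply: (RI_dct marc (g := fun x => `|ln (normc (\det (a x)) ^+ 2)| + S2 x)) => //.
  - exact: rint_meas Id.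
  - apply: ae_sub d0 => x hx /hx dx; rewrite /F (negbTE dx).
    apply: (cvg_comp (fun n => gp (ep n) x) (@ln R) (gp_cvg x)).
    exact: (@continuous_ln R _ (gp1 x dx)).
  - exact: (rintD marc (rint_norm Id) rint_S2).
  - move=> n x _; rewrite /F; case: eqP => [_|/eqP dx].
      by rewrite normr0 addr_ge0.
    have h1 : ln (normc (\det (a x)) ^+ 2) <= ln (gp (ep n) x).
      by rewrite ler_ln ?posrE ?gp_gt0// (gp1 x dx).
    have h2 := ln_gp_le x (ep0 n).
    have h3 : ep n * q%:R <= q%:R by rewrite ler_piMl.
    have h4 := S2_ge0 x; have h5 := ler_norm (- ln (normc (\det (a x)) ^+ 2)); rewrite normrN in h5.
    have key (u1 u2 u3 u4 u5 u6 : R) : u1 <= u2 -> u2 <= u3 + u4 - u5 -> u4 <= u5 -> 0 <= u3 ->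
      - u1 <= u6 -> 0 <= u6 -> `|u2| <= u6 + u3.
      by move=> *; rewrite ler_norml; apply/andP; split; lra.
    exact: key h1 h2 h3 h4 h5 _.
rewrite -(cvg_lim _ cF)//.
by apply: limr_ge; [apply/cvg_ex; eexists; exact: cF|exact: nearW].
Qed.

End jensen_H2.

(** * The bilateral shift *)

Section shift.
Context {R : realType}.
Variable q : nat.
Notation lmu := (@lebesgue_measure R).
Notation arc := (@circle_arc R : set (measurableTypeR R)).
Implicit Types v w : @circ R q.

Definition shift (k : int) v : circ q := cvec (fun x => \row_j (expi (k%:~R * x) * fe v x j)).

Lemma shiftE k v t j : fe (shift k v) t j = expi (k%:~R * t) * fe v t j.
Proof.
rewrite /fe cvecE ?mxE// => i; under eq_fun do rewrite mxE.
apply: (inL2_bmul marc _ (M := 1)) (fn_L2 v i); last by move=> x _; rewrite normc_expi.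
exact: cmeas_expi.
Qed.

Lemma circ_ext v w : (forall t j, fe v t j = fe w t j) -> v = w.
Proof. by move=> h; apply: val_inj; apply/funext => t; apply/matrixP => i j; rewrite ord1; exact: h. Qed.

Lemma shift_lin k a v w : shift k (a *: v + w) = a *: shift k v + shift k w.
Proof. by apply: circ_ext => t j; rewrite fnD fnZ !shiftE fnD fnZ mulrDr mulrCA. Qed.

Lemma shift0 k : shift k 0 = 0.
Proof. by apply: circ_ext => t j; rewrite shiftE /fe [_ 0 _]mxE mulr0. Qed.

Lemma shiftB k v w : shift k (v - w) = shift k v - shift k w.
Proof. by apply: circ_ext => t j; rewrite fnB !shiftE fnB mulrBr. Qed.

Lemma shift_nrm k v : nrm (shift k v) = nrm v.
Proof.
rewrite /nrm !fn_nrm2; congr (Num.sqrt (_ * _)); apply: eq_bigr => j _; apply: eq_RI => t _.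
by rewrite shiftE normcM normc_expi mul1r.
Qed.

Lemma csub_shift k (S : circ q -> Prop) : csub S -> csub (fun v => S (shift k v)).
Proof.
move=> cS; split; first by rewrite shift0; exact: csub0 cS.
  by move=> a x y Sx Sy; rewrite shift_lin; exact: csub_lin.
move=> x hx; apply: (csub_closed cS) => e e0; have [s Ss hs] := hx e e0.
by exists (shift k s); [exact: Ss|rewrite -shiftB shift_nrm].
Qed.

Lemma shift_adj k v w : ip v (shift (- k) w) = ip (shift k v) w.
Proof.
rewrite !fn_ip; congr (_ * _); apply: eq_bigr => j _; apply: eq_CI => x _.
by rewrite !shiftE rmorphM /= -expiN mulrNz mulNr opprK mulrCA mulrA.
Qed.

End shift.

Section innovation.
Context {R : realType}.
Variables (q : nat) (h : R -> 'M[R[i]]_q) (C : 'M[R[i]]_q).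
Notation lmu := (@lebesgue_measure R).
Notation arc := (@circle_arc R : set (measurableTypeR R)).
Notation CI := (cintegral lmu arc).
Notation c0 := (((2 * pi)^-1 : R)%:C%C).
Hypothesis h2 : forall i j, inL2 lmu arc (fun x => h x i j).

Definition hvec (p : int * 'I_q) : circ q :=
  cvec (fun x => \row_j (expi (- (p.1%:~R * x)) * h x p.2 j)).

Lemma hvecE p t j : fe (hvec p) t j = expi (- (p.1%:~R * t)) * h t p.2 j.
Proof.
rewrite /fe cvecE ?mxE// => i; under eq_fun do rewrite mxE.
apply: (inL2_bmul marc _ (M := 1)) (h2 p.2 i); last by move=> x _; rewrite normc_expi.
exact: cmeas_expiN.
Qed.

Hypothesis hF : forall i j (k : nat), CI (fun x => expi (k%:R * x) * h x i j) =
  if k == 0%N then (2 * pi)%:C%C * C i j else 0.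
Lemma shift_hvec k p : shift k (hvec p) = hvec (p.1 - k, p.2).
Proof.
apply: circ_ext => t j; rewrite shiftE !hvecE mulrA -expiD; congr (expi _ * _) => /=.
by rewrite rmorphB /=; ring.
Qed.

Let pi2 : 0 < 2 * pi :> R. Proof. by rewrite mulr_gt0 ?pi_gt0. Qed.
Let c0pi : c0 * (2 * pi)%:C%C = 1.
Proof. by rewrite -rmorphM /= mulVf ?lt0r_neq0. Qed.

Lemma ip_hvec_expv (m k : int) i j : m <= - k -> ip (hvec (m, i)) (expv (k, j)) =
  if m == - k then C i j else 0.
Proof.
move=> mk; have mk0 : m + k <= 0 by rewrite -lerBrDr sub0r.
rewrite ip_expv [CI _](_ : _ = CI (fun x => expi ((absz (m + k))%:R * x) * h x i j)); last first.
  apply: eq_CI => x _; rewrite hvecE /= mulrA -expiD; congr (expi _ * _).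
  rewrite -[((absz (m + k)))%:R]/(((absz (m + k))%:Z)%:~R).
  by rewrite (_ : (absz (m + k))%:Z = - (m + k)) ?rmorphN ?rmorphD /=; [ring|rewrite -(ler0_norm mk0)].
rewrite hF absz_eq0 addr_eq0; case: ifP => _; last by rewrite mulr0.
by rewrite mulrA c0pi mul1r.
Qed.

Hypothesis Cunit : C \in unitmx.
Hypothesis hdet : {ae lmu, forall x : R, arc x -> \det (h x) != 0}.
Hypothesis hlog : rint lmu arc (fun x => ln (normc (\det (h x)) ^+ 2)).
Hypothesis houter : RI lmu arc (fun x => ln (normc (\det (h x)) ^+ 2)) =
  (2 * pi) * ln (normc (\det C) ^+ 2).

Let S := clspan hvec (fun p => p.1 < 0).
Let cS : csub S := csub_clspan hvec (fun p => p.1 < 0).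
Let E i : circ q := hvec (0, i) - pj cS (hvec (0, i)).

Let ip_S_expv s j : S s -> ip s (expv (0, j)) = 0.
Proof.
move=> Ss; apply: (clspan_sub (csub_orth _) _ Ss) => -[m i] m0.
have {}m0 : m < 0 := m0.
by rewrite ip_hvec_expv oppr0 ?lt_eqF// ltW.
Qed.

(** h has nonnegative frequencies with constant term C, so X_m with m < 0 has positive frequencies
    only: subtracting the projection onto the past does not affect the constant term. *)
Let ip_E_expv i j : ip (E i) (expv (0, j)) = C i j.
Proof.
by rewrite /E ipBl (ip_S_expv _ (pj_in cS _)) subr0 ip_hvec_expv ?oppr0 ?eqxx.
Qed.

Let shift_S k s : 0 <= k -> S s -> S (shift k s).
Proof.
move=> k0 Ss; apply: (clspan_sub (csub_shift k cS) _ Ss) => -[m i] m0.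
by rewrite shift_hvec; apply: clspan_gen => /=; apply: le_lt_trans m0; rewrite lerBlDr lerDl.
Qed.

Let shift_E k i : 0 < k -> S (shift k (E i)).
Proof.
move=> k0; rewrite /E shiftB; apply: (csubB cS).
  by rewrite shift_hvec; apply: clspan_gen; rewrite /= sub0r oppr_lt0.
by apply: shift_S; [exact: ltW|exact: pj_in].
Qed.

Let E_orth i s : S s -> ip s (E i) = 0.
Proof. by move=> Ss; rewrite ipC (pj_orth cS _ Ss) conjC0. Qed.

Let G : 'M[R[i]]_q := \matrix_(i, j) ip (E i) (E j).
Let F0 x : 'M[R[i]]_q := \matrix_(i, j) fe (E i) x j.

Let F0_L2 i j : inL2 lmu arc (fun x => F0 x i j).
Proof. by under eq_fun do rewrite mxE; exact: fn_L2. Qed.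

Let gram_fourier (k : int) a b :
  c0 * CI (fun x => expi (k%:~R * x) * (F0 x *m adjmx (F0 x)) a b) = ip (shift k (E a)) (E b).
Proof.
rewrite fn_ip; congr (_ * _); rewrite -CI_sum; last 2 first.
- exact: marc.
- by move=> j _; apply: inL2_mulJ; [exact: marc|exact: fn_L2|exact: fn_L2].
apply: eq_CI => x _; rewrite mxE mulr_sumr; apply: eq_bigr => j _.
by rewrite shiftE adjmxE !mxE mulrA.
Qed.

(** By [gram_fourier] the coefficients are the inner products of e^(ikx) E_a with E_b. For k > 0 the
    shifted vector lies in the past, to which E_b is orthogonal; for k < 0 the shift is moved to the
    other argument. *)
Let gram_cst : {ae lmu, forall x : R, arc x -> F0 x *m adjmx (F0 x) = G}.
Proof.
suff H : forall a b, {ae lmu, forall x : R, arc x -> (F0 x *m adjmx (F0 x)) a b = G a b}.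
  have := ae_all (fun a => ae_all (fun b => H a b)).
  by apply: ae_sub => x hx Ax; apply/matrixP => a b; exact: hx.
move=> a b.
have IF : inL1 lmu arc (fun x => (F0 x *m adjmx (F0 x)) a b).
  under eq_fun do rewrite mxE; apply: (inL1_sum marc) => j _.
  by under eq_fun do rewrite adjmxE; apply: (inL2_mulJ marc).
have IG : inL1 lmu arc (fun=> G a b) by apply: (inL2_L1 marc arc_lty); exact: (inL2_cst marc _ arc_lty).
have := @fourier_unique R (fun x => (F0 x *m adjmx (F0 x)) a b - G a b) (inL1B marc IF IG).
move=> H; apply: ae_sub (H _) => [x hx /hx /eqP|k]; first by rewrite subr_eq0 => /eqP.
have bm (g : R -> R[i]) : inL1 lmu arc g -> inL1 lmu arc (fun x => expi (k%:~R * x) * g x).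
  move=> Ig; apply: (inL1_bmul marc _ (M := 1)) Ig; last by move=> x _; rewrite normc_expi.
  exact: cmeas_expi.
under eq_CI do rewrite mulrBr; rewrite (CI_B marc (bm _ IF) (bm _ IG)).
have -> : CI (fun x => expi (k%:~R * x) * G a b) = G a b * CI (fun x => expi (k%:~R * x)).
  rewrite -(CI_Z marc); last by have := inL2_L1 marc arc_lty (expi_L2 k).
  by apply: eq_CI => x _; rewrite mulrC.
apply: (mulfI (x := c0)); first by rewrite eq_complex /= eqxx andbT lt0r_neq0// invr_gt0.
rewrite mulr0 mulrBr gram_fourier CI_expi.
case: (ltrgtP k 0) => k0.
- rewrite mulr0 mulr0 subr0.
  have <- : ip (E a) (shift (- k) (E b)) = ip (shift k (E a)) (E b).
    exact: shift_adj.
  by apply: (pj_orth cS); apply: shift_E; rewrite oppr_gt0.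
- by rewrite !mulr0 subr0 E_orth//; exact: shift_E.
- rewrite [c0 * _]mulrCA c0pi mulr1 [G a b]mxE k0.
  rewrite (_ : shift 0 (E a) = E a) ?subrr//.
  by apply: circ_ext => t j; rewrite shiftE mul0r expi0 mul1r.
Qed.

(** A vector v in the kernel of G makes a null combination of the E_i, whose constant Fourier
    coefficient v C is then 0, against the invertibility of C. *)
Let Gunit : G \in unitmx.
Proof.
rewrite unitmxE unitfE; apply/negP => /det0P[v v0 vG].
pose y : circ q := \sum_a v 0 a *: E a.
have y0 : nrm y = 0.
  apply/nrm_eq0; rewrite /nrm2 (_ : ip y y = (v *m G *m adjmx v) 0 0).
    by rewrite vG mul0mx mxE.
  rewrite /y ip_sumr mxE; apply: eq_bigr => b _; rewrite ipZr adjmxE mulrC; congr (_ * _).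
  by rewrite ip_suml mxE; apply: eq_bigr => a _; rewrite ipZl [G a b]mxE.
have vC : v *m C = 0.
  apply/matrixP => i j; rewrite ord1 [RHS]mxE -(ip_null (expv (0, j)) y0) mxE /y ip_suml.
  by apply: eq_bigr => a _; rewrite ipZl ip_E_expv.
by move: v0; rewrite -[v]mulmx1 -(mulmxV Cunit) mulmxA vC mul0mx eqxx.
Qed.

(* A version of the innovation's boundary function satisfying F F^* = G everywhere. *)
Let F_ex : exists F : R -> 'M[R[i]]_q, [/\ forall i j, cmeasurable arc (fun x => F x i j),
  forall x, F x *m adjmx (F x) = G & {ae lmu, forall x : R, arc x -> F x = F0 x}].
Proof.
have [x0 hx0] : exists x0 : R, F0 x0 *m adjmx (F0 x0) = G.
  apply: contrapT => /forallNP hn.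
  have : lmu.-negligible arc.
    by apply: negligibleS gram_cst => x Ax /= /(_ Ax); exact: hn.
  move=> /(@negligibleP _ (measurableTypeR R) R lmu _ marc) l0.
  by have := etrans (esym (@lmu_arc R)) l0 => -[/eqP]; rewrite gt_eqF.
have mF0 i j : cmeasurable arc (fun x => F0 x i j) by case: (F0_L2 i j).
have [F [mF FG FN]] := @measurable_patch R q F0 (fun x => F0 x *m adjmx (F0 x)) G (F0 x0) mF0
  (cmeas_mulmx mF0 (cmeas_adjmx mF0)).
exists F; split => // [x|].
  by have [Gx|nGx] := pselect (F0 x *m adjmx (F0 x) = G); [rewrite FG|rewrite FN].
by apply: ae_sub gram_cst => x hx /hx; exact: FG.
Qed.

(** The left side is the inner product of X_(-k) with E_b: zero for k > 0 by orthogonality to the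
    past, and for k = 0 equal to that of E_i with E_b. *)
Let mean_hE (k : nat) i b :
  c0 * CI (fun x => expi (k%:R * x) * (h x *m adjmx (F0 x)) i b) = if k == 0%N then G i b else 0.
Proof.
transitivity (ip (hvec (- k%:Z, i)) (E b)).
  rewrite fn_ip; congr (_ * _); rewrite -CI_sum; last 2 first.
  - exact: marc.
  - by move=> j _; apply: inL2_mulJ; [exact: marc|exact: fn_L2|exact: fn_L2].
  apply: eq_CI => x _; rewrite mxE mulr_sumr; apply: eq_bigr => j _.
  by rewrite hvecE /= rmorphN mulNr opprK adjmxE [F0 _ _ _]mxE mulrA.
case: k => [|k]; last by rewrite E_orth//; apply: clspan_gen.
rewrite oppr0 eqxx [G i b]mxE {2}/E ipBl (_ : ip (pj cS _) _ = 0) ?subr0//.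
by apply: E_orth; exact: pj_in.
Qed.

(* The determinant of F has constant modulus, so Jensen's inequality for h F^* G^-1
   and the hypothesis on log |det h| give |det C|^2 >= det G, hence
   tr (C^* G^-1 C) >= q: then the integral of |F^-1 (F - C)|^2 is at most 0. *)
Theorem innovation i : S (hvec (0, i) - \sum_j C i j *: expv (0, j)).
Proof.
have [F [mF FG FF0]] := F_ex.
have mh a b : cmeasurable arc (fun x => h x a b) by case: (h2 a b).
have dG0 : normc (\det (F 0)) ^+ 2 != 0.
  have := Gunit; rewrite -(FG 0) unitmxE det_mulmx det_adjmx mulcJ unitfE.
  by rewrite eq_complex /= eqxx andbT.
pose g : R := normc (\det (F 0)) ^+ 2.
have g0 : 0 < g by rewrite lt_neqAle eq_sym dG0 sqr_ge0.
have dGE : \det G = g%:C%C by rewrite -(FG 0) det_mulmx det_adjmx mulcJ.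
have dF x : normc (\det (F x)) ^+ 2 = g.
  by have := congr1 (fun M => complex.Re (\det M)) (FG x); rewrite det_mulmx det_adjmx mulcJ dGE.
have Funit x : F x \in unitmx.
  rewrite unitmxE unitfE; apply/eqP => d0; have := dF x; rewrite d0 normc0 expr0n /= => /eqP.
  by rewrite lt_eqF.
have FL2 a b : inL2 lmu arc (fun x => F x a b).
  apply: (inL2_ae marc (mF a b) _ (F0_L2 a b)).
  by apply: ae_sub FF0 => x hx /hx ->.
(* F F^* = G bounds |F_ab|^2 by G_aa; the 1 + turns the bound on the square into one on the
   modulus. *)
pose K : R := 1 + \sum_a `|Re (G a a)|.
have Fb x a b : normc (F x a b) <= K.
  have h1 : normc (F x a b) ^+ 2 <= Re (G a a).
    rewrite -(FG x) mxE Re_sum (bigD1 b)//= adjmxE mulcJ /= lerDl.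
    by apply: sumr_ge0 => c _; rewrite adjmxE mulcJ /= sqr_ge0.
  have h3 : Re (G a a) <= \sum_a `|Re (G a a)|.
    by rewrite (bigD1 a)//= (le_trans (ler_norm _))// lerDl sumr_ge0.
  rewrite /K; move: (\sum_a _) (Re _) h1 h3 => u v h1 h3.
  by have := normc_ge0 (F x a b); nra.
have hFL2 a b : inL2 lmu arc (fun x => (h x *m adjmx (F x)) a b).
  under eq_fun do rewrite mxE; apply: (inL2_sum marc) => j _.
  under eq_fun do rewrite mulrC adjmxE; apply: (inL2_bmul marc _ (M := K)) => //.
    exact: cmeasJ.
  by move=> x _; rewrite normcJ.
have bexp (k : nat) (v : R -> R[i]) : inL1 lmu arc v -> inL1 lmu arc (fun x => expi (k%:R * x) * v x).
  move=> Iv; apply: (inL1_bmul marc _ (M := 1)) Iv; last by move=> x _; rewrite normc_expi.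
  exact: cmeas_expi.
have L21 (v : R -> R[i]) : inL2 lmu arc v -> inL1 lmu arc v := inL2_L1 marc arc_lty.
have hFm (k : nat) a b : CI (fun x => expi (k%:R * x) * (h x *m adjmx (F x)) a b) =
    (2 * pi)%:C%C * (if k == 0%N then G a b else 0).
  rewrite -(mean_hE k a b) mulrA -rmorphM mulfV ?lt0r_neq0// rmorph1 mul1r.
  have me (f : R -> R[i]) : cmeasurable arc f -> cmeasurable arc (fun x => expi (k%:R * x) * f x).
    by move=> mf; apply: cmeasM => //; exact: cmeas_expi.
  apply: (CI_ae marc).
  - by apply: me; case: (hFL2 a b).
  - apply: me; apply: cmeas_mulmx => //; apply: cmeas_adjmx => c d.
    by case: (F0_L2 c d).
  - by apply: ae_sub FF0 => x hx /hx ->.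
(* By [mean_hE], A has constant term 1 and no negative frequencies; since |det F|^2 = det G
   everywhere, |det A|^2 = |det h|^2 / det G. *)
pose A x := h x *m adjmx (F x) *m invmx G.
have A2 a b : inL2 lmu arc (fun x => A x a b).
  under eq_fun do rewrite mxE; apply: (inL2_sum marc) => j _.
  by under eq_fun do rewrite mulrC; apply: (inL2Z marc).
have A0 a b (k : nat) : CI (fun x => expi (k%:R * x) * (A x a b - (a == b)%:R)) = 0.
  have ce : CI (fun x => expi (k%:R * x)) = if k == 0%N then (2 * pi)%:C%C else 0.
    by rewrite -[k%:R]/(k%:Z%:~R) CI_expi.
  have Ie : inL1 lmu arc (fun x => expi (k%:R * x)).
    by rewrite -[k%:R]/(k%:Z%:~R); apply: L21; exact: expi_L2.
  transitivity (\sum_c invmx G c b * CI (fun x => expi (k%:R * x) * (h x *m adjmx (F x)) a c) -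
      (a == b)%:R * CI (fun x => expi (k%:R * x))).
    have Ij c : inL1 lmu arc (fun x => invmx G c b * (expi (k%:R * x) * (h x *m adjmx (F x)) a c)).
      by apply: (inL1Z marc); apply: bexp; exact: L21.
    rewrite -(CI_Z marc _ Ie) (eq_bigr (fun c => CI (fun x => invmx G c b * (expi (k%:R * x) * (h x *m adjmx (F x)) a c)))); last first.
      by move=> c _; rewrite -(CI_Z marc)//; apply: bexp; exact: L21.
    rewrite -(CI_sum marc)// -(CI_B marc); last 2 first.
    - exact: (inL1_sum marc).
    - exact: (inL1Z marc).
    apply: eq_CI => x _; rewrite [A x a b]mxE mulrBr mulr_sumr [X in _ - X]mulrC; congr (_ - _).
    by apply: eq_bigr => c _; ring.
  rewrite ce; have [->|k0] := eqVneq k 0%N; last first.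
    rewrite mulr0 subr0 big1// => c _; rewrite hFm.
    by rewrite (negbTE k0) !mulr0.
  apply/eqP; rewrite subr_eq0; apply/eqP.
  transitivity ((2 * pi)%:C%C * (G *m invmx G) a b).
    by rewrite mxE mulr_sumr; apply: eq_bigr => c _; rewrite hFm eqxx; ring.
  by rewrite mulmxV ?Gunit// mxE mulrC.
have dA x : normc (\det (A x)) ^+ 2 = normc (\det (h x)) ^+ 2 / g.
  rewrite /A !det_mulmx det_adjmx det_inv dGE !normcM normcJ normcV normc_real gtr0_norm//.
  by rewrite !exprMn dF; field; exact: lt0r_neq0.
have lnA : {ae lmu, forall x : R, arc x ->
    ln (normc (\det (h x)) ^+ 2) - ln g = ln (normc (\det (A x)) ^+ 2)}.
  apply: ae_sub hdet => x hx /hx dh; rewrite dA ln_div ?posrE// exprn_gt0//.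
  by rewrite lt_neqAle normc_ge0 andbT eq_sym; apply: contra_neq dh; exact: normc_eq0.
have mlA : @measurable_fun _ _ (measurableTypeR R) R arc (fun x => ln (normc (\det (A x)) ^+ 2)).
  apply: measurableT_comp; first exact: measurable_ln.
  apply: measurable_funX; apply: measurable_normc; apply: cmeas_det => a b.
  by case: (A2 a b).
have Ihg : rint lmu arc (fun x => ln (normc (\det (h x)) ^+ 2) - ln g).
  by apply: (rintB marc hlog); exact: rint_arc_cst.
have IlA := rint_ae marc mlA lnA Ihg.
have J := jensen_H2 A2 A0.
have dCg : g <= normc (\det C) ^+ 2.
  have dC : 0 < normc (\det C) ^+ 2.
    rewrite exprn_gt0// lt_neqAle normc_ge0 andbT eq_sym.
    by move: Cunit; rewrite unitmxE unitfE; apply: contra_neq; exact: normc_eq0.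
  rewrite -ler_ln ?posrE//.
  have := J _ IlA; rewrite -(RI_ae marc (rint_meas Ihg) mlA lnA) (RI_B marc hlog (rint_arc_cst _)).
  rewrite RI_arc_cst houter [ln g * _]mulrC -mulrBr pmulr_rge0// subr_ge0; apply.
  apply: ae_sub hdet => x hx /hx; apply: contra_neq => d0; have := dA x.
  rewrite d0 normc0 expr0n /= => /esym/eqP; rewrite mulf_eq0 invr_eq0 (gt_eqF g0) orbF sqrf_eq0.
  by move=> /eqP; exact: normc_eq0.
pose W := invmx G.
have pG : psdmx G by rewrite -(FG 0); exact: psd_mulJ.
have pW : psdmx W := psd_inv pG Gunit.
pose M := adjmx C *m W *m C.
have TM : q%:R <= Re (\tr M).
  have [_ _ _] := psd_det (psd_conj C pW).
  rewrite !det_mulmx det_adjmx det_inv dGE mulrAC [_^* * _]mulrC mulcJ -fmorphV -rmorphM /=.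
  move=> hM; have h1 : 1 <= expR (Re (\tr M) - q%:R).
    by apply: le_trans hM; rewrite ler_pdivlMr// mul1r.
  by move: h1; rewrite -expR0 ler_expR subr_ge0.
have WE x : W = adjmx (invmx (F x)) *m invmx (F x).
  rewrite -[LHS]mulmx1 /W; have -> : 1%:M = G *m (adjmx (invmx (F x)) *m invmx (F x)).
    rewrite -(FG x) -mulmxA [adjmx (F x) *m _]mulmxA -adjmxM (mulVmx (Funit x)) adjmx1 mul1mx.
    by rewrite (mulmxV (Funit x)).
  exact: (mulKmx Gunit).
pose D x := invmx (F x) *m (F x - C).
have DE x : Re (\tr (adjmx (D x) *m D x)) =
    q%:R + Re (\tr M) - 2 * Re (\tr (adjmx C *m W *m F x)).
  have -> : adjmx (D x) *m D x = adjmx (F x - C) *m W *m (F x - C).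
    by rewrite /D adjmxM (WE x) !mulmxA.
  rewrite adjmxB mulmxBr !mulmxBl !TB -/M.
  have -> : adjmx (F x) *m W *m F x = 1%:M.
    by rewrite (WE x) mulmxA -adjmxM (mulVmx (Funit x)) adjmx1 mul1mx (mulVmx (Funit x)).
  have -> : Re (\tr (adjmx (F x) *m W *m C)) = Re (\tr (adjmx C *m W *m F x)).
    have -> : adjmx (F x) *m W *m C = adjmx (adjmx C *m W *m F x).
      by rewrite !adjmxM adjmxK pW.1 mulmxA.
    by rewrite /adjmx trace_map_mx mxtrace_tr ReJ.
  rewrite mxtrace1 (_ : Re (q%:R) = q%:R); first by ring.
  by rewrite -(rmorph_nat (real_complex R)).
have mD a b : cmeasurable arc (fun x => D x a b).
  apply: cmeas_mulmx => c d; first exact: (cmeas_invmx marc mF).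
  by under eq_fun do rewrite !mxE; apply: cmeasB => //; exact: cmeas_cst.
have ItW : inL1 lmu arc (fun x => \tr (adjmx C *m W *m F x)).
  apply: (inL1_sum marc) => a _; under eq_fun do rewrite mxE.
  by apply: (inL1_sum marc) => b _; apply: (inL1Z marc); exact: L21.
have CItW : CI (fun x => \tr (adjmx C *m W *m F x)) = (2 * pi)%:C%C * \tr M.
  rewrite (CI_sum marc); last first.
    move=> a _; under eq_fun do rewrite mxE.
    by apply: (inL1_sum marc) => b _; apply: (inL1Z marc); exact: L21.
  rewrite mulr_sumr; apply: eq_bigr => a _; rewrite mxE.
  under eq_CI do rewrite mxE.
  rewrite (CI_sum marc); last by move=> b _; apply: (inL1Z marc); exact: L21.
  rewrite mulr_sumr; apply: eq_bigr => b _; rewrite (CI_Z marc); last exact: L21.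
  rewrite mulrCA; congr (_ * _).
  rewrite (CI_ae marc (g := fun x => F0 x b a)); last 3 first.
  - exact: mF.
  - by case: (F0_L2 b a).
  - by apply: ae_sub FF0 => x hx /hx ->.
  apply: (mulfI (x := c0)); first by rewrite eq_complex /= eqxx andbT lt0r_neq0// invr_gt0.
  rewrite mulrA c0pi mul1r -ip_E_expv ip_expv; congr (_ * _).
  by apply: eq_CI => x _; rewrite mxE oppr0 mul0r expi0 mul1r.
have [ItWr _] := proj1 (inL1P _ marc _) ItW.
have Iq : rint lmu arc (fun x => Re (\tr (adjmx (D x) *m D x))).
  under eq_fun do rewrite DE.
  by apply: (rintB marc); [exact: rint_arc_cst|exact: (rintZ marc)].
have D0 : RI lmu arc (fun x => Re (\tr (adjmx (D x) *m D x))) = 0.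
  apply/eqP; rewrite eq_le; apply/andP; split; last first.
    by apply: RI_ge0 => x _; rewrite T_normc; apply: sumr_ge0 => a _; apply: sumr_ge0 => b _; exact: sqr_ge0.
  under eq_RI do rewrite DE.
  rewrite (RI_B marc (rint_arc_cst _) (rintZ marc _ ItWr)) RI_arc_cst (RI_Z marc _ ItWr).
  have -> : RI lmu arc (fun x => Re (\tr (adjmx C *m W *m F x))) = 2 * pi * Re (\tr M).
    by rewrite -[LHS]/(Re (CI _)) CItW ReM /= mul0r subr0.
  rewrite [leLHS](_ : _ = - (2 * pi * (Re (\tr M) - q%:R))); last by ring.
  by rewrite oppr_le0 mulr_ge0 ?(ltW pi2)// subr_ge0.
have FC : {ae lmu, forall x : R, arc x -> F x = C}.
  have pos x : arc x -> 0 <= Re (\tr (adjmx (D x) *m D x)).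
    by move=> _; rewrite T_normc; apply: sumr_ge0 => a _; apply: sumr_ge0 => b _; exact: sqr_ge0.
  apply: ae_sub (RI_eq0_ae marc Iq pos D0).
  move=> x hx /hx; rewrite T_normc => hD.
  have Dx : D x = 0.
    apply/matrixP => a b; rewrite [RHS]mxE; apply: normc_eq0; apply/eqP; rewrite -sqrf_eq0.
    move/eqP: hD; rewrite psumr_eq0 => [/allP/(_ a (mem_index_enum _))|c _]; last first.
      by apply: sumr_ge0 => d _; exact: sqr_ge0.
    by rewrite psumr_eq0 => [/allP/(_ b (mem_index_enum _))|c _]; last exact: sqr_ge0.
  apply/eqP; rewrite -subr_eq0; apply/eqP.
  by rewrite -[LHS]mul1mx -(mulmxV (Funit x)) -mulmxA -/(D x) Dx mulmx0.
apply: (csub_null cS (pj_in cS (hvec (0, i)))).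
rewrite addrAC -/(E i); apply/fn_null => j.
apply: ae_sub (ae_and FC FF0) => x [h1 h3] Ax; rewrite fnB fn_sum.
have -> : fe (E i) x j = C i j by rewrite -(h1 Ax) (h3 Ax) mxE.
rewrite (bigD1 j)//= big1 ?addr0 => [|c cj].
  by rewrite fnZ expvE /= eqxx mul0r expi0 mulr1 subrr.
by rewrite fnZ expvE /= eq_sym (negbTE cj) mulr0.
Qed.

End innovation.

(** * Prediction on the circle *)

Section isometry.
Context {R : realType} {H H' : semiHilbert R}.
Variable T : H -> H'.
Hypothesis T0 : T 0 = 0.
Hypothesis Tlin : forall a x y, T (a *: x + y) = a *: T x + T y.
Hypothesis Tnrm : forall x, nrm (T x) = nrm x.

Lemma isometryB x y : T (x - y) = T x - T y.
Proof. by rewrite addrC -scaleN1r Tlin scaleN1r addrC. Qed.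

Lemma isometry_sum I (r : seq I) (P : pred I) (a : I -> R[i]) (F : I -> H) :
  T (\sum_(i <- r | P i) a i *: F i) = \sum_(i <- r | P i) a i *: T (F i).
Proof. by elim/big_rec2 : _ => [|i y1 y2 _ <-]; rewrite ?T0 ?Tlin. Qed.

Lemma csub_isometry (S : H' -> Prop) : csub S -> csub (fun x => S (T x)).
Proof.
move=> cS; split; first by rewrite T0; exact: csub0 cS.
  by move=> a x y Sx Sy; rewrite Tlin; exact: csub_lin.
move=> x hx; apply: (csub_closed cS) => e e0; have [s Ss hs] := hx e e0.
by exists (T s); [exact: Ss|rewrite -isometryB Tnrm].
Qed.

End isometry.

Section approximation.
Context {R : realType} {H : semiHilbert R}.
Variables (q : nat) (u : nat -> 'I_q -> H) (S : H -> Prop).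
Hypothesis cS : csub S.

Lemma csub_approx : csub (approx u S).
Proof.
split.
- move=> e e0; exists 0, 0; split; [exact: csub0 cS|exact: lspan0|].
  by rewrite addr0 subrr nrm0.
- move=> a x y Ax Ay e e0.
  have e1 : 0 < e / (2 * (normc a + 1)).
    by rewrite divr_gt0// mulr_gt0// ltr_wpDl// normc_ge0.
  have e2 : 0 < e / 2 by rewrite divr_gt0.
  have [s [w [Ss lw h1]]] := Ax _ e1; have [s' [w' [Ss' lw' h2]]] := Ay _ e2.
  exists (a *: s + s'), (a *: w + w'); split; [exact: csub_lin|exact: lspan_lin|].
  have -> : a *: x + y - (a *: s + s' + (a *: w + w')) = a *: (x - (s + w)) + (y - (s' + w')).
    by rewrite scalerBr !scalerDr (addrACA (a *: s)) opprD addrACA.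
  rewrite (le_lt_trans (nrmD _ _))// nrmZ [ltRHS](splitr e) ler_ltD//.
  rewrite (le_trans (ler_wpM2l (normc_ge0 a) (ltW h1)))//.
  have a0 : 0 < normc a + 1 by rewrite ltr_wpDl// normc_ge0.
  rewrite (_ : e / 2 = (normc a + 1) * (e / (2 * (normc a + 1)))); last by field; exact: lt0r_neq0.
  by rewrite ler_wpM2r ?(ltW e1)// lerDl.
- move=> x hx e e0; have e2 : 0 < e / 2 by rewrite divr_gt0.
  have [y Ay hy] := hx _ e2; have [s [w [Ss lw h]]] := Ay _ e2.
  exists s, w; split => //; rewrite (le_lt_trans (nrm_tri y _ _))// (splitr e) ltrD//.
Qed.

Lemma approx_sub x : S x -> approx u S x.
Proof.
by move=> Sx e e0; exists x, 0; split => //; [exact: lspan0|rewrite addr0 subrr nrm0].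
Qed.

Lemma approx_gen l i : approx u S (u l i).
Proof.
move=> e e0; exists 0, (u l i); split; first exact: csub0 cS.
  exact: (@lspan_gen R H _ (fun li : nat * 'I_q => u li.1 li.2) (fun=> True) (l, i)).
by rewrite add0r subrr nrm0.
Qed.

End approximation.

Section linear_system.
Context {R : realType} {H : semiHilbert R}.
Variables (q : nat) (S : H -> Prop).
Hypothesis cS : csub S.

Lemma csub_solve (C : 'M[R[i]]_q) (x u : 'I_q -> H) : C \in unitmx ->
  (forall i, S (x i)) -> (forall i, S (x i - \sum_j C i j *: u j)) -> forall j, S (u j).
Proof.
move=> uC hx hxu j.
have Cu i : S (\sum_j C i j *: u j).
  by have := csubB cS (hx i) (hxu i); rewrite opprB addrC subrK.
have -> : u j = \sum_i invmx C j i *: \sum_k C i k *: u k.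
  transitivity (\sum_k (j == k)%:R *: u k).
    by rewrite (bigD1 j)//= eqxx scale1r big1 ?addr0// => k kj; rewrite eq_sym (negbTE kj) scale0r.
  under [RHS]eq_bigr do rewrite scaler_sumr; rewrite exchange_big /=; apply: eq_bigr => k _.
  under [RHS]eq_bigr do rewrite scalerA; rewrite -scaler_suml; congr (_ *: _).
  by have := congr1 (fun M : 'M[R[i]]_q => M j k) (mulVmx uC); rewrite !mxE => ->.
by apply: (csub_sum cS) => i _; exact: (csubZ cS).
Qed.

End linear_system.

Section prediction.
Context {R : realType}.
Variables (q : nat) (h g U : R -> 'M[R[i]]_q) (C D : 'M[R[i]]_q).
Notation lmu := (@lebesgue_measure R).
Notation arc := (@circle_arc R : set (measurableTypeR R)).
Notation circ := (@circ R).
Notation CI := (cintegral lmu arc).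
Notation c0 := (((2 * pi)^-1 : R)%:C%C).
Hypothesis h2 : forall i j, inL2 lmu arc (fun x => h x i j).
Hypothesis g2 : forall i j, inL2 lmu arc (fun x => g x i j).
Hypothesis hF : forall i j (k : nat), CI (fun x => expi (k%:R * x) * h x i j) =
  if k == 0%N then (2 * pi)%:C%C * C i j else 0.
Hypothesis gF : forall i j (k : nat), CI (fun x => expi (k%:R * x) * g x i j) =
  if k == 0%N then (2 * pi)%:C%C * D i j else 0.
Hypotheses (Cunit : C \in unitmx) (Dunit : D \in unitmx).
Notation X := (hvec h).
Hypothesis hI : forall i, clspan X (fun p => p.1 < 0) (X (0, i) - \sum_j C i j *: expv (0, j)).
Hypothesis gI : forall i, clspan (hvec g) (fun p => p.1 < 0) (hvec g (0, i) - \sum_j D i j *: expv (0, j)).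
Hypothesis mU : forall i j, cmeasurable arc (fun x => U x i j).
Hypothesis UU : forall x, U x *m adjmx (U x) = 1%:M.
Hypothesis hgU : {ae lmu, forall x : R, arc x -> h x = g (- x) *m U x}.

Let U_le1 x i j : normc (U x i j) <= 1.
Proof.
have : normc (U x i j) ^+ 2 <= 1.
  have <- : Re ((U x *m adjmx (U x)) i i) = 1 by rewrite UU mxE eqxx.
  rewrite mxE Re_sum.
  rewrite (bigD1 j)//= adjmxE mulcJ /= lerDl.
  by apply: sumr_ge0 => c _; rewrite adjmxE mulcJ /= sqr_ge0.
by rewrite -[X in _ <= X -> _](expr1n _ 2) ler_pXn2r ?nnegrE// normc_ge0.
Qed.

Let U_L2 i j : inL2 lmu arc (fun x => U x i j).
Proof.
have := inL2_bmul marc (mU i j) (M := 1) _ (inL2_cst marc 1 arc_lty).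
by under eq_fun do rewrite mulr1; apply => x _; exact: U_le1.
Qed.

Let exp_L2 (a : R) (f : R -> R[i]) : inL2 lmu arc f -> inL2 lmu arc (fun x => expi (a * x) * f x).
Proof.
move=> If; apply: (inL2_bmul marc _ (M := 1)) If; last by move=> x _; rewrite normc_expi.
exact: cmeas_expi.
Qed.

Let refl_L2 (f : R -> R[i]) : inL2 lmu arc f -> inL2 lmu arc (fun x => f (- x)).
Proof.
move=> If; split; last exact: (rint_reflect (inL2_rint If)).
by case: If => -[m1 m2] _; split; [exact: (meas_reflect m1)|exact: (meas_reflect m2)].
Qed.

Definition uvec (p : int * 'I_q) : circ q :=
  cvec (fun x => \row_j (expi (p.1%:~R * x) * U x p.2 j)).

Let uvecE p t j : fe (uvec p) t j = expi (p.1%:~R * t) * U t p.2 j.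
Proof.
rewrite /fe cvecE ?mxE// => i; under eq_fun do rewrite mxE; exact: exp_L2.
Qed.

(** The isometry v(x) -> v(-x) U(x) carries the model of the reversed process, built on g, to that
    of X with time reversed, and exponentials to the vectors [uvec]. Facts about g thereby become
    facts about the future of X. *)
Let refl (v : circ q) : circ q :=
  cvec (fun x => \row_j (\sum_l fe v (- x) l * U x l j)).

Let reflE v t j : fe (refl v) t j = \sum_l fe v (- t) l * U t l j.
Proof.
rewrite /fe cvecE ?mxE// => i; under eq_fun do rewrite mxE.
apply: (inL2_sum marc) => l _; under eq_fun do rewrite mulrC.
apply: (inL2_bmul marc (mU l i) (M := 1)); first by move=> x _; exact: U_le1.
exact: (refl_L2 (fn_L2 v l)).
Qed.

Let refl_lin a v w : refl (a *: v + w) = a *: refl v + refl w.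
Proof.
apply: circ_ext => t j; rewrite fnD fnZ !reflE mulr_sumr -big_split /=; apply: eq_bigr => l _.
by rewrite fnD fnZ mulrDl mulrA.
Qed.

Let refl0 : refl 0 = 0.
Proof.
apply: circ_ext => t j; rewrite reflE big1 => [|l _]; last by rewrite /fe [_ 0 _]mxE mul0r.
by rewrite /fe [RHS]mxE.
Qed.

Let refl_nrm v : nrm (refl v) = nrm v.
Proof.
have I2 (w : circ q) j := inL2_rint (fn_L2 w j).
rewrite /nrm !fn_nrm2; congr (Num.sqrt (_ * _)).
rewrite -!(RI_sum marc); try by move=> j _; exact: I2.
rewrite -[RHS]RI_reflect; last by apply: (rint_sum marc) => j _; exact: I2.
apply: eq_RI => t _.
pose r : 'rV[R[i]]_q := \row_l fe v (- t) l.
have rE (M : 'rV[R[i]]_q) : \sum_j normc (M 0 j) ^+ 2 = Re ((M *m adjmx M) 0 0).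
  by rewrite mxE Re_sum; apply: eq_bigr => j _; rewrite adjmxE mulcJ.
transitivity (Re ((r *m U t *m adjmx (r *m U t)) 0 0)).
  rewrite -rE; apply: eq_bigr => j _; rewrite reflE mxE; congr (normc _ ^+ 2).
  by apply: eq_bigr => l _; rewrite mxE.
rewrite adjmxM mulmxA -(mulmxA r) UU mulmx1 -rE.
by apply: eq_bigr => l _; rewrite mxE.
Qed.

Let refl_expv k j : refl (expv (k, j)) = uvec (- k, j).
Proof.
apply: circ_ext => t i; rewrite reflE uvecE (bigD1 j)//= big1 ?addr0 => [|l lj].
  by rewrite expvE /= eqxx mulr1n mulrN mulrNz mulNr.
by rewrite expvE /= (negbTE lj) mul0r.
Qed.

Let refl_hvec k j : nrm (refl (hvec g (k, j)) - X (- k, j)) = 0.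
Proof.
apply/fn_eq => i; apply: ae_sub hgU => t ht /ht hE.
rewrite reflE (hvecE h2) /= hE mxE mulr_sumr; apply: eq_bigr => l _.
by rewrite (hvecE g2) /= mulrN mulrNz mulNr mulrA.
Qed.

Let csub_refl (S : circ q -> Prop) : csub S -> csub (fun v => S (refl v)).
Proof. exact: (@csub_isometry R (circ q) (circ q) refl refl0 refl_lin refl_nrm). Qed.

(* The innovation relation of the reversed process. *)
Let gI' i : clspan X (fun p => 0 < p.1) (X (0, i) - \sum_j D i j *: uvec (0, j)).
Proof.
pose S := clspan X (fun p => 0 < p.1).
have cS : csub S := csub_clspan _ _.
have : S (refl (hvec g (0, i) - \sum_j D i j *: expv (0, j))).
  apply: (clspan_sub (csub_refl cS) _ (gI i)) => -[k j] k0.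
  apply: (csub_null cS _ (refl_hvec k j)); apply: clspan_gen => /=.
  by rewrite oppr_gt0.
rewrite (@isometryB R (circ q) (circ q) refl refl_lin) (@isometry_sum R (circ q) (circ q) refl refl0 refl_lin).
under eq_bigr do rewrite refl_expv oppr0.
move=> Sx; apply: (csub_null cS Sx).
by rewrite opprB addrA subrK nrmC; have := refl_hvec 0 i; rewrite oppr0.
Qed.

Lemma CI_reflect (f : R -> R[i]) : inL1 lmu arc f -> CI (fun x => f (- x)) = CI f.
Proof.
by move=> /(inL1P _ marc)[I1 I2]; apply: complex_ext; rewrite /= -/(RI lmu arc _);
  [exact: (RI_reflect I1)|exact: (RI_reflect I2)].
Qed.

(** Since h U^* = g(-x), the inner product is a Fourier coefficient of g after the reflection x ->
    -x, and g has no negative frequencies. *)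
Let ip_X_uvec (m k : int) i j : - k <= m -> ip (X (m, i)) (uvec (k, j)) =
  if m == - k then D i j else 0.
Proof.
move=> mk; have mk0 : 0 <= m + k by rewrite -lerBlDr sub0r.
pose f x := expi ((absz (m + k))%:R * x) * g x i j.
have If : inL1 lmu arc f by apply: (inL2_L1 marc arc_lty); exact: exp_L2.
have mc (a : R) (u : R -> R[i]) : cmeasurable arc u -> cmeasurable arc (fun x => expi (- (a * x)) * u x).
  by move=> mu; apply: cmeasM => //; exact: cmeas_expiN.
have mh a b : cmeasurable arc (fun x => h x a b) by case: (h2 a b).
have kE : (absz (m + k))%:R = m%:~R + k%:~R :> R.
  by rewrite -[(absz (m + k))%:R]/((absz (m + k))%:Z%:~R) gez0_abs// rmorphD.
transitivity (c0 * CI (fun x => f (- x))).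
  rewrite fn_ip; congr (_ * _); rewrite -(CI_sum marc); last first.
    by move=> l _; apply: (inL2_mulJ marc); exact: fn_L2.
  transitivity (CI (fun x => expi (- ((m%:~R + k%:~R) * x)) * (h x *m adjmx (U x)) i j)).
    apply: eq_CI => x _; rewrite mxE mulr_sumr; apply: eq_bigr => l _.
    rewrite (hvecE h2) uvecE /= adjmxE rmorphM /= -expiN mulrACA -expiD mulrDl opprD.
    by [].
  apply: (CI_ae marc).
  - apply: mc; apply: cmeas_mulmx => // a b; exact: cmeas_adjmx.
  - have [[m1 m2] _] := If; split; [exact: (meas_reflect m1)|exact: (meas_reflect m2)].
  - apply: ae_sub hgU => x hx /hx hE.
    by rewrite hE -mulmxA UU mulmx1 /f kE mulrN.
rewrite (CI_reflect If) gF absz_eq0 addr_eq0; case: ifP => _; last by rewrite mulr0.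
by rewrite mulrA -rmorphM /= mulVf ?mul1r// lt0r_neq0// mulr_gt0 ?pi_gt0.
Qed.

(** The sequence beta written through U alone: almost everywhere h^* h_sharp^-1 = U^*, see
    [unitary_factor]. *)
Definition ubeta (m : int) : 'M[R[i]]_q :=
  \matrix_(i, j) - (c0 * CI (fun x => expi (- (m%:~R * x)) * (U x j i)^*)).

Let ip_expv_uvec (k m : int) i j : ip (expv (k, i)) (uvec (m, j)) = - ubeta (m - k) i j.
Proof.
rewrite mxE opprK fn_ip (bigD1 i)//= big1 ?addr0 => [|l li].
  congr (_ * _); apply: eq_CI => x _; rewrite expvE uvecE /= eqxx mulr1n rmorphM /= -expiN mulrA -expiD.
  by congr (expi _ * _); rewrite rmorphB /=; ring.
rewrite -[RHS](CI_0 lmu arc); apply: eq_CI => x _.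
by rewrite expvE /= (negbTE li) mulr0n mul0r.
Qed.

Let uvec_orthonormal k l i j : ip (uvec (k, i)) (uvec (l, j)) = ((k == l) && (i == j))%:R.
Proof.
rewrite -[RHS](@expv_orthonormal R q) !fn_ip; congr (_ * _).
rewrite -!(CI_sum marc); try by move=> a _; apply: (inL2_mulJ marc); exact: fn_L2.
apply: eq_CI => x _.
transitivity (expi (k%:~R * x) * (expi (l%:~R * x))^* * (U x *m adjmx (U x)) i j).
  rewrite mxE mulr_sumr; apply: eq_bigr => a _.
  by rewrite !uvecE /= rmorphM mulrACA adjmxE.
rewrite UU mxE (bigD1 i)//= big1 ?addr0 => [|a ai]; last by rewrite expvE /= (negbTE ai) mul0r.
by rewrite !expvE /= eqxx mulr1n; case: (i == j); rewrite ?mulr1n ?mulr0n ?conjC0 ?mulr1 ?mulr0.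
Qed.

Let shift_expv k (p : int * 'I_q) : @shift R q k (expv p) = expv (k + p.1, p.2).
Proof.
apply: circ_ext => t j; rewrite shiftE !expvE /=; case: eqP => _; last by rewrite mulr0.
by rewrite !mulr1n -expiD -mulrDl -rmorphD.
Qed.

Let shift_uvec k p : shift k (uvec p) = uvec (k + p.1, p.2).
Proof. by apply: circ_ext => t j; rewrite shiftE !uvecE /= mulrA -expiD -mulrDl -rmorphD. Qed.

Let shift_clspan k (L L' : int * 'I_q -> Prop) v : (forall p, L p -> L' (p.1 - k, p.2)) ->
  clspan X L v -> clspan X L' (shift k v).
Proof.
move=> LL' Lv; have cS : csub (clspan X L') := csub_clspan _ _.
apply: (clspan_sub (csub_shift k cS) _ Lv) => p Lp.
by rewrite (shift_hvec h2); apply: clspan_gen; exact: LL'.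
Qed.

Let shift_sum k (a : 'I_q -> R[i]) (F : 'I_q -> circ q) :
  shift k (\sum_i a i *: F i) = \sum_i a i *: shift k (F i).
Proof. exact: (@isometry_sum R (circ q) (circ q) (shift k) (@shift0 R q k) (@shift_lin R q k)). Qed.

Let hIk k i : clspan X (fun p => p.1 < k) (X (k, i) - \sum_j C i j *: expv (- k, j)).
Proof.
have := @shift_clspan (- k) _ (fun p => p.1 < k) _ _ (hI i).
rewrite shiftB (shift_hvec h2) shift_sum /= opprK add0r.
under eq_bigr do rewrite shift_expv /= addr0.
by apply => -[m j] /=; rewrite gtrDr.
Qed.

Let gIk k i : clspan X (fun p => k < p.1) (X (k, i) - \sum_j D i j *: uvec (- k, j)).
Proof.
have := @shift_clspan (- k) _ (fun p => k < p.1) _ _ (gI' i).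
rewrite shiftB (shift_hvec h2) shift_sum /= opprK add0r.
under eq_bigr do rewrite shift_uvec /= addr0.
by apply => -[m j] /=; rewrite ltrDr.
Qed.

Variable n : nat.
Hypothesis n_gt0 : (0 < n)%N.

Let SA := clspan X (fun p => p.1 <= -1).
Let SB := clspan X (fun p => - n%:Z <= p.1).
Let K := clspan X (fun=> True).
Let cA : csub SA := csub_clspan _ _.
Let cB : csub SB := csub_clspan _ _.
Let cK : csub K := csub_clspan _ _.
Let u l i : circ q := expv (- l%:Z, i).
Let v l i : circ q := uvec ((n + l).+1%:Z, i).

Let ou l m i j : ip (u l i) (u m j) = ((l == m) && (i == j))%:R.
Proof. by rewrite expv_orthonormal eqr_opp. Qed.

Let ov l m i j : ip (v l i) (v m j) = ((l == m) && (i == j))%:R.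
Proof. by rewrite uvec_orthonormal eqz_nat eqSS eqn_add2l. Qed.

Let uA l i s : SA s -> ip (u l i) s = 0.
Proof.
move=> Ss; rewrite ipC; apply/eqP; rewrite conjC_eq0; apply/eqP.
apply: (clspan_sub (csub_orth _) _ Ss) => -[m j] m0; have {}m0 : m <= -1 := m0.
by rewrite (ip_hvec_expv h2 hF) ?opprK; [rewrite lt_eqF//; lia|lia].
Qed.

Let vB l i s : SB s -> ip (v l i) s = 0.
Proof.
move=> Ss; rewrite ipC; apply/eqP; rewrite conjC_eq0; apply/eqP.
apply: (clspan_sub (csub_orth _) _ Ss) => -[m j] m0; have {}m0 : - n%:Z <= m := m0.
by rewrite ip_X_uvec; [rewrite gt_eqF//; lia|lia].
Qed.

(** The past and the u_l together span everything: X_N with N >= 0 is a combination of the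
    components of u_N plus an element of the closed span of earlier values, so induction on N
    applies. *)
Let KA z : K z -> approx u SA z.
Proof.
have cP := csub_approx u cA.
have gen N : forall m i, m < N%:Z -> approx u SA (X (m, i)).
  elim: N => [|N ih] m i mN.
    by apply: approx_sub; apply: clspan_gen => /=; lia.
  have [mN'|Nm] := ltP m N%:Z; first exact: ih.
  have -> : m = N%:Z by lia.
  rewrite -[X _](subrK (\sum_j C i j *: expv (- N%:Z, j))).
  apply: (csubD cP).
    by apply: (clspan_sub cP _ (hIk N%:Z i)) => -[k j] kN; exact: ih.
  by apply: (csub_sum cP) => j _; apply: (csubZ cP); exact: (approx_gen u cA).
move=> Kz; apply: (clspan_sub cP _ Kz) => -[m i] _.
by apply: (gen `|m|%N.+1); lia.
Qed.

Let KB z : K z -> approx v SB z.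
Proof.
have cP := csub_approx v cB.
have gen N : forall m i, - (n + N)%N%:Z <= m -> approx v SB (X (m, i)).
  elim: N => [|N ih] m i mN.
    by apply: approx_sub; apply: clspan_gen => /=; lia.
  have [mN'|Nm] := lerP (- (n + N)%N%:Z) m; first exact: ih.
  have -> : m = - (n + N).+1%:Z by lia.
  rewrite -[X _](subrK (\sum_j D i j *: uvec (- - (n + N).+1%:Z, j))).
  apply: (csubD cP).
    apply: (clspan_sub cP _ (gIk (- (n + N).+1%:Z) i)) => -[k j] kN; apply: ih.
    have {}kN : - (n + N).+1%:Z < k := kN; lia.
  apply: (csub_sum cP) => j _; apply: (csubZ cP); rewrite opprK; exact: (approx_gen v cB).
move=> Kz; apply: (clspan_sub cP _ Kz) => -[m i] _.
by apply: (gen `|m|%N); lia.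
Qed.

Let AK z : SA z -> K z. Proof. by apply: clspan_mono. Qed.
Let BK z : SB z -> K z. Proof. by apply: clspan_mono. Qed.

Let gramm_uv l j : gramm (u l) (v j) = - ubeta (n + (j + l).+1)%N.
Proof.
apply/matrixP => a b; rewrite [LHS]mxE ip_expv_uvec [RHS]mxE; congr (- ubeta _ a b); lia.
Qed.

Definition predictor (phi : nat -> 'M[R[i]]_q) (m : nat -> int) (i : 'I_q) : circ q :=
  \sum_(1 <= k < n.+1) \sum_j phi k i j *: X (m k, j).

Let predictor_in (S : circ q -> Prop) phi m i : csub S ->
  (forall k j, (1 <= k < n.+1)%N -> S (X (m k, j))) -> S (predictor phi m i).
Proof.
move=> cS hS; rewrite /predictor big_seq; apply: (csub_sum cS) => k; rewrite mem_index_iota => hk.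
by apply: (csub_sum cS) => j _; apply: (csubZ cS); exact: hS.
Qed.

Let gramm_predictor phi m (eta : 'I_q -> circ q) (L : 'M[R[i]]_q) :
  (forall k i j, (1 <= k < n.+1)%N -> ip (X (m k, i)) (eta j) = if k == n then L i j else 0) ->
  gramm (predictor phi m) eta = phi n *m L.
Proof.
move=> he; apply/matrixP => i j; rewrite !mxE /predictor ip_suml.
rewrite big_nat_recr// big_nat big1 => [|k /andP[k1 kn]]; last first.
  rewrite ip_suml big1// => l _; rewrite ipZl he ?k1 ?(ltn_trans kn)//.
  by rewrite ltn_eqF// mulr0.
rewrite [LHS]add0r ip_suml; apply: eq_bigr => l _; rewrite ipZl he ?n_gt0 ?ltnSn// eqxx //.
Qed.

Theorem forward_series (phi : nat -> 'M[R[i]]_q) (B : int -> 'M[R[i]]_q) :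
  B =1 ubeta ->
  (forall i z, SA z -> SB z -> ip (X (0, i) - predictor phi (fun k => - k%:Z) i) z = 0) ->
  eq_double_series (phi n) C (invmx D)
    (fun k j => bcoef B n (2 * k) j *m B (n + j)%N).
Proof.
move=> BE xy.
(* Every X_m with m > -n is orthogonal to eta: X_0 drops out, and of the predictor only the term in
   X_(-n) remains. *)
pose eta j : circ q := uvec (n%:Z, j).
have etaB : forall i, SB (eta i).
  apply: (csub_solve cB Dunit (x := fun i => X (- n%:Z, i))).
    by move=> i; apply: clspan_gen => /=.
  move=> i; have := gIk (- n%:Z) i; rewrite opprK.
  by apply: clspan_mono => p; exact: ltW.
have [|||||||||h1 h3 h4] := @alternating_series R (circ q) q SA SB K cA cB cK AK BK u v
  (fun i => X (0, i)) (predictor phi (fun k => - k%:Z)) eta ou ov uA vB KA KB C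
  (fun m => B (n + m)%N) (fun k => bcoef B n k) Cunit _ _ _ _ etaB _ _ _ xy.
- by move=> i; apply: clspan_gen => /=; lia.
- move=> l; apply/matrixP => a b; rewrite mxE (ip_hvec_expv h2 hF) ?opprK//.
  by case: l => [|l]; rewrite //= mxE.
- by move=> l j; rewrite gramm_uv BE.
- move=> l; apply/matrixP => a b; rewrite [LHS]mxE ip_expv_uvec [RHS]mxE BE; congr (- ubeta _ a b); lia.
- apply/matrixP => a b; rewrite [LHS]mxE ip_X_uvec ?[RHS]mxE; last lia.
  by rewrite gt_eqF//; lia.
- by move=> i; apply: predictor_in => // k j hk; apply: clspan_gen => /=; lia.
- by move=> i; apply: predictor_in => // k j hk; apply: clspan_gen => /=; lia.
- by [].
- move=> k j /=; congr mxsum; apply/funext => l; rewrite addn1 -addnA -addnS.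
  by case: odd.
rewrite (_ : (fun k j => _) = fun k j => bcoef B n k.*2 j *m B (n + j)%N); last first.
  by apply/funext => k; apply/funext => j; rewrite -mul2n.
split; [exact: h1|exact: h3|].
rewrite -h4 (@gramm_predictor _ _ _ D).
    by rewrite mulmxK.
  move=> k i j hk; rewrite ip_X_uvec; last lia.
  by rewrite eqr_opp eqz_nat.
Qed.

(** [alternating_series] with the past and the future, u and v, C and D, beta and its adjoint
    exchanged. *)
Theorem backward_series (phi : nat -> 'M[R[i]]_q) (B : int -> 'M[R[i]]_q) :
  B =1 ubeta ->
  (forall i z, SA z -> SB z ->
    ip (X (- n.+1%:Z, i) - predictor phi (fun k => - (n.+1%:Z - k%:Z)) i) z = 0) ->
  eq_double_series (phi n) D (invmx C)
    (fun k j => btcoef B n (2 * k) j *m adjmx (B (n + j)%N)).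
Proof.
move=> BE xy.
(* The mirror image: every X_m with m < -1 is orthogonal to e^(ix), and X_(-1) carries the
   coefficient [phi n]. *)
pose eta j : circ q := expv (1, j).
have etaA : forall i, SA (eta i).
  apply: (csub_solve cA Cunit (x := fun i => X (-1, i))).
    by move=> i; apply: clspan_gen => /=.
  move=> i; have := hIk (-1) i; rewrite opprK.
  by apply: clspan_mono => p; exact: ltW.
have xy' i z : SB z -> SA z -> ip (X (- n.+1%:Z, i) - predictor phi (fun k => - (n.+1%:Z - k%:Z)) i) z = 0.
  by move=> Bz Az; exact: xy.
have [|||||||||h1 h3 h4] := @alternating_series R (circ q) q SB SA K cB cA cK BK AK v u
  (fun i => X (- n.+1%:Z, i)) (predictor phi (fun k => - (n.+1%:Z - k%:Z))) eta ov ou vB uA KB KA D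
  (fun m => adjmx (B (n + m)%N)) (fun k => btcoef B n k) Dunit _ _ _ _ etaA _ _ _ xy'.
- by move=> i; apply: clspan_gen => /=; lia.
- move=> l; apply/matrixP => a b; rewrite mxE ip_X_uvec; last lia.
  rewrite eqr_opp eqz_nat; case: l => [|l]; first by rewrite addn0 eqxx.
  by rewrite eqSS -[X in X == _]addn0 eqn_add2l /= mxE.
- by move=> l j; rewrite grammC gramm_uv adjmxN BE [(l + j)%N]addnC.
- move=> l; rewrite grammC -adjmxN; congr adjmx; apply/matrixP => a b.
  rewrite [LHS]mxE ip_expv_uvec [RHS]mxE BE; congr (- ubeta _ a b); lia.
- apply/matrixP => a b; rewrite [LHS]mxE (ip_hvec_expv h2 hF) ?[RHS]mxE; last lia.
  by rewrite lt_eqF//; lia.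
- by move=> i; apply: predictor_in => // k j hk; apply: clspan_gen => /=; lia.
- by move=> i; apply: predictor_in => // k j hk; apply: clspan_gen => /=; lia.
- by [].
- move=> k j /=; congr mxsum; apply/funext => l; rewrite adjmxK addn1 -addnA -addnS.
  by case: odd.
rewrite (_ : (fun k j => _) = fun k j => btcoef B n k.*2 j *m adjmx (B (n + j)%N)); last first.
  by apply/funext => k; apply/funext => j; rewrite -mul2n.
split; [exact: h1|exact: h3|].
rewrite -h4 (@gramm_predictor _ _ _ C).
    by rewrite mulmxK.
  move=> k i j hk; rewrite (ip_hvec_expv h2 hF); last lia.
  congr (if _ then _ else _); apply/eqP/eqP; lia.
Qed.

End prediction.

(** * From the process to the circle *)

Section outer_facts.
Context {R : realType}.
Variable q : nat.
Notation lmu := (@lebesgue_measure R).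
Notation arc := (@circle_arc R : set (measurableTypeR R)).
Implicit Types f w : R[i] -> 'M[R[i]]_q.

Lemma hardy2mx_L2 f : hardy2mx f -> forall i j, inL2 lmu arc (fun x => f (expi x) i j).
Proof. by move=> hf i j; case: (hf i j). Qed.

Lemma hardy2mx_meas f : hardy2mx f -> forall i j, cmeasurable arc (fun x => f (expi x) i j).
Proof. by move=> hf i j; case: (hardy2mx_L2 hf i j). Qed.

Lemma meas_ln_det f : hardy2mx f -> @measurable_fun _ _ (measurableTypeR R) R arc
  (fun x => ln (normc (\det (f (expi x))) ^+ 2)).
Proof.
move=> hf; apply: measurableT_comp; first exact: measurable_ln.
by apply: measurable_funX; apply: measurable_normc; apply: cmeas_det; exact: hardy2mx_meas.
Qed.

Lemma normc_gt0 (z : R[i]) : (0 < normc z) = (z != 0).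
Proof.
rewrite lt_neqAle normc_ge0 andbT eq_sym; congr negb.
by apply/eqP/eqP => [/normc_eq0|->]; rewrite ?normc0.
Qed.

Lemma det_mulJ (A : 'M[R[i]]_q) : \det (A *m adjmx A) = (normc (\det A) ^+ 2)%:C%C.
Proof. by rewrite det_mulmx det_adjmx mulcJ. Qed.

(** The mean of log |det f| is finite, whereas [lne] would be -oo at a singular f 0. Squares are
    used because |det|^2 is what the Gram matrices provide. *)
Lemma outer_mean f : outer f -> {ae lmu, forall x : R, arc x -> \det (f (expi x)) != 0} ->
  rint lmu arc (fun x => ln (normc (\det (f (expi x))) ^+ 2)) ->
  f 0 \in unitmx /\ RI lmu arc (fun x => ln (normc (\det (f (expi x))) ^+ 2)) =
    2 * pi * ln (normc (\det (f 0)) ^+ 2).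
Proof.
move=> [hf fo] d0 Il.
pose n x := normc (\det (f (expi x))).
have mn : @measurable_fun _ _ (measurableTypeR R) R arc n.
  by apply: measurable_normc; apply: cmeas_det; exact: hardy2mx_meas.
have ml : @measurable_fun _ _ (measurableTypeR R) R arc (fun x => ln (n x)).
  by apply: measurableT_comp; first exact: measurable_ln.
have l2 : {ae lmu, forall x : R, arc x -> 2^-1 * ln (n x ^+ 2) = ln (n x)}.
  apply: ae_sub d0 => x hx /hx dx; have := @lnXn R 2 (n x); rewrite normc_gt0 => /(_ dx) ->.
  by rewrite -(mulr_natl (ln (n x)) 2) mulKf// pnatr_eq0.
have IL := rint_ae marc ml l2 (rintZ marc 2^-1 Il).
have RL : RI lmu arc (fun x => ln (n x)) = 2^-1 * RI lmu arc (fun x => ln (n x ^+ 2)).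
  rewrite -(RI_Z marc _ Il); apply/esym/(RI_ae marc _ ml l2).
  exact: rint_meas (rintZ marc 2^-1 Il).
have E : (\int[lmu]_(x in arc) lne (n x)%:E = (RI lmu arc (fun x => ln (n x)))%:E)%E.
  rewrite -(RI_EFin marc IL); apply: ae_eq_integral; first exact: marc.
  - rewrite (_ : (fun x => _) = fun x => if n x <= 0 then -oo%E else (ln (n x))%:E)//.
    apply: measurable_fun_if; first exact: marc.
    + by apply: measurable_fun_ler => //; exact: measurable_cst.
    + exact: measurable_cst.
    + apply: measurable_funS (proj2 (measurable_EFinP _ _) ml); [exact: marc|by []].
  - exact/measurable_EFinP.
  - by apply: ae_sub d0 => x hx /hx dx; rewrite lne_EFin// normc_gt0.
move: fo; rewrite -/(n _) E -EFinM; case: (eqVneq (\det (f 0)) 0) => [->|dn].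
  by rewrite normc0 le0_lneNy.
rewrite lne_EFin ?normc_gt0// => -[fo]; split; first by rewrite unitmxE unitfE.
have := @lnXn R 2 (normc (\det (f 0))); rewrite normc_gt0 => /(_ dn) ->; rewrite fo RL.
have pn0 : pi != 0 :> R by rewrite lt0r_neq0// pi_gt0.
rewrite -/(n _); move: (RI _ _ _) => I; rewrite -(mulr_natl (_ * (_ * I)) 2).
by move: (pi : R) pn0 => p pn0; field.
Qed.

Lemma logdet_outer w f : hardy2mx f -> logdet_L1 w -> ae_circle (fun z => w z = f z *m adjmx (f z)) ->
  {ae lmu, forall x : R, arc x -> \det (f (expi x)) != 0} /\
  rint lmu arc (fun x => ln (normc (\det (f (expi x))) ^+ 2)).
Proof.
move=> hf Iw wf.
have h1 : {ae lmu, forall x : R, arc x -> \det (f (expi x)) != 0}.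
  have := ae_and (integrable_ae marc Iw) wf; apply: ae_sub => x [h1 h2] Ax.
  have := h1 Ax; rewrite (h2 Ax) det_mulJ /=.
  by apply: contraTneq => ->; rewrite normc0 expr0n /= lexx.
split=> //.
pose G x : R := fine (lne (complex.Re (\det (w (expi x))))%:E).
have IG : rint lmu arc G.
  have mw := measurable_int lmu Iw.
  apply: (le_integrable marc _ _ Iw).
    by apply/measurable_EFinP; apply: (measurableT_comp (f := fine)) => //; exact: fine_measurable.
  by move=> x _; rewrite /G; case: (lne _) => [r| |] //=; rewrite ?lexx// normr0 leey.
apply: (rint_ae marc (meas_ln_det hf) _ IG).
apply: ae_sub (ae_and h1 wf) => x [dx wx] Ax.
by rewrite /G (wx Ax) det_mulJ /= lt_geF ?exprn_gt0 ?normc_gt0 ?dx.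
Qed.

End outer_facts.

(** * The process and its model on the circle *)

Section representation.
Context d (T : measurableType d) {R : realType} (P : probability T R) (q : nat).
Variable X : int -> T -> 'cV[R[i]]_q.
Hypothesis X_L2 : forall k j, inL2 P setT (fun t => X k t j 0).
Notation L2P := (@L2H _ T R 1 P setT measurableT 1 ltr01).
Notation pf v t := (@L2fun _ T R 1 P setT measurableT v t 0 0).

Fact pvec_L2 (p : int * 'I_q) : (fun t => \row_(j < 1) X p.1 t p.2 0) \in @isL2 _ T R 1 P setT measurableT.
Proof. by apply/isL2P => j; under eq_fun do rewrite mxE. Qed.

Definition pvec (p : int * 'I_q) : L2P := MkL2 (pvec_L2 p).

Lemma pvecE p t : pf (pvec p) t = X p.1 t p.2 0.
Proof. by rewrite [LHS]mxE. Qed.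

Lemma pf_sum I (r : seq I) (Q : pred I) (F : I -> L2P) t :
  pf (\sum_(i <- r | Q i) F i) t = \sum_(i <- r | Q i) pf (F i) t.
Proof.
elim/big_rec2 : _ => [|i y1 y2 _ <-]; first by rewrite [LHS]mxE.
exact: L2funD.
Qed.

Lemma pip (v w : L2P) : ip v w = cintegral P setT (fun t => pf v t * (pf w t)^*).
Proof. by rewrite /ip /= /L2ip big_ord_recl big_ord0 addr0 rmorph1 mul1r. Qed.

Lemma pnrm2 (v : L2P) : nrm2 v = RI P setT (fun t => normc (pf v t) ^+ 2).
Proof. by rewrite [LHS]Re_L2ip big_ord_recl big_ord0 addr0 mul1r. Qed.

Lemma pvec_gram (p p' : int * 'I_q) : ip (pvec p) (pvec p') = gram P (X p.1) (X p'.1) p.2 p'.2.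
Proof.
rewrite pip mxE; apply: eq_CI => t _; rewrite !pvecE.
by rewrite mxE big_ord_recl big_ord0 addr0 adjmxE.
Qed.

Lemma clspan_pvec (K : set int) (v : L2P) :
  clspan pvec (fun p => K p.1) v <-> Mspan P X K (fun t => pf v t).
Proof.
have dist (s : L2P) (S : T -> R[i]) : (forall t, pf s t = S t) -> nrm2 (v - s) =
    RI P setT (fun t => normc (pf v t - S t) ^+ 2).
  by move=> hs; rewrite pnrm2; apply: eq_RI => t _; rewrite L2funB hs.
have Idist (s : L2P) (S : T -> R[i]) : (forall t, pf s t = S t) ->
    rint P setT (fun t => normc (pf v t - S t) ^+ 2).
  move=> hs; have := inL2_rint (L2_inL2 (v - s) 0).
  by apply: (eq_rint measurableT) => t _; rewrite L2funB hs.
split=> [cv|[_ hv] e e0].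
  split; first exact: L2_inL2.
  move=> e e0; have e1 : 0 < Num.sqrt e by rewrite sqrtr_gt0.
  have [s ls] := cv _ e1; rewrite nrm_lt2 ?sqrtr_ge0// sqr_sqrtr ?(ltW e0)// => hs.
  have [r [hK hr]] : exists r : seq (R[i] * int * 'I_q), (forall a, a \in r -> K a.1.2) /\
      forall t, pf s t = \sum_(a <- r) a.1.1 * X a.1.2 t a.2 0.
    elim: ls => [|a [k j] w Kk _ [r [hK hr]]].
      by exists [::]; split=> // t; rewrite big_nil [LHS]mxE.
    exists ((a, k, j) :: r); split=> [b|t].
      by rewrite inE => /orP[/eqP-> //|/hK].
    by rewrite big_cons -hr [LHS]L2funD L2funZ pvecE.
  exists r; split=> //; rewrite (RI_EFin measurableT (Idist s _ hr)) lte_fin.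
  by rewrite -(dist s _ hr).
have [r [hK hr]] := hv (e ^+ 2) (exprn_gt0 2 e0).
pose s : L2P := \sum_(a <- r) a.1.1 *: pvec (a.1.2, a.2).
have sE t : pf s t = \sum_(a <- r) a.1.1 * X a.1.2 t a.2 0.
  by rewrite pf_sum; apply: eq_bigr => a _; rewrite L2funZ pvecE.
exists s.
  rewrite /s; elim: r hK {hr s sE} => [|a r ih] hK; first by rewrite big_nil; exact: lspan0.
  rewrite big_cons; apply: lspanS; first by apply: hK; rewrite inE eqxx.
  by apply: ih => b br; apply: hK; rewrite inE br orbT.
rewrite nrm_lt2 ?(ltW e0)// (dist s _ sE) -lte_fin.
by rewrite -(RI_EFin measurableT (Idist s _ sE)).
Qed.

Variables (w h : R[i] -> 'M[R[i]]_q).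
Notation lmu := (@lebesgue_measure R).
Notation arc := (@circle_arc R : set (measurableTypeR R)).
Hypothesis hL2 : forall i j, inL2 lmu arc (fun x => h (expi x) i j).
Hypothesis wL1 : inL1_circle w.
Hypothesis Xw : forall m n : int, gram P (X m) (X n) =
  circle_int (fun x => expi (- ((m - n)%:~R * x)) *: w (expi x)).
Hypothesis wh : ae_circle (fun z => w z = h z *m adjmx (h z)).
Notation Xh := (hvec (fun x => h (expi x))).

Lemma hvec_pvec p p' : ip (Xh p) (Xh p') = ip (pvec p) (pvec p').
Proof.
rewrite pvec_gram Xw mxE fn_ip; congr (_ * _).
rewrite -(CI_sum marc); last by move=> j _; apply: (inL2_mulJ marc); exact: fn_L2.
have mw i j : cmeasurable arc (fun x => w (expi x) i j) by case: (wL1 i j).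
have mh i j : cmeasurable arc (fun x => h (expi x) i j) by case: (hL2 i j).
transitivity (cintegral lmu arc
    (fun x => expi (- ((p.1 - p'.1)%:~R * x)) * (h (expi x) *m adjmx (h (expi x))) p.2 p'.2)).
  apply: eq_CI => x _; rewrite mxE mulr_sumr; apply: eq_bigr => j _.
  rewrite !(hvecE hL2) adjmxE rmorphM /= -expiN opprK mulrACA -expiD; congr (expi _ * _).
  by rewrite rmorphB /=; ring.
apply: (CI_ae marc).
- apply: cmeasM; first exact: cmeas_expiN.
  by apply: cmeas_mulmx => //; exact: cmeas_adjmx.
- under eq_fun do rewrite mxE.
  by apply: cmeasM; [exact: cmeas_expiN|exact: mw].
- by apply: ae_sub wh => x hx /hx ->; rewrite [RHS]mxE.
Qed.

Lemma hvec_inter (K K' K'' : set int) : Mspan P X K `&` Mspan P X K' = Mspan P X K'' ->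
  forall v, clspan Xh (fun p => K p.1) v -> clspan Xh (fun p => K' p.1) v -> clspan Xh (fun p => K'' p.1) v.
Proof.
move=> hX; apply: (@clspan_inter_transport R _ L2P _ Xh pvec _ _ _ hvec_pvec) => v.
by move=> /clspan_pvec h1 /clspan_pvec h2; apply/clspan_pvec; rewrite -hX.
Qed.

Lemma hvec_proj (K : set int) (n : nat) (phi : nat -> 'M[R[i]]_q) (m : nat -> int) (m0 : int) :
  is_proj P X K (X m0) (fun t => \sum_(1 <= k < n.+1) phi k *m X (m k) t) ->
  forall i z, clspan Xh (fun p => K p.1) z ->
    ip (Xh (m0, i) - predictor (fun x => h (expi x)) n phi m i) z = 0.
Proof.
move=> pX i z Kz.
suff H p : K p.1 -> ip (Xh (m0, i) - predictor (fun x => h (expi x)) n phi m i) (Xh p) = 0.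
  rewrite ipC; apply/eqP; rewrite conjC_eq0; apply/eqP.
  apply: (clspan_sub (csub_orth _) _ Kz) => p /H hp.
  by rewrite ipC hp conjC0.
move=> Kp; pose V : L2P := pvec (m0, i) - \sum_(1 <= k < n.+1) \sum_j phi k i j *: pvec (m k, j).
transitivity (ip V (pvec p)).
  rewrite !ipBl hvec_pvec !ip_suml; congr (_ - _); apply: eq_bigr => k _.
  by rewrite !ip_suml; apply: eq_bigr => j _; rewrite !ipZl hvec_pvec.
have [_ /(_ (fun t => pf (pvec p) t))] := pX i.
rewrite pip => <-; last by apply/clspan_pvec; exact: clspan_gen.
apply: eq_CI => t _; congr (_ * _); rewrite L2funB pvecE pf_sum summxE; congr (_ - _).
apply: eq_bigr => k _; rewrite mxE pf_sum; apply: eq_bigr => j _.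
by rewrite L2funZ pvecE.
Qed.

End representation.

(** * The unitary factor relating the two outer functions *)

Section reversal.
Context {R : realType}.
Variable q : nat.
Notation lmu := (@lebesgue_measure R).
Notation arc := (@circle_arc R : set (measurableTypeR R)).
Variables w h ht : R[i] -> 'M[R[i]]_q.
Hypotheses (hh : hardy2mx h) (hht : hardy2mx ht).
Hypothesis wh : ae_circle (fun z => w z = h z *m adjmx (h z)).
Hypothesis wht : ae_circle (fun z => time_reversal w z = ht z *m adjmx (ht z)).
Hypothesis h_det : {ae lmu, forall x : R, arc x -> \det (h (expi x)) != 0}.
Hypothesis h_log : rint lmu arc (fun x => ln (normc (\det (h (expi x))) ^+ 2)).

Let factors : {ae lmu, forall x : R, arc x ->
  h (expi x) *m adjmx (h (expi x)) = ht (expi (- x)) *m adjmx (ht (expi (- x)))}.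
Proof.
have := ae_and wh (ae_reflect wht); apply: ae_sub => x [h1 h2] Ax.
by rewrite -(h1 Ax) -(h2 Ax) /time_reversal -expiN opprK.
Qed.

Let dets : {ae lmu, forall x : R, arc x ->
  normc (\det (h (expi x))) ^+ 2 = normc (\det (ht (expi (- x)))) ^+ 2}.
Proof.
apply: ae_sub factors => x hx /hx /(congr1 (fun M => complex.Re (\det M))).
by rewrite !det_mulJ.
Qed.

Lemma reversed_det : {ae lmu, forall x : R, arc x -> \det (ht (expi (- x))) != 0}.
Proof.
apply: ae_sub (ae_and h_det dets) => x [d1 d2] Ax.
move: (d1 Ax); apply: contra_neq => d0; have := d2 Ax.
by rewrite d0 normc0 expr0n /= => /eqP; rewrite sqrf_eq0 => /eqP; exact: normc_eq0.
Qed.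

(** Both factorisations give the same determinant, so |det ht(e^(-ix))| = |det h(e^(ix))| almost
    everywhere, and the reflection preserves integrability. *)
Lemma reversed_logdet : {ae lmu, forall x : R, arc x -> \det (ht (expi x)) != 0} /\
  rint lmu arc (fun x => ln (normc (\det (ht (expi x))) ^+ 2)).
Proof.
have h1 := ae_reflect reversed_det; have h2 := ae_reflect dets.
split; first by apply: ae_sub h1 => x; rewrite opprK.
apply: (rint_ae marc (meas_ln_det hht) _ (rint_reflect h_log)).
by apply: ae_sub h2 => x hx /hx ->; rewrite opprK.
Qed.

(** U = ht(e^(-ix))^-1 h(e^(ix)) satisfies U U^* = 1 almost everywhere, both outer functions being
    factors of w at the same point. [measurable_patch] makes this true everywhere, and U^* is the
    integrand h^* h_sharp^-1 of beta. *)
Lemma unitary_factor : exists U : R -> 'M[R[i]]_q, [/\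
  forall i j, cmeasurable arc (fun x => U x i j),
  forall x, U x *m adjmx (U x) = 1%:M,
  {ae lmu, forall x : R, arc x -> h (expi x) = ht (expi (- x)) *m U x} &
  forall n, beta_coef h ht n = ubeta U n].
Proof.
have mh := hardy2mx_meas hh.
have mht i j : cmeasurable arc (fun x => ht (expi (- x)) i j).
  by case: (hardy2mx_meas hht i j) => m1 m2; split; [exact: (meas_reflect m1)|exact: (meas_reflect m2)].
pose V x := invmx (ht (expi (- x))) *m h (expi x).
have mV i j : cmeasurable arc (fun x => V x i j).
  by apply: cmeas_mulmx => //; exact: (cmeas_invmx marc).
have VV : {ae lmu, forall x : R, arc x -> V x *m adjmx (V x) = 1%:M}.
  apply: ae_sub (ae_and factors reversed_det) => x [fx dx] Ax.
  have ux : ht (expi (- x)) \in unitmx by rewrite unitmxE unitfE dx.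
  rewrite /V adjmxM -mulmxA [h _ *m _]mulmxA (fx Ax) -!mulmxA -adjmxM (mulVmx ux) adjmx1 mulmx1.
  exact: mulVmx.
have [U [mU UV UN]] := @measurable_patch R q V (fun x => V x *m adjmx (V x)) 1%:M 1%:M mV
  (cmeas_mulmx mV (cmeas_adjmx mV)).
have UVae : {ae lmu, forall x : R, arc x -> U x = V x}.
  by apply: ae_sub VV => x hx /hx; exact: UV.
exists U; split => //.
- move=> x; have [e|ne] := pselect (V x *m adjmx (V x) = 1%:M); first by rewrite UV.
  by rewrite UN// adjmx1 mulmx1.
- apply: ae_sub (ae_and UVae reversed_det) => x [Ux dx] Ax.
  by rewrite (Ux Ax) /V mulKVmx// unitmxE unitfE dx.
- move=> n; apply/matrixP => i j; rewrite !mxE; congr (- (_ * _)).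
  apply: (CI_ae marc).
  + under eq_fun do rewrite mxE.
    apply: cmeasM; first exact: cmeas_expiN.
    apply: cmeas_mulmx; first exact: cmeas_adjmx.
    apply: (cmeas_invmx marc); rewrite /hsharp; apply: cmeas_adjmx => a b.
    by under eq_fun do rewrite -expiN; exact: mht.
  + by apply: cmeasM; [exact: cmeas_expiN|exact: cmeasJ].
  + apply: ae_sub (ae_and UVae reversed_det) => x [Ux dx] Ax.
    have ux : ht (expi (- x)) \in unitmx by rewrite unitmxE unitfE dx.
    rewrite mxE (Ux Ax) -adjmxE /V adjmxM /hsharp -expiN adjmx_inv//.
Qed.

End reversal.

Theorem theorem5p2 (R : realType) (d : measure_display) (T : measurableType d)
    (P : probability T R) (q : nat) (q_gt0 : (0 < q)%N)
    (X : int -> T -> 'cV[complex R]_q) (X_stationary : stationary P X)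
    (w : complex R -> 'M[complex R]_q) (w_density : spectral_density P X w)
    (w_logdet : logdet_L1 w)
    (X_intersection : forall n : nat, (0 < n)%N ->
       Mspan P X [set k | k <= -1] `&` Mspan P X [set k | - n%:Z <= k] =
       Mspan P X [set k | - n%:Z <= k <= -1])
    (h ht : complex R -> 'M[complex R]_q)
    (h_outer : outer_factor w h) (ht_outer : outer_factor (time_reversal w) ht)
    (phi phit : nat -> nat -> 'M[complex R]_q)
    (phi_coeffs : forall n, (0 < n)%N -> forward_coeffs P X n (phi n))
    (phit_coeffs : forall n, (0 < n)%N -> backward_coeffs P X n (phit n))
    (n : nat) (n_gt0 : (0 < n)%N) :
  eq_double_series (phi n n) (h 0) (invmx (ht 0))
    (fun k j => bcoef (beta_coef h ht) n (2 * k) j *m beta_coef h ht (n + j)%N) /\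
  eq_double_series (phit n n) (ht 0) (invmx (h 0))
    (fun k j => btcoef (beta_coef h ht) n (2 * k) j *m adjmx (beta_coef h ht (n + j)%N)).
Proof.
have [X2 _ _] := X_stationary; have [w1 _ Xw] := w_density.
have [[hh ho] wh] := h_outer; have [[hht hto] wht] := ht_outer.
have [hd hl] := logdet_outer hh w_logdet wh.
have [htd htl] := reversed_logdet hht wh wht hd hl.
have [hu hm] := outer_mean (conj hh ho) hd hl.
have [htu htm] := outer_mean (conj hht hto) htd htl.
have hL2 := hardy2mx_L2 hh; have htL2 := hardy2mx_L2 hht.
have hF i j k := hardy2_fourier k (hh i j).
have htF i j k := hardy2_fourier k (hht i j).
have hI := innovation hL2 hF hu hd hl hm.
have htI := innovation htL2 htF htu htd htl htm.
have [U [mU UU hU bU]] := unitary_factor hh hht wh wht hd.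
have hX := hvec_inter X2 hL2 w1 Xw wh (X_intersection n n_gt0).
split.
- apply: (forward_series hL2 htL2 hF htF hu htu hI htI mU UU hU n_gt0 bU) => i z Az Bz.
  apply: (hvec_proj X2 hL2 w1 Xw wh (phi_coeffs n n_gt0)).
  exact: hX.
- apply: (backward_series hL2 htL2 hF htF hu htu hI htI mU UU hU n_gt0 bU) => i z Az Bz.
  apply: (hvec_proj X2 hL2 w1 Xw wh (phit_coeffs n n_gt0)).
  exact: hX.
Qed.
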